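(* Let $\alpha\in[0,1]$ and let $W^{(0)},W,V$ be the generating functions described in the context. Then the $\alpha$-curvelet system $$\mathcal{C}_\alpha(W^{(0)},W,V)=\{\psi_{0,k}:k\in\mathbb{Z}^2\}\cup\{\psi_{j,\ell,k}: j\in\mathbb{N},\ k\in\mathbb{Z}^2,\ \ell\in\{0,1,\dots,L_j-1\}\}$$ constitutes a tight frame for $L^2(\mathbb{R}^2)$.
   Context: A system $(\varphi_\lambda)_\lambda\subset L^2(\mathbb{R}^2)$ is a tight frame if there is $A>0$ with $\sum_\lambda|\langle f,\varphi_\lambda\rangle|^2=A\|f\|_2^2$ for all $f\in L^2(\mathbb{R}^2)$. Fourier transform: $\widehat f(\xi)=\int f(x)e^{-2\pi i x\cdot\xi}dx$. $\mathbb{N}=\{1,2,\dots\}$. Construction of $\alpha$-curvelets. Radial part: let $\widetilde W^{(0)},\widetilde W:\mathbb{R}_+\to[0,1]$ be $C^\infty$ with $\operatorname{supp}\widetilde W^{(0)}\subset[0,2]$, $\widetilde W^{(0)}=1$ on $[0,\frac32]$, $\operatorname{supp}\widetilde W\subset[\frac12,2]$, $\widetilde W=1$ on $[\frac34,\frac32]$. Put $\widetilde W^{(j)}(r)=\widetilde W(2^{-j}r)$ for $j\in\mathbb{N}$ and $W^{(j)}(r)=\widetilde W^{(j)}(8\pi r)$ for $j\in\mathbb{N}_0$. Angular part: $L_j=2^{\lfloor j(1-\alpha)\rfloor}$, $\omega_j=\pi2^{-\lfloor j(1-\alpha)\rfloor}$, $\omega_{j,\ell}=\ell\omega_j$ for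 $\ell\in\{0,\dots,L_j-1\}$, $R_{j,\ell}=\begin{pmatrix}\cos\omega_{j,\ell}&-\sin\omega_{j,\ell}\\ \sin\omega_{j,\ell}&\cos\omega_{j,\ell}\end{pmatrix}$. Let $V:\mathbb{R}\to[0,1]$ be $C^\infty$ with $\operatorname{supp}V\subset[-\frac34\pi,\frac34\pi]$ and $V=1$ on $[-\frac\pi2,\frac\pi2]$. Identifying $[-\pi,\pi]$ with $\mathbb{S}^1$ via $t\mapsto e^{it}$, let $\widetilde V^{(j,0)}:\mathbb{S}^1\to[0,1]$ be the restriction of $V(2^{\lfloor j(1-\alpha)\rfloor}\cdot)$ to $[-\pi,\pi]$; put $V^{(j,0)}(\xi)=\widetilde V^{(j,0)}(\xi)+\widetilde V^{(j,0)}(-\xi)$ and $V^{(j,\ell)}(\xi)=V^{(j,0)}(R_{j,\ell}\xi)$ for $\xi\in\mathbb{S}^1$. With $\Psi(\xi)=W^{(0)}(|\xi|)^2+\sum_{j\in\mathbb{N}}\sum_{\ell=0}^{L_j-1}W^{(j)}(|\xi|)^2V^{(j,\ell)}(\xi/|\xi|)^2$ ($|\xi|$ the Euclidean norm) set $\chi_0(\xi)=W^{(0)}(|\xi|)/\sqrt{\Psi(\xi)}$ and $\chi_{j,\ell}(\xi)=W^{(j)}(|\xi|)V^{(j,\ell)}(\xi/|\xi|)/\sqrt{\Psi(\xi)}$. Define $\psi_0,\psi_{j,\ell}$ by $\widehat\psi_0=\chi_0$, $\widehat\psi_{j,\ell}=\chi_{j,\ell}$, and with $D_s=\operatorname{diag}(s,s^\alpha)$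 put $\psi_{0,k}=\psi_0(\cdot-k)$ and $\psi_{j,\ell,k}=2^{-j(1+\alpha)/2}\psi_{j,\ell}(\cdot-x_{j,\ell,k})$, $x_{j,\ell,k}=R_{j,\ell}^{-1}D_{2^j}^{-1}k$, $k\in\mathbb{Z}^2$. *)

(* Defs.v *)
From mathcomp Require Import all_boot all_order all_algebra.
From mathcomp Require Import ring complex.
From mathcomp Require Import all_classical all_reals all_analysis.

Set Implicit Arguments.
Unset Strict Implicit.
Unset Printing Implicit Defensive.

Import Order.TTheory GRing.Theory Num.Theory.
Import numFieldNormedType.Exports.

Local Open Scope classical_set_scope.
Local Open Scope complex_scope.
Local Open Scope ring_scope.

Section plane.
Context {R : realType}.
Implicit Types (x y : R * R) (f g h : R * R -> R[i]).

Definition dot x y : R := x.1 * y.1 + x.2 * y.2.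

Definition enorm x : R := Num.sqrt (dot x x).

Definition rotv (t : R) x : R * R :=
  (cos t * x.1 - sin t * x.2, sin t * x.1 + cos t * x.2).

Lemma rotvK t : cancel (rotv t) (rotv (- t)).
Proof.
move=> [a b]; rewrite /rotv /= cosN sinN.
by congr pair; [rewrite -[RHS]mul1r -(cos2Dsin2 t)|
  rewrite -[RHS]mul1r -(cos2Dsin2 t)]; ring.
Qed.

(* D_s^{-1} with D_s = diag(s, s^alpha) *)
Definition dil_inv (alpha s : R) x : R * R := (s^-1 * x.1, (s `^ alpha)^-1 * x.2).

(* The inverse of the identification t |-> e^{it} of [-pi, pi] (with endpoints
   glued) with the unit circle; the common image of -pi and pi is sent to pi.
   Only meaningful for u on the unit circle. *)
Definition angle (u : R * R) : R := if 0 <= u.2 then acos u.1 else - acos u.1.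

Lemma angleK t : - pi < t <= pi -> angle (cos t, sin t) = t.
Proof.
move=> /andP[tgt tle]; rewrite /angle /=; case: ifPn.
- move=> s0; have [t0|t0] := leP 0 t; first by rewrite cosK // in_itv /= t0 tle.
  have : 0 < sin (- t) by apply: sin_gt0_pi; rewrite oppr_gt0 t0 ltrNl tgt.
  by rewrite sinN oppr_gt0 ltNge s0.
- rewrite -ltNge => s0; have [t0|t0] := leP 0 t.
    by have := @sin_ge0_pi R t; rewrite t0 tle leNgt s0 => /(_ isT).
  by rewrite -cosN cosK ?opprK // in_itv /= oppr_ge0 (ltW t0) lerNl ltW.
Qed.

Definition leb2 := ((@lebesgue_measure R) \x (@lebesgue_measure R))%E.

(* R[i] carries no measurable structure: measurability, integrals and norms of
   complex functions are expressed through real and imaginary parts and the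
   modulus. *)
Definition cmeasurable f :=
  measurable_fun setT (fun x => complex.Re (f x)) /\
  measurable_fun setT (fun x => complex.Im (f x)).

Definition cmod (z : R[i]) : R := ComplexField.Normc.normc z.

Definition cLnorm (p : \bar R) f : \bar R := Lnorm leb2 p (fun x => (cmod (f x))%:E).

Definition inLp (p : \bar R) f := cmeasurable f /\ (cLnorm p f < +oo)%E.

Definition cintegral f : R[i] :=
  (\int[leb2]_x complex.Re (f x)) +i* (\int[leb2]_x complex.Im (f x)).

Definition inner f g : R[i] := cintegral (fun x => f x * (g x)^*).

Definition expi (t : R) : R[i] := cos t +i* sin t.

Definition fourier f (xi : R * R) : R[i] :=
  cintegral (fun x => f x * expi (- (2 * pi * dot x xi))).

(* g is the Fourier-Plancherel transform of f, i.e. (f, g) lies in the L^2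
   closure of the graph of the Fourier integral on L^1 and L^2. *)
Definition is_fourier2 f g :=
  [/\ inLp 2%:E f, inLp 2%:E g &
      exists u : nat -> R * R -> R[i],
        [/\ forall n, inLp 1%:E (u n) /\ inLp 2%:E (u n),
            (fun n => cLnorm 2%:E (fun x => u n x - f x)) @ \oo --> 0%E &
            (fun n => cLnorm 2%:E (fun xi => fourier (u n) xi - g xi))
              @ \oo --> 0%E]].

(* A representative of the L^2 function whose transform is g. The Plancherel
   transform is onto L^2, so the default value is irrelevant for g in L^2. *)
Definition inv_fourier2 g : R * R -> R[i] :=
  xget (fun=> 0) [set f | is_fourier2 f g].

(* The system is the family (phi l) for l in D. *)
Definition tight_frame (I : choiceType) (D : set I) (phi : I -> R * R -> R[i]) :=
  (forall l, D l -> inLp 2%:E (phi l)) /\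
  exists A : R, 0 < A /\
    forall f, inLp 2%:E f ->
      (\esum_(l in D) (cmod (inner f (phi l)) ^+ 2)%:E =
       A%:E * cLnorm 2%:E f ^+ 2)%E.

End plane.

Section generators.
Context {R : realType}.

Definition smooth (f : R -> R) := forall n x, derivable (derive1n n f) x 1.

(* C^oo on the closed half-line [0, +oo[, as restriction of a smooth function *)
Definition smooth_Rplus (f : R -> R) :=
  exists g, smooth g /\ forall r : R, 0 <= r -> g r = f r.

(* W0 and W are functions on [0, +oo[: their values on negative numbers are
   neither constrained nor used. *)
Record curvelet_generators (W0 W V : R -> R) : Prop := CurveletGenerators {
  W0_smooth : smooth_Rplus W0;
  W0_range : forall r : R, 0 <= r -> 0 <= W0 r <= 1;
  W0_supp : closure [set r : R | 0 <= r /\ W0 r != 0] `<=` `[0, 2];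
  W0_one : forall r : R, 0 <= r <= 3 / 2 -> W0 r = 1;
  W_smooth : smooth_Rplus W;
  W_range : forall r : R, 0 <= r -> 0 <= W r <= 1;
  W_supp : closure [set r : R | 0 <= r /\ W r != 0] `<=` `[1 / 2, 2];
  W_one : forall r : R, 3 / 4 <= r <= 3 / 2 -> W r = 1;
  V_smooth : smooth V;
  V_range : forall t : R, 0 <= V t <= 1;
  V_supp : closure [set t : R | V t != 0] `<=` `[- (3 / 4 * pi), 3 / 4 * pi];
  V_one : forall t : R, - (pi / 2) <= t <= pi / 2 -> V t = 1 }.

End generators.

Section curvelets.
Context {R : realType}.
Variables (alpha : R) (W0 W V : R -> R).

(* floor (j (1 - alpha)), a natural number since alpha <= 1 *)
Definition ang_level (j : nat) : nat := Num.truncn (j%:R * (1 - alpha)).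

Definition nrot (j : nat) : nat := 2 ^ ang_level j.

Definition omega (j l : nat) : R := l%:R * (pi * 2 ^- ang_level j).

(* W0 and W stand for the functions written with a tilde in the construction *)
Definition Wt (j : nat) (r : R) : R := if j is 0 then W0 r else W (2 ^- j * r).

Definition Wrad (j : nat) (r : R) : R := Wt j (8 * pi * r).

Definition Vt (j : nat) (u : R * R) : R := V (2 ^+ ang_level j * angle u).

Definition Vang0 (j : nat) (u : R * R) : R := Vt j u + Vt j (- u).

Definition Vang (j l : nat) (u : R * R) : R := Vang0 j (rotv (omega j l) u).

(* xi / |xi|; at xi = 0 its value is irrelevant, as Wrad j 0 = 0 for j > 0 *)
Definition dir (xi : R * R) : R * R := (xi.1 / enorm xi, xi.2 / enorm xi).

(* locally finite sum of nonnegative terms *)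
Definition Psi (xi : R * R) : R :=
  Wrad 0 (enorm xi) ^+ 2 +
  fine (\sum_(1 <= j <oo)
    (\sum_(l < nrot j) Wrad j (enorm xi) ^+ 2 * Vang j l (dir xi) ^+ 2)%R%:E)%E.

Definition chi0 (xi : R * R) : R := Wrad 0 (enorm xi) / Num.sqrt (Psi xi).

Definition chi (j l : nat) (xi : R * R) : R :=
  Wrad j (enorm xi) * Vang j l (dir xi) / Num.sqrt (Psi xi).

Definition psi0 : R * R -> R[i] := inv_fourier2 (fun xi => (chi0 xi)%:C).

Definition psi (j l : nat) : R * R -> R[i] :=
  inv_fourier2 (fun xi => (chi j l xi)%:C).

Definition int2 (k : int * int) : R * R := (k.1%:~R, k.2%:~R).

Definition grid (j l : nat) (k : int * int) : R * R :=
  rotv (- omega j l) (dil_inv alpha (2 ^+ j) (int2 k)).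

(* inl k indexes psi_{0,k} and inr (j, l, k) indexes psi_{j,l,k} *)
Definition curvelet_index : choiceType :=
  ((int * int) + (nat * nat * (int * int)))%type.

Definition curvelet_indices : set curvelet_index :=
  [set i | match i with
           | inl _ => True
           | inr (j, l, _) => (0 < j)%N /\ (l < nrot j)%N
           end].

Definition curvelet (i : curvelet_index) : R * R -> R[i] :=
  match i with
  | inl k => fun x => psi0 (x - int2 k)
  | inr (j, l, k) =>
      fun x => (2 `^ (- (j%:R * (1 + alpha) / 2)))%:C * psi j l (x - grid j l k)
  end.

End curvelets.

(* Main.v *)
(* Write <f, psi_(j,l,k)> = <hat f, w * chi_(j,l) * exp(-2 pi i <x_k, .>)>. The
   multiplier chi_(j,l) has its support inside the image of the unit square
   centred at 0 under a linear map h of determinant w^-2 (dilation by D_(2^j),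
   then rotation) whose transpose sends x_k to k, so Parseval's identity for
   Fourier series on the square gives, for fixed (j, l),
     sum_k |<f, psi_(j,l,k)>|^2 = ||hat f * chi_(j,l)||^2.
   The squares of the multipliers add up to 1, as Psi >= 1 is a locally finite
   sum, so summation over (j, l) and Plancherel's identity give the frame
   constant 1. It suffices to treat bounded f with bounded support, because the
   frame identity with constant 1 on a dense subspace extends to L^2.

   For the Fourier analysis itself: Fourier series of Lipschitz functions converge
   pointwise, by Bessel's inequality for difference quotients, whence Parseval's
   identity for them, then for bounded functions by averaging, and then on the
   square. Plancherel's identity is Parseval's identity on a large square, applied
   to the modulations of f and integrated over them. *)

(* The constants meet at one threshold. The factor [8 * pi] in the radial windows confines the
   multiplier at scale j to [4 * pi * |xi| <= 2^j], so its first coordinate in the chart is at most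
   1/(4 pi). The angular support [3/4 * pi], with the factor 2 lost in the floor of [j (1 - alpha)],
   leaves 3/8 for the second. The room between 3/8 and 1/2 is spent on the Fourier series: averages
   over steps of at most 1/16 widen the support to 7/16, and then [t - x] stays within 15/16 for t
   in the unit interval and x in the support, away from the other zeros of exp(2 pi i s) - 1.

   The multipliers enter only as bounded measurable functions of bounded support, so the curvelets
   are known only as square-integrable functions, chosen among the inverse transforms. Hence
   translations are moved to a bounded test function, and the passage to frequencies is the
   polarized Plancherel identity. Inverse transforms have to exist only for such multipliers, and
   there the multiplication formula replaces Fourier inversion. *)
Require Import Defs.
From mathcomp Require Import all_boot all_order all_algebra.
From mathcomp Require Import ring lra complex.
From mathcomp Require Import all_classical all_reals all_analysis measurable_realfun.
From HB Require Import structures.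

Set Implicit Arguments.
Unset Strict Implicit.
Unset Printing Implicit Defensive.

Import Order.TTheory GRing.Theory Num.Theory.
Import numFieldNormedType.Exports.

Local Open Scope classical_set_scope.
Local Open Scope complex_scope.
Local Open Scope ring_scope.

(** * Complex-valued measurable and square-integrable functions *)

Section sqm.
Context {R : realType}.
Implicit Types (z w : R[i]) (a b : R).

Definition sqm z : R := complex.Re z ^+ 2 + complex.Im z ^+ 2.

Lemma cmod_sqr z : cmod z ^+ 2 = sqm z.
Proof.
by case: z => a b; rewrite /cmod /sqm /= sqr_sqrtr // addr_ge0 ?sqr_ge0.
Qed.

Lemma cmod_ge0 z : 0 <= cmod z.
Proof. by case: z => a b; rewrite /cmod /= sqrtr_ge0. Qed.

Lemma sqm_ge0 z : 0 <= sqm z.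
Proof. by rewrite /sqm addr_ge0 ?sqr_ge0. Qed.

Lemma sqm0 : sqm 0 = 0.
Proof. by rewrite /sqm /= expr0n /= addr0. Qed.

Lemma sqm_eq0 z : sqm z = 0 -> z = 0.
Proof.
case: z => a b; rewrite /sqm /= => /eqP; rewrite paddr_eq0 ?sqr_ge0 //.
by rewrite !sqrf_eq0 => /andP[/eqP -> /eqP ->].
Qed.

Lemma sqmM z w : sqm (z * w) = sqm z * sqm w.
Proof. by case: z w => [a b] [c d]; rewrite /sqm /=; ring. Qed.

Lemma sqmN z : sqm (- z) = sqm z.
Proof. by case: z => [a b]; rewrite /sqm /=; ring. Qed.

Lemma sqm_conj z : sqm z^*%C = sqm z.
Proof. by case: z => [a b]; rewrite /sqm /=; ring. Qed.

Lemma sqmR a : sqm a%:C = a ^+ 2.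
Proof. by rewrite /sqm /= expr0n /= addr0. Qed.

Lemma sqm_expi a : sqm (expi a) = 1.
Proof. by rewrite /sqm /= cos2Dsin2. Qed.

Lemma mul_conjC z : z * z^*%C = (sqm z)%:C.
Proof. by case: z => [a b]; rewrite /sqm /=; apply/eqP; rewrite eq_complex /=; apply/andP; split; apply/eqP; ring. Qed.

(** In each coordinate the right side exceeds the left by [d^-1 * (d * x - y) ^+ 2]. The free weight
    lets the first constant come arbitrarily close to 1, which limits of norms require. *)
Lemma sqmD_le (d : R) z w : 0 < d -> sqm (z + w) <= (1 + d) * sqm z + (1 + d^-1) * sqm w.
Proof.
move=> d0; case: z w => [a b] [a' b']; rewrite /sqm /=.
have sq x y : (x + y) ^+ 2 <= (1 + d) * x ^+ 2 + (1 + d^-1) * y ^+ 2.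
  rewrite -subr_ge0 (_ : _ - _ = d^-1 * (d * x - y) ^+ 2); last by field; rewrite gt_eqF.
  by rewrite mulr_ge0 ?sqr_ge0 // invr_ge0 ltW.
by have := sq a a'; have := sq b b'; lra.
Qed.

Lemma sqmD2 z w : sqm (z + w) <= 2 * sqm z + 2 * sqm w.
Proof. by have := sqmD_le z w (@ltr01 R); rewrite invr1. Qed.

Lemma Re_sq_le z : complex.Re z ^+ 2 <= sqm z.
Proof. by rewrite /sqm lerDl sqr_ge0. Qed.

Lemma Im_sq_le z : complex.Im z ^+ 2 <= sqm z.
Proof. by rewrite /sqm lerDr sqr_ge0. Qed.

Lemma ReD z w : complex.Re (z + w) = complex.Re z + complex.Re w.
Proof. by case: z w => [a b] [c d]. Qed.
Lemma ImD z w : complex.Im (z + w) = complex.Im z + complex.Im w.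
Proof. by case: z w => [a b] [c d]. Qed.
Lemma ReN z : complex.Re (- z) = - complex.Re z.
Proof. by case: z. Qed.
Lemma ImN z : complex.Im (- z) = - complex.Im z.
Proof. by case: z. Qed.
Lemma ReM z w : complex.Re (z * w) = complex.Re z * complex.Re w - complex.Im z * complex.Im w.
Proof. by case: z w => [a b] [c d]. Qed.
Lemma ImM z w : complex.Im (z * w) = complex.Re z * complex.Im w + complex.Im z * complex.Re w.
Proof. by case: z w => [a b] [c d]. Qed.
Lemma ReJ z : complex.Re z^*%C = complex.Re z.
Proof. by case: z. Qed.
Lemma ImJ z : complex.Im z^*%C = - complex.Im z.
Proof. by case: z. Qed.

Lemma complexP z w : complex.Re z = complex.Re w -> complex.Im z = complex.Im w -> z = w.
Proof. by case: z w => [a b] [c d] /= -> ->. Qed.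

Lemma conjcN z : (- z)^*%C = - z^*%C.
Proof. by apply: complexP; rewrite !(ReJ, ImJ, ReN, ImN). Qed.

Lemma conjcM z w : (z * w)^*%C = z^*%C * w^*%C.
Proof. by apply: complexP; rewrite !(ReJ, ImJ, ReM, ImM); ring. Qed.

Lemma expiD a b : expi (a + b) = expi a * expi b.
Proof. by apply: complexP; rewrite !(ReM, ImM) /= ?cosD ?sinD; ring. Qed.

Lemma expi0 : expi (0 : R) = 1.
Proof. by apply: complexP; rewrite /= ?cos0 ?sin0. Qed.

Lemma expiN a : expi (- a) = (expi a)^*%C.
Proof. by apply: complexP; rewrite /= ?cosN ?sinN. Qed.

End sqm.

Section cmf.
Context d (T : measurableType d) {R : realType}.
Implicit Types f g : T -> R[i].

(** [cmeasurable] over any measurable space: slices on the line and kernels on a product of two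
    planes occur besides functions on the plane. *)
Definition cmf f :=
  measurable_fun setT (fun x => complex.Re (f x)) /\
  measurable_fun setT (fun x => complex.Im (f x)).

Lemma cmf_cst z : cmf (fun=> z).
Proof. by split; exact: measurable_cst. Qed.

Lemma cmfR (a : T -> R) : measurable_fun setT a -> cmf (fun x => (a x)%:C).
Proof. by move=> ma; split => //=; exact: measurable_cst. Qed.

Lemma cmfD f g : cmf f -> cmf g -> cmf (fun x => f x + g x).
Proof.
move=> [f1 f2] [g1 g2]; split; under eq_fun do rewrite ?ReD ?ImD;
  exact: measurable_funD.
Qed.

Lemma cmfN f : cmf f -> cmf (fun x => - f x).
Proof.
by move=> [f1 f2]; split; under eq_fun do rewrite ?ReN ?ImN;
  exact: measurable_funN.
Qed.

Lemma cmfB f g : cmf f -> cmf g -> cmf (fun x => f x - g x).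
Proof. by move=> mf mg; apply: cmfD => //; exact: cmfN. Qed.

Lemma cmfM f g : cmf f -> cmf g -> cmf (fun x => f x * g x).
Proof.
move=> [f1 f2] [g1 g2]; split; under eq_fun do rewrite ?ReM ?ImM.
  by apply: measurable_funB; exact: measurable_funM.
by apply: measurable_funD; exact: measurable_funM.
Qed.

Lemma cmfJ f : cmf f -> cmf (fun x => (f x)^*%C).
Proof.
move=> [f1 f2]; split; first by under eq_fun do rewrite ReJ.
by under eq_fun do rewrite ImJ; exact: measurable_funN.
Qed.

Lemma cmf_expi (a : T -> R) : measurable_fun setT a -> cmf (fun x => expi (a x)).
Proof.
move=> ma; split.
  exact: (measurableT_comp (continuous_measurable_fun (@continuous_cos R))).
exact: (measurableT_comp (continuous_measurable_fun (@continuous_sin R))).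
Qed.

Lemma measurable_sqm f : cmf f -> measurable_fun setT (fun x => sqm (f x)).
Proof.
by move=> [f1 f2]; apply: measurable_funD; exact: measurable_funX.
Qed.

Lemma cmf_sum (I : Type) (s : seq I) (f : I -> T -> R[i]) :
  (forall i, cmf (f i)) -> cmf (fun x => \sum_(i <- s) f i x).
Proof.
move=> mf; elim: s => [|i s IH].
  by under eq_fun do rewrite big_nil; exact: cmf_cst.
by under eq_fun do rewrite big_cons; exact: cmfD.
Qed.

End cmf.

Lemma cmf_comp d d' (T : measurableType d) (T' : measurableType d') (R : realType)
  (f : T -> R[i]) (h : T' -> T) :
  cmf f -> measurable_fun setT h -> cmf (fun x => f (h x)).
Proof. by move=> [f1 f2] mh; split; [move: f1|move: f2] => /measurableT_comp; apply. Qed.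

Lemma eq_integrableT d (T : measurableType d) (R : realType)
  (mu : {measure set T -> \bar R}) (f g : T -> \bar R) :
  mu.-integrable setT f -> f =1 g -> mu.-integrable setT g.
Proof. by move=> + /funext <-. Qed.

Section cint.
Context d (T : measurableType d) {R : realType}.
Context (mu : {measure set T -> \bar R}).
Implicit Types f g h : T -> R[i].

Definition cint f : R[i] :=
  (\int[mu]_x complex.Re (f x)) +i* (\int[mu]_x complex.Im (f x)).

Definition cintegrable f :=
  mu.-integrable setT (fun x => (complex.Re (f x))%:E) /\
  mu.-integrable setT (fun x => (complex.Im (f x))%:E).

Lemma le_cintegrable f (a : T -> R) : cmf f -> mu.-integrable setT (EFin \o a) ->
  (forall x, 0 <= a x) -> (forall x, sqm (f x) <= a x ^+ 2) -> cintegrable f.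
Proof.
move=> [f1 f2] ia a0 fa; split; apply: (le_integrable measurableT _ _ ia).
- exact/measurable_EFinP.
- move=> x _ /=; rewrite lee_fin (ger0_norm (a0 x)).
  rewrite -(@ler_pXn2r _ 2) ?nnegrE // real_normK ?num_real //.
  exact: le_trans (Re_sq_le _) (fa x).
- exact/measurable_EFinP.
- move=> x _ /=; rewrite lee_fin (ger0_norm (a0 x)).
  rewrite -(@ler_pXn2r _ 2) ?nnegrE // real_normK ?num_real //.
  exact: le_trans (Im_sq_le _) (fa x).
Qed.

Lemma cintegrableD f g : cintegrable f -> cintegrable g -> cintegrable (fun x => f x + g x).
Proof.
move=> [f1 f2] [g1 g2]; split.
  by apply: (eq_integrableT (integrableD measurableT f1 g1)) => // x; rewrite ReD.
by apply: (eq_integrableT (integrableD measurableT f2 g2)) => // x; rewrite ImD.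
Qed.

Lemma cintegrableZ z f : cintegrable f -> cintegrable (fun x => z * f x).
Proof.
move=> [f1 f2]; split.
  apply: (eq_integrableT (integrableB measurableT (integrableZl measurableT (complex.Re z) f1)
    (integrableZl measurableT (complex.Im z) f2))) => // x /=.
  by rewrite ReM EFinB !EFinM.
apply: (eq_integrableT (integrableD measurableT (integrableZl measurableT (complex.Re z) f2)
  (integrableZl measurableT (complex.Im z) f1))) => // x /=.
by rewrite ImM EFinD !EFinM.
Qed.

Lemma cintegrableN f : cintegrable f -> cintegrable (fun x => - f x).
Proof. by under [X in _ -> cintegrable X]eq_fun do rewrite -mulN1r; exact: cintegrableZ. Qed.

Lemma cintegrable0 : cintegrable (fun=> 0).
Proof. by split; exact: integrable0. Qed.

Lemma cintegrable_sum (I : Type) (s : seq I) (f : I -> T -> R[i]) :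
  (forall i, cintegrable (f i)) -> cintegrable (fun x => \sum_(i <- s) f i x).
Proof.
move=> mf; elim: s => [|i s IH].
  by under eq_fun do rewrite big_nil; exact: cintegrable0.
by under eq_fun do rewrite big_cons; exact: cintegrableD.
Qed.

Lemma eq_cint f g : f =1 g -> cint f = cint g.
Proof. by move=> /funext ->. Qed.

Lemma cintD f g : cintegrable f -> cintegrable g ->
  cint (fun x => f x + g x) = cint f + cint g.
Proof.
move=> [f1 f2] [g1 g2]; apply: complexP; rewrite ?ReD ?ImD /=.
  by under eq_Rintegral do rewrite ReD; rewrite RintegralD.
by under eq_Rintegral do rewrite ImD; rewrite RintegralD.
Qed.

Lemma cintZ z f : cintegrable f -> cint (fun x => z * f x) = z * cint f.
Proof.
move=> [f1 f2].
have Zl a (b : T -> R) : mu.-integrable setT (EFin \o b) ->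
    mu.-integrable setT (EFin \o (fun x => a * b x)).
  by move=> ib; apply: (eq_integrableT (integrableZl measurableT a ib)).
apply: complexP; rewrite ?ReM ?ImM /=.
  by under eq_Rintegral do rewrite ReM; rewrite RintegralB ?RintegralZl //; exact: Zl.
by under eq_Rintegral do rewrite ImM; rewrite RintegralD ?RintegralZl //; exact: Zl.
Qed.

Lemma cintN f : cintegrable f -> cint (fun x => - f x) = - cint f.
Proof. by move=> fi; under eq_cint do rewrite -mulN1r; rewrite cintZ // mulN1r. Qed.

Lemma cintB f g : cintegrable f -> cintegrable g ->
  cint (fun x => f x - g x) = cint f - cint g.
Proof. by move=> fi gi; rewrite cintD ?cintN //; exact: cintegrableN. Qed.

Lemma cintJ f : cintegrable f -> cint (fun x => (f x)^*%C) = (cint f)^*%C.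
Proof.
move=> [f1 f2]; apply: complexP; rewrite ?ReJ ?ImJ /=.
  by under eq_Rintegral do rewrite ReJ.
under eq_Rintegral do rewrite ImJ -mulN1r.
by rewrite RintegralZl // mulN1r.
Qed.

Lemma cint0 : cint (fun=> 0) = 0.
Proof. by apply: complexP; rewrite /= Rintegral_cst // mul0r. Qed.

Lemma cint_sum (I : Type) (s : seq I) (f : I -> T -> R[i]) :
  (forall i, cintegrable (f i)) ->
  cint (fun x => \sum_(i <- s) f i x) = \sum_(i <- s) cint (f i).
Proof.
move=> fi; elim: s => [|i s IH].
  by rewrite big_nil; under eq_cint do rewrite big_nil; rewrite cint0.
rewrite big_cons; under eq_cint do rewrite big_cons.
by rewrite cintD ?IH //; exact: cintegrable_sum.
Qed.

(** Real and imaginary parts are estimated separately, which costs the factor 2. This is harmless,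
    as the bound only serves to show that a transform is bounded. *)
Lemma sqm_cint_le f (a : T -> R) : cmf f -> mu.-integrable setT (EFin \o a) ->
  (forall x, 0 <= a x) -> (forall x, sqm (f x) <= a x ^+ 2) ->
  sqm (cint f) <= 2 * (\int[mu]_x a x) ^+ 2.
Proof.
move=> mf ia a0 fa; have [f1 f2] := le_cintegrable mf ia a0 fa.
have H (b : T -> R) : mu.-integrable setT (EFin \o b) -> (forall x, b x ^+ 2 <= sqm (f x)) ->
    (\int[mu]_x b x) ^+ 2 <= (\int[mu]_x a x) ^+ 2.
  move=> ib bf; rewrite -[leLHS]real_normK ?num_real // ler_pXn2r ?nnegrE //; last first.
    by apply: Rintegral_ge0 => x _; exact: a0.
  apply: le_trans (le_normr_Rintegral measurableT ib) _.
  apply: le_Rintegral => //.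
    by apply: (eq_integrableT (integrable_norm ib)).
  move=> x _; rewrite -(@ler_pXn2r _ 2) ?nnegrE // real_normK ?num_real //.
  exact: le_trans (bf x) (fa x).
rewrite /sqm /= [2 * _]mulr_natl mulr2n; apply: lerD; apply: H => // x; [exact: Re_sq_le|exact: Im_sq_le].
Qed.

End cint.

Section L2.
Context d (T : measurableType d) {R : realType}.
Context (mu : {measure set T -> \bar R}).
Implicit Types f g h : T -> R[i].

(** The squared norm, with extended real values so that it can be compared before it is known to be
    finite. *)
Definition n2 f : \bar R := (\int[mu]_x (sqm (f x))%:E)%E.

Definition L2 f := cmf f /\ (n2 f < +oo)%E.

Definition inn f g : R[i] := cint mu (fun x => f x * (g x)^*%C).

Lemma n2_ge0 f : (0 <= n2 f)%E.
Proof. by apply: integral_ge0 => x _; rewrite lee_fin sqm_ge0. Qed.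

Lemma L2_cmf f : L2 f -> cmf f.
Proof. by case. Qed.

Lemma L2_integrable f : L2 f -> mu.-integrable setT (EFin \o (fun x => sqm (f x))).
Proof.
move=> [mf nf]; apply/integrableP; split; first exact/measurable_EFinP/measurable_sqm.
rewrite (_ : (fun x => _) = (fun x => (sqm (f x))%:E)) //.
by apply/funext => x /=; rewrite ger0_norm ?sqm_ge0.
Qed.

Lemma n2_fin f : L2 f -> n2 f \is a fin_num.
Proof. by move=> [mf nf]; rewrite ge0_fin_numE ?n2_ge0. Qed.

Lemma n2_EFin f : L2 f -> n2 f = (fine (n2 f))%:E.
Proof. by move=> /n2_fin /fineK. Qed.

Lemma fine_n2_ge0 f : 0 <= fine (n2 f).
Proof. exact: fine_ge0 (n2_ge0 f). Qed.

Lemma eq_n2 f g : (forall x, sqm (f x) = sqm (g x)) -> n2 f = n2 g.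
Proof. by move=> fg; apply: eq_integral => x _; rewrite fg. Qed.

Lemma le_n2 f g : cmf f -> cmf g -> (forall x, sqm (f x) <= sqm (g x)) -> (n2 f <= n2 g)%E.
Proof.
move=> mf mg fg; apply: ge0_le_integral => //.
- by move=> x _; rewrite lee_fin sqm_ge0.
- exact/measurable_EFinP/measurable_sqm.
- exact/measurable_EFinP/measurable_sqm.
- by move=> x _; rewrite lee_fin.
Qed.

Lemma n2N f : n2 (fun x => - f x) = n2 f.
Proof. by apply: eq_n2 => x; rewrite sqmN. Qed.

Lemma n2_distC f g : n2 (fun x => f x - g x) = n2 (fun x => g x - f x).
Proof. by apply: eq_n2 => x; rewrite -sqmN opprB. Qed.

Lemma n2J f : n2 (fun x => (f x)^*%C) = n2 f.
Proof. by apply: eq_n2 => x; rewrite sqm_conj. Qed.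

Lemma n2Z z f : cmf f -> n2 (fun x => z * f x) = ((sqm z)%:E * n2 f)%E.
Proof.
move=> mf; rewrite /n2 -ge0_integralZl_EFin ?sqm_ge0 //.
- by apply: eq_integral => x _; rewrite sqmM EFinM.
- by move=> x _; rewrite lee_fin sqm_ge0.
- exact/measurable_EFinP/measurable_sqm.
Qed.

Lemma n2D_le (e : R) f g : 0 < e -> cmf f -> cmf g ->
  (n2 (fun x => (f x + g x)%R) <= (1 + e)%:E * n2 f + (1 + e^-1)%:E * n2 g)%E.
Proof.
move=> e0 mf mg.
have mf' : measurable_fun setT (fun x => (sqm (f x))%:E) by exact/measurable_EFinP/measurable_sqm.
have mg' : measurable_fun setT (fun x => (sqm (g x))%:E) by exact/measurable_EFinP/measurable_sqm.
have e1 : 0 <= 1 + e by rewrite addr_ge0 // ltW.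
have e2 : 0 <= 1 + e^-1 by rewrite addr_ge0 // invr_ge0 ltW.
rewrite /n2 -!ge0_integralZl_EFin //; try by move=> x _; rewrite lee_fin sqm_ge0.
rewrite -ge0_integralD //; first last.
- exact: measurable_funeM.
- by move=> x _; rewrite mule_ge0 // lee_fin ?sqm_ge0.
- exact: measurable_funeM.
- by move=> x _; rewrite mule_ge0 // lee_fin ?sqm_ge0.
apply: ge0_le_integral => //.
- by move=> x _; rewrite lee_fin sqm_ge0.
- exact/measurable_EFinP/measurable_sqm/cmfD.
- by apply: emeasurable_funD; exact: measurable_funeM.
- by move=> x _; rewrite -!EFinM -EFinD lee_fin sqmD_le.
Qed.

Lemma n2D_le2 f g : cmf f -> cmf g ->
  (n2 (fun x => (f x + g x)%R) <= 2%:E * n2 f + 2%:E * n2 g)%E.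
Proof.
by move=> mf mg; have := n2D_le (@ltr01 R) mf mg; rewrite invr1 -[1 + 1]/(2%R).
Qed.

Lemma L2D f g : L2 f -> L2 g -> L2 (fun x => f x + g x).
Proof.
move=> Lf Lg; have [mf _] := Lf; have [mg _] := Lg.
split; first exact: cmfD.
apply: le_lt_trans (n2D_le2 mf mg) _.
by rewrite (n2_EFin Lf) (n2_EFin Lg) -!EFinM -EFinD ltry.
Qed.

Lemma L2Z z f : L2 f -> L2 (fun x => z * f x).
Proof.
move=> Lf; have [mf nf] := Lf; split; first by apply: cmfM => //; exact: cmf_cst.
by rewrite n2Z // (n2_EFin Lf) -EFinM ltry.
Qed.

Lemma L2N f : L2 f -> L2 (fun x => - f x).
Proof. by move=> [mf nf]; split; [exact: cmfN|rewrite n2N]. Qed.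

Lemma L2B f g : L2 f -> L2 g -> L2 (fun x => f x - g x).
Proof. by move=> Lf Lg; apply: L2D => //; exact: L2N. Qed.

Lemma L20 : L2 (fun=> 0).
Proof. by split; [exact: cmf_cst|rewrite /n2 sqm0 integral0 ltry]. Qed.

Lemma L2_sum (I : Type) (s : seq I) (f : I -> T -> R[i]) :
  (forall i, L2 (f i)) -> L2 (fun x => \sum_(i <- s) f i x).
Proof.
move=> mf; elim: s => [|i s IH].
  by under eq_fun do rewrite big_nil; exact: L20.
by under eq_fun do rewrite big_cons; exact: L2D.
Qed.

Lemma le_L2 f g : cmf f -> L2 g -> (forall x, sqm (f x) <= sqm (g x)) -> L2 f.
Proof.
move=> mf [mg ng] fg; split => //; apply: le_lt_trans ng; exact: le_n2.
Qed.

Lemma L2_cintegrable f g : L2 f -> L2 g -> cintegrable mu (fun x => f x * (g x)^*%C).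
Proof.
move=> Lf Lg; have [mf _] := Lf; have [mg _] := Lg.
apply: (@le_cintegrable _ _ _ _ _ (fun x => sqm (f x) + sqm (g x))).
- by apply: cmfM => //; exact: cmfJ.
- apply: (eq_integrableT (integrableD measurableT (L2_integrable Lf) (L2_integrable Lg))) => x //.
- by move=> x; rewrite addr_ge0 // sqm_ge0.
- move=> x; rewrite sqmM sqm_conj; have := sqm_ge0 (f x); have := sqm_ge0 (g x).
  by move: (sqm _) (sqm _) => a b; nra.
Qed.

Lemma innDl f g h : L2 f -> L2 g -> L2 h -> inn (fun x => f x + g x) h = inn f h + inn g h.
Proof.
move=> Lf Lg Lh; rewrite -cintD; [|exact: L2_cintegrable..].
by apply: eq_cint => x; rewrite mulrDl.
Qed.

Lemma innZl z f h : L2 f -> L2 h -> inn (fun x => z * f x) h = z * inn f h.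
Proof.
move=> Lf Lh; rewrite -cintZ; last exact: L2_cintegrable.
by apply: eq_cint => x; rewrite mulrA.
Qed.

Lemma innBl f g h : L2 f -> L2 g -> L2 h -> inn (fun x => f x - g x) h = inn f h - inn g h.
Proof.
move=> Lf Lg Lh; rewrite -cintB; [|exact: L2_cintegrable..].
by apply: eq_cint => x; rewrite mulrBl.
Qed.

Lemma innC f g : L2 f -> L2 g -> inn g f = (inn f g)^*%C.
Proof.
move=> Lf Lg; rewrite -cintJ; last exact: L2_cintegrable.
by apply: eq_cint => x; rewrite conjcM conjcK mulrC.
Qed.

Lemma inn_suml (I : Type) (s : seq I) (f : I -> T -> R[i]) h :
  (forall i, L2 (f i)) -> L2 h ->
  inn (fun x => \sum_(i <- s) f i x) h = \sum_(i <- s) inn (f i) h.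
Proof.
move=> Lf Lh; rewrite -cint_sum => [|i]; last exact: L2_cintegrable.
by apply: eq_cint => x; rewrite mulr_suml.
Qed.

Lemma n2D f g : L2 f -> L2 g ->
  fine (n2 (fun x => f x + g x)) = fine (n2 f) + fine (n2 g) + 2 * complex.Re (inn f g).
Proof.
move=> Lf Lg; have [If _] := L2_cintegrable Lf Lg.
have IR : mu.-integrable setT (EFin \o (fun x => 2 * complex.Re (f x * (g x)^*%C))).
  exact: (eq_integrableT (integrableZl measurableT 2 If)).
have Ifg : mu.-integrable setT (EFin \o (fun x => sqm (f x) + sqm (g x))).
  exact: (eq_integrableT (integrableD measurableT (L2_integrable Lf) (L2_integrable Lg))).
rewrite /inn /= -RintegralZl //.
have -> : fine (n2 f) + fine (n2 g) = \int[mu]_x (sqm (f x) + sqm (g x)).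
  by rewrite RintegralD //; exact: L2_integrable.
rewrite -RintegralD //; apply: eq_Rintegral => x _.
by case: (f x) (g x) => [a b] [c e]; rewrite /sqm /=; ring.
Qed.

Lemma n2B f g : L2 f -> L2 g ->
  fine (n2 (fun x => f x - g x)) = fine (n2 f) + fine (n2 g) - 2 * complex.Re (inn f g).
Proof.
move=> Lf Lg; rewrite n2D //; last exact: L2N.
rewrite n2N -mulrN; congr (_ + 2 * _); rewrite -ReN /inn -cintN; last exact: L2_cintegrable.
by congr complex.Re; apply: eq_cint => x; rewrite conjcN mulrN.
Qed.

Lemma fine_n2Z z f : L2 f -> fine (n2 (fun x => z * f x)) = sqm z * fine (n2 f).
Proof. by move=> Lf; rewrite n2Z; [rewrite (n2_EFin Lf)|exact: L2_cmf]. Qed.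

Lemma innZr z f h : L2 f -> L2 h -> inn f (fun x => z * h x) = z^*%C * inn f h.
Proof. by move=> Lf Lh; rewrite innC ?innZl //; [rewrite conjcM -innC|exact: L2Z]. Qed.

(** The quadratic polynomial in [t] given by the squared norm of [f - t p g], with [p] the inner
    product, is nonnegative; it is evaluated at its minimum. *)
Lemma cauchy_schwarz f g : L2 f -> L2 g -> sqm (inn f g) <= fine (n2 f) * fine (n2 g).
Proof.
move=> Lf Lg; set p := inn f g; set a := fine (n2 f); set b := fine (n2 g).
have key (t : R) : 0 <= a + t ^+ 2 * sqm p * b - 2 * t * sqm p.
  have L : L2 (fun x => (t%:C * p) * g x) by exact: L2Z.
  have := fine_n2_ge0 (fun x => f x - (t%:C * p) * g x).
  rewrite n2B // fine_n2Z // innZr // sqmM sqmR -/p -/a -/b.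
  have -> : complex.Re ((t%:C * p)^*%C * p) = t * sqm p.
    by case: (p) => u v; rewrite /sqm /=; ring.
  by rewrite mulrA.
have a0 : 0 <= a := fine_n2_ge0 f; have b0 : 0 <= b := fine_n2_ge0 g.
have p0 := sqm_ge0 p.
have [bE|bn0] := eqVneq b 0.
  rewrite bE mulr0 leNgt; apply/negP => pp.
  (* For [b = 0] the polynomial is affine in [t], and its value here, [a - 2 * (a + 1)], is
     negative. *)
  have := key ((a + 1) / sqm p).
  rewrite bE mulr0 addr0 -!mulrA mulVf ?gt_eqF // mulr1.
  by lra.
have bp : 0 < b by rewrite lt_def bn0.
(* The minimum over [t] is at [1 / b]. *)
have := key b^-1; rewrite (_ : a + _ - _ = a - sqm p / b); last by field.
by rewrite subr_ge0 ler_pdivrMr.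
Qed.

(* Subtracting the orthogonal projection onto the span of the [phi i]. *)
Lemma bessel (I : eqType) (s : seq I) (phi : I -> T -> R[i]) f :
  uniq s -> (forall i, L2 (phi i)) ->
  (forall i j, inn (phi i) (phi j) = (i == j)%:R) -> L2 f ->
  \sum_(i <- s) sqm (inn f (phi i)) <= fine (n2 f).
Proof.
move=> us Lphi ort Lf.
pose g s x := f x - \sum_(i <- s) inn f (phi i) * phi i x.
have Lg s' : L2 (g s') by apply: L2B => //; apply: L2_sum => i; exact: L2Z.
suff : fine (n2 (g s)) = fine (n2 f) - \sum_(i <- s) sqm (inn f (phi i)).
  by move=> e; have := fine_n2_ge0 (g s); rewrite e subr_ge0.
elim: s us => [_|i s IH /= /andP[nis us]].
  rewrite big_nil subr0; congr fine; apply: eq_n2 => x.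
  by rewrite /g big_nil subr0.
rewrite big_cons opprD addrCA [RHS]addrC -IH //.
have -> : g (i :: s) = fun x => g s x - inn f (phi i) * phi i x.
  by apply/funext => x; rewrite /g big_cons opprD addrA addrAC.
have Li : L2 (fun x => inn f (phi i) * phi i x) by exact: L2Z.
have n1 : fine (n2 (phi i)) = 1.
  have := ort i i; rewrite eqxx => /(congr1 (@complex.Re R)) /= <-.
  by congr fine; apply: eq_integral => x _; rewrite mul_conjC.
rewrite n2B // fine_n2Z // n1 mulr1 innZr //.
have -> : inn (g s) (phi i) = inn f (phi i).
  rewrite /g innBl //; last by apply: L2_sum => j; exact: L2Z.
  rewrite inn_suml => [|j|//]; last exact: L2Z.
  rewrite big_seq big1 ?subr0 // => j js.
  rewrite innZl // ort; case: eqP => [ji|_]; last by rewrite mulr0.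
  by move: nis; rewrite -ji js.
by rewrite [_^*%C * _]mulrC mul_conjC /=; ring.
Qed.

End L2.

(* The weights 1 + t and 1 + 1/t come from (x + y)^2 <= (1 + t) x^2 + (1 + 1/t) y^2. *)
Lemma approx_le (R : realType) (a b : \bar R) (p : nat -> \bar R) (e e' : nat -> \bar R) :
  (0 <= b)%E -> (forall n, 0 <= p n)%E ->
  e @ \oo --> 0%E -> e' @ \oo --> 0%E ->
  (forall (t : R) n, (0 < t)%R -> a <= (1 + t)%:E * p n + (1 + t^-1)%:E * e n)%E ->
  (forall (t : R) n, (0 < t)%R -> p n <= (1 + t)%:E * b + (1 + t^-1)%:E * e' n)%E ->
  (a <= b)%E.
Proof.
move=> b0 p0 ce ce' ap pb.
have [->|boo] := eqVneq b +oo%E; first exact: leey.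
have bE : b = (fine b)%:E by rewrite fineK // fin_numE boo -ltNye (lt_le_trans _ b0) ?ltNyr.
have st (t : R) : 0 < t -> (a <= ((1 + t) * (1 + t) * fine b)%:E)%E.
  move=> t0.
  have cv : (fun n => ((1 + t) * (1 + t) * fine b)%:E + ((1 + t) * (1 + t^-1))%:E * e' n +
      (1 + t^-1)%:E * e n)%E @ \oo --> ((1 + t) * (1 + t) * fine b)%:E.
    rewrite -[X in _ --> X]adde0; apply: cvgeD => //; last first.
      by rewrite -[X in _ --> X](mule0 (1 + t^-1)%:E); apply: cvgeZl.
    rewrite -[X in _ --> X]adde0; apply: cvgeD => //; first exact: cvg_cst.
    by rewrite -[X in _ --> X](mule0 ((1 + t) * (1 + t^-1))%:E); apply: cvgeZl.
  apply: (cvge_to_ge cv); apply: nearW => n.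
  apply: le_trans (ap t n t0) _; apply: leeD => //.
  have t1 : (0 <= (1 + t)%:E)%E by rewrite lee_fin addr_ge0 // ltW.
  apply: le_trans (lee_wpmul2l t1 (pb t n t0)) _.
  rewrite [in X in (X <= _)%E]bE -EFinM muleDr ?fin_num_adde_defr //.
  by rewrite -EFinM mulrA muleA -EFinM.
rewrite bE; apply/lee_addgt0Pr => t t0.
(* With [s <= 1] the excess of [(1 + s)^2 * b] over [b] is at most [3 * s * b], hence at most [t];
   the summand 1 in the denominator covers [b = 0]. *)
pose s := Num.min 1 (t / (3 * (fine b + 1))).
have fb0 : 0 <= fine b by exact: fine_ge0.
have fb1 : 0 < 3 * (fine b + 1) by rewrite mulr_gt0 // ltr_wpDl.
have s0 : 0 < s by rewrite lt_min ltr01 divr_gt0.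
apply: le_trans (st s s0) _; rewrite -EFinD lee_fin.
have s1 : s <= 1 by rewrite ge_min lexx.
have st' : s * (3 * (fine b + 1)) <= t by rewrite -ler_pdivlMr // ge_min lexx orbT.
by nra.
Qed.

(** * Limits of complex sequences and of integrals, measured by the squared modulus *)

Section cvgc.
Context {R : realType}.
Implicit Types (u : nat -> R[i]) (z : R[i]).

Lemma cvg_sqm_Re u z : (fun n => sqm (u n - z)) @ \oo --> (0 : R) ->
  (fun n => complex.Re (u n)) @ \oo --> complex.Re z.
Proof.
move=> h; apply/cvgrPdist_le => e e0.
move/cvgrPdist_le : h => /(_ (e ^+ 2)); rewrite exprn_gt0 // => /(_ isT).
apply: filterS => n; rewrite sub0r normrN ger0_norm ?sqm_ge0 // => h.
rewrite -(@ler_pXn2r _ 2) ?nnegrE // ?(ltW e0) // real_normK ?num_real //.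
by apply: le_trans h; rewrite -sqrrN opprB -ReN -ReD Re_sq_le.
Qed.

Lemma cvg_sqm_Im u z : (fun n => sqm (u n - z)) @ \oo --> (0 : R) ->
  (fun n => complex.Im (u n)) @ \oo --> complex.Im z.
Proof.
move=> h; apply/cvgrPdist_le => e e0.
move/cvgrPdist_le : h => /(_ (e ^+ 2)); rewrite exprn_gt0 // => /(_ isT).
apply: filterS => n; rewrite sub0r normrN ger0_norm ?sqm_ge0 // => h.
rewrite -(@ler_pXn2r _ 2) ?nnegrE // ?(ltW e0) // real_normK ?num_real //.
by apply: le_trans h; rewrite -sqrrN opprB -ImN -ImD Im_sq_le.
Qed.

Lemma cvg_sqr (v : nat -> R) (l : R) : v @ \oo --> l -> (fun n => v n ^+ 2) @ \oo --> l ^+ 2.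
Proof. by move=> h; rewrite expr2; under eq_fun do rewrite expr2; exact: cvgM. Qed.

Lemma cvg_sqmP u z : (fun n => complex.Re (u n)) @ \oo --> complex.Re z ->
  (fun n => complex.Im (u n)) @ \oo --> complex.Im z ->
  (fun n => sqm (u n - z)) @ \oo --> (0 : R).
Proof.
move=> h1 h2; rewrite -[X in _ --> X](_ : (complex.Re z - complex.Re z) ^+ 2 +
  (complex.Im z - complex.Im z) ^+ 2 = 0); last by rewrite !subrr expr0n addr0.
rewrite (_ : (fun n => _) = (fun n => (complex.Re (u n) - complex.Re z) ^+ 2 +
  (complex.Im (u n) - complex.Im z) ^+ 2)); last first.
  by apply/funext => n; rewrite /sqm ReD ImD ReN ImN.
by apply: cvgD; apply: cvg_sqr; apply: cvgB => //; exact: cvg_cst.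
Qed.

Lemma cvg_sqm u z : (fun n => sqm (u n - z)) @ \oo --> (0 : R) ->
  (fun n => sqm (u n)) @ \oo --> sqm z.
Proof.
move=> h; have h1 := cvg_sqm_Re h; have h2 := cvg_sqm_Im h.
by rewrite /sqm; apply: cvgD; exact: cvg_sqr.
Qed.

End cvgc.

Section limits.
Context d (T : measurableType d) {R : realType}.
Context (mu : {measure set T -> \bar R}).
Implicit Types (f : T -> R[i]) (fn : nat -> T -> R[i]).

Lemma n2_fatou fn f (c : \bar R) : (forall n, cmf (fn n)) ->
  (forall x, (fun n => sqm (fn n x - f x)) @ \oo --> (0 : R)) ->
  (forall n, n2 mu (fn n) <= c)%E -> (n2 mu f <= c)%E.
Proof.
move=> mf cf nc.
have := @fatou _ T R mu setT measurableT (fun n x => (sqm (fn n x))%:E) _ _.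
have -> : (fun x => limn_einf (fun n => (sqm (fn n x))%:E)) = (fun x => (sqm (f x))%:E).
  apply/funext => x.
  have cx : (fun n => (sqm (fn n x))%:E) @ \oo --> (sqm (f x))%:E.
    by apply: cvg_EFin; [exact: nearW|exact: cvg_sqm].
  by rewrite is_cvg_limn_einfE; [exact: cvg_lim cx|apply/cvg_ex; eexists; exact: cx].
move=> H; apply: le_trans (H _ _) _.
- by move=> n; exact/measurable_EFinP/measurable_sqm.
- by move=> n x _; rewrite lee_fin sqm_ge0.
rewrite limn_einf_lim; apply: lime_le; first exact: is_cvg_einfs.
apply: nearW => n; apply: le_trans (nc n).
by apply: ereal_inf_lbound; exists n => /=.
Qed.

Lemma n2_dct fn f (a : T -> R) : (forall n, cmf (fn n)) -> cmf f ->
  {ae mu, forall x, (fun n => sqm (fn n x - f x)) @ \oo --> (0 : R)} ->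
  mu.-integrable setT (EFin \o a) ->
  (forall n x, sqm (fn n x - f x) <= a x) ->
  (fun n => n2 mu (fun x => fn n x - f x)) @ \oo --> 0%E.
Proof.
move=> mfn mf cf ia fa.
have [|||||_ _] := @dominated_convergence _ T R mu setT measurableT
  (fun n x => (sqm (fn n x - f x))%:E) (cst 0%E) (EFin \o a) => //.
- by move=> n; apply/measurable_EFinP/measurable_sqm/cmfB.
- apply: filterS cf => x cx _.
  by apply: cvg_EFin; [exact: nearW|exact: cx].
- by apply: nearW => x n _ /=; rewrite lee_fin ger0_norm ?sqm_ge0.
by rewrite integral0.
Qed.

Lemma cint_dct fn f (a : T -> R) : (forall n, cmf (fn n)) -> cmf f ->
  (forall x, (fun n => sqm (fn n x - f x)) @ \oo --> (0 : R)) ->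
  mu.-integrable setT (EFin \o a) -> (forall x, 0 <= a x) ->
  (forall n x, sqm (fn n x) <= a x ^+ 2) ->
  (fun n => sqm (cint mu (fn n) - cint mu f)) @ \oo --> (0 : R).
Proof.
move=> mfn mf cf ia a0 fa.
have H (b : nat -> T -> R) (c : T -> R) : (forall n, measurable_fun setT (b n)) ->
    measurable_fun setT c -> (forall x, b ^~ x @ \oo --> c x) ->
    (forall n x, b n x ^+ 2 <= sqm (fn n x)) ->
    (fun n => \int[mu]_x b n x) @ \oo --> \int[mu]_x c x.
  move=> mb mc bc bf.
  have [|||||ic _ H1] := @dominated_convergence _ T R mu setT measurableT
    (fun n x => (b n x)%:E) (EFin \o c) (EFin \o a) => //.
  - by move=> n; apply/measurable_EFinP.
  - exact/measurable_EFinP.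
  - by apply: nearW => x _; apply: cvg_EFin; [exact: nearW|exact: bc].
  - apply: nearW => x n _ /=; rewrite lee_fin.
    rewrite -(@ler_pXn2r _ 2) ?nnegrE // real_normK ?num_real //.
    exact: le_trans (bf n x) (fa n x).
  have ic' : mu.-integrable setT (EFin \o c) by [].
  by apply: (fine_cvg _); rewrite /Rintegral fineK ?integrable_fin_num.
apply: cvg_sqmP => /=.
- apply: H => [n||x|n x]; [by case: (mfn n)|by case: mf| |exact: Re_sq_le].
  exact: cvg_sqm_Re.
- apply: H => [n||x|n x]; [by case: (mfn n)|by case: mf| |exact: Im_sq_le].
  exact: cvg_sqm_Im.
Qed.

Definition cut (A : set T) f : T -> R[i] := fun x => (\1_A x)%:C * f x.

Lemma cmf_cut A f : measurable A -> cmf f -> cmf (cut A f).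
Proof. by move=> mA mf; apply: cmfM => //; apply: cmfR. Qed.

Lemma cut_in A f x : A x -> cut A f x = f x.
Proof. by move=> Ax; rewrite /cut indicE mem_set // mul1r. Qed.

Lemma cut_out A f x : ~ A x -> cut A f x = 0.
Proof. by move=> Ax; rewrite /cut indicE memNset // mul0r. Qed.

Lemma cvg_cut (A : nat -> set T) f x : (\forall n \near \oo, A n x) ->
  (fun n => sqm (cut (A n) f x - f x)) @ \oo --> (0 : R).
Proof.
move=> h; apply: cvg_near_cst; apply: filterS h => n Anx.
by rewrite cut_in // subrr sqm0.
Qed.

Lemma n2_cut (A : nat -> set T) f : (forall n, measurable (A n)) -> L2 mu f ->
  (forall x, \forall n \near \oo, A n x) ->
  (fun n => n2 mu (fun x => cut (A n) f x - f x)) @ \oo --> 0%E.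
Proof.
move=> mA Lf cA; apply: (n2_dct (a := fun x => sqm (f x))).
- by move=> n; exact: cmf_cut (L2_cmf Lf).
- exact: L2_cmf Lf.
- by apply: nearW => x; exact: cvg_cut.
- exact: L2_integrable.
- move=> n x; have [Ax|Ax] := pselect (A n x).
    by rewrite cut_in // subrr sqm0 sqm_ge0.
  by rewrite cut_out // sub0r sqmN.
Qed.

End limits.

(** * Parseval frames *)

Section frames.
Context d (T : measurableType d) {R : realType}.
Context (mu : {measure set T -> \bar R}).
Context (I : choiceType) (D : set I) (phi : I -> T -> R[i]).
Context (Lphi : forall l, D l -> L2 mu (phi l)).

Definition fsum (f : T -> R[i]) : \bar R := (\esum_(l in D) (sqm (inn mu f (phi l)))%:E)%E.

Lemma fsum_ge0 f : (0 <= fsum f)%E.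
Proof. by apply: esum_ge0 => l _; rewrite lee_fin sqm_ge0. Qed.

Lemma fsum_le f (c : \bar R) :
  (forall s : seq I, uniq s -> (forall l, l \in s -> D l) ->
    (\sum_(l <- s) (sqm (inn mu f (phi l)))%:E <= c)%E) -> (fsum f <= c)%E.
Proof.
move=> h; apply: ge_ereal_sup => _ [X [fX XD] <-].
rewrite fsbig_finite //; apply: h; first exact: finmap.fset_uniq.
by move=> l; rewrite in_fset_set // inE => /XD.
Qed.

Lemma fsum_ge f (s : seq I) : uniq s -> (forall l, l \in s -> D l) ->
  (\sum_(l <- s) (sqm (inn mu f (phi l)))%:E <= fsum f)%E.
Proof.
move=> us sD; apply: esum_ge; exists [set` s].
  by split; [exact: finite_seq|move=> l /= /sD].
by rewrite -fsbig_seq.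
Qed.

Lemma sum_sqm_innD_le (s : seq I) (t : R) f g : 0 < t -> (forall l, l \in s -> D l) ->
  L2 mu f -> L2 mu g ->
  (\sum_(l <- s) (sqm (inn mu f (phi l)))%:E <=
   (1 + t)%:E * \sum_(l <- s) (sqm (inn mu g (phi l)))%:E +
   (1 + t^-1)%:E * \sum_(l <- s) (sqm (inn mu (fun x => f x - g x) (phi l)))%:E)%E.
Proof.
move=> t0 sD Lf Lg; rewrite !sumEFin -!EFinM -EFinD lee_fin.
rewrite !mulr_sumr -big_split /= big_seq [leRHS]big_seq; apply: ler_sum => l /sD Dl.
have -> : inn mu f (phi l) = inn mu g (phi l) + inn mu (fun x => f x - g x) (phi l).
  by rewrite innBl; [rewrite addrC subrK|by []|by []|exact: Lphi].
exact: sqmD_le.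
Qed.

(** Bessel's inequality is one half. For the other, the sum for [fn n] is compared with the sum for
    [f]; Bessel's inequality for [fn n - f] makes the error small uniformly in the finite set of
    indices. *)
Lemma fsum_lim (fn : nat -> T -> R[i]) f :
  (forall g, L2 mu g -> (fsum g <= n2 mu g)%E) -> L2 mu f ->
  (forall n, L2 mu (fn n) /\ fsum (fn n) = n2 mu (fn n)) ->
  (fun n => n2 mu (fun x => fn n x - f x)) @ \oo --> 0%E ->
  fsum f = n2 mu f.
Proof.
move=> B Lf Sfn cfn; apply/eqP; rewrite eq_le B //=.
have Lfn n : L2 mu (fn n) by case: (Sfn n).
apply: (approx_le (p := fun n => n2 mu (fn n)) (e' := fun n => n2 mu (fun x => fn n x - f x))
    (e := fun n => n2 mu (fun x => fn n x - f x))) => //.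
- exact: fsum_ge0.
- by move=> n; exact: n2_ge0.
- move=> t n t0; rewrite [in X in (_ <= _ + X)%E]n2_distC.
  have {1}-> : f = (fun x => fn n x + (f x - fn n x)).
    by apply/funext => x; rewrite addrC subrK.
  by apply: n2D_le => //; [exact: L2_cmf (Lfn n)|exact: L2_cmf (L2B Lf (Lfn n))].
- move=> t n t0; case: (Sfn n) => _ <-.
  apply: fsum_le => s us sD.
  apply: le_trans (sum_sqm_innD_le t0 sD (Lfn n) Lf) _.
  apply: leeD; apply: lee_wpmul2l.
  + by rewrite lee_fin addr_ge0 // ltW.
  + exact: fsum_ge.
  + by rewrite lee_fin addr_ge0 // invr_ge0 ltW.
  by apply: le_trans (fsum_ge _ us sD) _; apply: B; exact: L2B.
Qed.

(* The identity passes to the limit once the finite sums are controlled by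
   Cauchy-Schwarz and, as a consequence, Bessel's inequality holds on L2. *)
Lemma fsum_dense (S : set (T -> R[i])) :
  (forall f, S f -> L2 mu f /\ fsum f = n2 mu f) ->
  (forall f, L2 mu f -> exists fn : nat -> T -> R[i], (forall n, S (fn n)) /\
    (fun n => n2 mu (fun x => fn n x - f x)) @ \oo --> 0%E) ->
  forall f, L2 mu f -> fsum f = n2 mu f.
Proof.
move=> SE Sd.
have B f : L2 mu f -> (fsum f <= n2 mu f)%E.
  move=> Lf; have [fn [Sfn cfn]] := Sd f Lf.
  have Lfn n : L2 mu (fn n) by case: (SE _ (Sfn n)).
  apply: fsum_le => s us sD.
  (* [C] depends on the finite set [s], which is fixed while [n] tends to infinity. *)
  pose C := \sum_(l <- s) fine (n2 mu (phi l)).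
  apply: (approx_le (p := fun n => n2 mu (fn n)) (e' := fun n => n2 mu (fun x => fn n x - f x))
    (e := fun n => (C%:E * n2 mu (fun x => (fn n x - f x)%R))%E)) => //.
  - exact: n2_ge0.
  - by move=> n; exact: n2_ge0.
  - by rewrite -[X in _ --> X](mule0 C%:E); exact: cvgeZl.
  - move=> t n t0; apply: le_trans (sum_sqm_innD_le t0 sD Lf (Lfn n)) _.
    apply: leeD; apply: lee_wpmul2l.
    + by rewrite lee_fin addr_ge0 // ltW.
    + by apply: le_trans (fsum_ge _ us sD) _; case: (SE _ (Sfn n)) => _ ->.
    + by rewrite lee_fin addr_ge0 // invr_ge0 ltW.
    rewrite n2_distC (n2_EFin (L2B Lf (Lfn n))) sumEFin -EFinM lee_fin mulr_suml.
    rewrite big_seq [leRHS]big_seq; apply: ler_sum => l /sD Dl.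
    by rewrite mulrC; apply: cauchy_schwarz; [exact: L2B|exact: Lphi].
  - move=> t n t0; have {1}-> : fn n = (fun x => f x + (fn n x - f x)).
      by apply/funext => x; rewrite addrC subrK.
    by apply: n2D_le => //; [exact: L2_cmf Lf|exact: L2_cmf (L2B (Lfn n) Lf)].
move=> f Lf; have [fn [Sfn cfn]] := Sd f Lf.
by apply: (fsum_lim B Lf _ cfn) => n; exact: SE.
Qed.

End frames.

(** * Fubini's theorem for complex integrals *)

Section fubini.
Context d1 d2 (T1 : measurableType d1) (T2 : measurableType d2) {R : realType}.
Context (m1 : {sigma_finite_measure set T1 -> \bar R})
          (m2 : {sigma_finite_measure set T2 -> \bar R}).

(** No integrability enters: Tonelli gives measurability for the positive and the negative part, and
    the integral is by definition their difference, whether or not it is finite. *)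
Lemma measurable_fubini_F_gen (f : T1 * T2 -> R) : measurable_fun setT f ->
  measurable_fun setT (fun x => \int[m2]_y f (x, y)).
Proof.
move=> mf.
pose g z := (f z)%:E; have mg : measurable_fun setT g by exact/measurable_EFinP.
have h : measurable_fun setT (fubini_F m2 g^\+ \- fubini_F m2 g^\-)%E.
  apply: emeasurable_funB; apply: measurable_fun_fubini_tonelli_F => //.
    exact: measurable_funepos.
  exact: measurable_funeneg.
have E : (fubini_F m2 g^\+ \- fubini_F m2 g^\-)%E = (fun x => \int[m2]_y (f (x, y))%:E)%E.
  apply/funext => x; rewrite [RHS]integralE.
  by congr (_ - _)%E; apply: eq_integral => y _; rewrite ?funeposE ?funenegE.
by have := measurableT_comp (@fine_measurable R setT measurableT) h; rewrite E.
Qed.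

Lemma cmf_fubini (f : T1 * T2 -> R[i]) : cmf f -> cmf (fun x => cint m2 (fun y => f (x, y))).
Proof.
by move=> [f1 f2]; split; [exact: (measurable_fubini_F_gen f1)|exact: (measurable_fubini_F_gen f2)].
Qed.

(** Integrability of every slice, rather than of almost every one, allows [fineK] pointwise under
    the outer integral. *)
Lemma cfubini1 (f : T1 * T2 -> R[i]) : cintegrable (m1 \x m2)%E f ->
  (forall x, cintegrable m2 (fun y => f (x, y))) ->
  cint (m1 \x m2)%E f = cint m1 (fun x => cint m2 (fun y => f (x, y))).
Proof.
move=> [f1 f2] fi.
have H (a : T1 * T2 -> R) : (m1 \x m2)%E.-integrable setT (EFin \o a) ->
    (forall x, m2.-integrable setT (fun y => (a (x, y))%:E)) ->
    \int[(m1 \x m2)%E]_z a z = \int[m1]_x \int[m2]_y a (x, y).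
  move=> ia ia2; rewrite /Rintegral -(integral12_prod_meas1 ia); congr fine.
  by apply: eq_integral => x _; rewrite /fubini_F fineK // integrable_fin_num.
by apply: complexP => /=; apply: H => // x; case: (fi x).
Qed.

Lemma cfubini2 (f : T1 * T2 -> R[i]) : cintegrable (m1 \x m2)%E f ->
  (forall y, cintegrable m1 (fun x => f (x, y))) ->
  cint (m1 \x m2)%E f = cint m2 (fun y => cint m1 (fun x => f (x, y))).
Proof.
move=> [f1 f2] fi.
have H (a : T1 * T2 -> R) : (m1 \x m2)%E.-integrable setT (EFin \o a) ->
    (forall y, m1.-integrable setT (fun x => (a (x, y))%:E)) ->
    \int[(m1 \x m2)%E]_z a z = \int[m2]_y \int[m1]_x a (x, y).
  move=> ia ia2; rewrite /Rintegral -(integral21_prod_meas1 ia); congr fine.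
  by apply: eq_integral => y _; rewrite /fubini_G fineK // integrable_fin_num.
by apply: complexP => /=; apply: H => // y; case: (fi y).
Qed.

End fubini.

(** * Fourier series *)

Section trig_integrals.
Context {R : realType}.
Local Notation mu := (@lebesgue_measure R).

Lemma expi_int (k : int) : expi (2 * pi * k%:~R) = 1 :> R[i].
Proof.
have H (n : nat) : expi (2 * pi * n%:R) = 1 :> R[i].
  elim: n => [|n IH]; first by rewrite mulr0 expi0.
  rewrite -[n.+1]addn1 natrD mulrDr expiD IH mulr1 mul1r.
  by apply: complexP => /=; rewrite mulr_natl ?cos2pi ?sin2pi.
case: k => n; first exact: H.
by rewrite NegzE mulrNz mulrN expiN H; apply: complexP; rewrite /= ?oppr0.
Qed.

Lemma derive_sinc (c x : R) : c != 0 ->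
  is_derive x (1 : R) (fun x => c^-1 * sin (c * x)) (cos (c * x)).
Proof.
move=> c0.
have h : is_derive x 1 (fun x => c * x) c.
  by apply: is_derive_eq (@is_deriveZ R R R (@id R) c x 1 1 _) _; exact: mulr1.
have := is_derive1_comp (is_derive_sin (c * x)) h => h2.
apply: is_derive_eq (@is_deriveZ R R R _ c^-1 x 1 _ h2) _.
by rewrite /GRing.scale /=; field.
Qed.

Lemma derive_cosc (c x : R) : c != 0 ->
  is_derive x (1 : R) (fun x => - c^-1 * cos (c * x)) (sin (c * x)).
Proof.
move=> c0.
have h : is_derive x 1 (fun x => c * x) c.
  by apply: is_derive_eq (@is_deriveZ R R R (@id R) c x 1 1 _) _; exact: mulr1.
have := is_derive1_comp (is_derive_cos (c * x)) h => h2.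
apply: is_derive_eq (@is_deriveZ R R R _ (- c^-1) x 1 _ h2) _.
by rewrite /GRing.scale /=; field.
Qed.

Lemma FTC2_is_derive (f F : R -> R) (a b : R) : a < b -> continuous f ->
  (forall x, is_derive x (1 : R) F (f x)) ->
  \int[mu]_(x in `[a, b]) f x = F b - F a.
Proof.
move=> ab cf dF.
have dv x : derivable F x 1 by have := dF x; case.
have cF x : {for x, continuous F}.
  by apply: differentiable_continuous; apply/derivable1_diffP; exact: dv.
rewrite /Rintegral (@continuous_FTC2 R f F a b) //.
- by apply: continuous_subspaceT.
- split => //.
  + by apply: cvg_at_right_filter; exact: cF.
  + by apply: cvg_at_left_filter; exact: cF.
- by move=> x _; rewrite derive1E; have := dF x; case.
Qed.

End trig_integrals.

Section bounded_support.
Context d (T : measurableType d) {R : realType}.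
Context (mu : {measure set T -> \bar R}).
Implicit Types (f : T -> R[i]) (A : set T).

Lemma integrable_scale_indic A (c : R) : measurable A -> (mu A < +oo)%E ->
  mu.-integrable setT (EFin \o (fun x => c * \1_A x)).
Proof.
move=> mA Aoo.
have iA : mu.-integrable setT (fun x => (\1_A x)%:E).
  apply/integrableP; split; first exact/measurable_EFinP.
  rewrite (_ : (fun x => `|_|%E) = (fun x => (\1_A x)%:E)).
    by rewrite integral_indic // setIT.
  by apply/funext => x /=; rewrite ger0_norm.
by apply: (eq_integrableT (integrableZl measurableT c iA)).
Qed.

Lemma L2_bounded A f (M : R) : measurable A -> (mu A < +oo)%E -> cmf f ->
  (forall x, sqm (f x) <= M * \1_A x) -> L2 mu f.
Proof.
move=> mA Aoo mf fM; split => //.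
apply: (@le_lt_trans _ _ (\int[mu]_x (M * \1_A x)%:E)%E).
  apply: ge0_le_integral => //.
  - by move=> x _; rewrite lee_fin sqm_ge0.
  - exact/measurable_EFinP/measurable_sqm.
  - by apply/measurable_EFinP/measurable_funM => //; exact: measurable_cst.
  - by move=> x _; rewrite lee_fin.
exact: integrable_lty (integrable_scale_indic M mA Aoo).
Qed.

Lemma n2_bounded_le A f (M : R) : measurable A -> 0 <= M -> cmf f ->
  (forall x, sqm (f x) <= M * \1_A x) -> (n2 mu f <= M%:E * mu A)%E.
Proof.
move=> mA M0 mf fM.
have -> : (M%:E * mu A = \int[mu]_x (M * \1_A x)%:E)%E.
  under eq_integral do rewrite EFinM.
  rewrite ge0_integralZl_EFin //; last exact/measurable_EFinP/measurable_indic.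
  by rewrite integral_indic // setIT.
apply: ge0_le_integral => //.
- by move=> t _; rewrite lee_fin sqm_ge0.
- exact/measurable_EFinP/measurable_sqm.
- by apply/measurable_EFinP/measurable_funM; [exact: measurable_cst|exact: measurable_indic].
- by move=> t _; rewrite lee_fin.
Qed.

Lemma cintegrable_bounded A f (M : R) : measurable A -> (mu A < +oo)%E -> cmf f ->
  (forall x, sqm (f x) <= M * \1_A x) -> cintegrable mu f.
Proof.
move=> mA Aoo mf fM.
apply: (le_cintegrable mf (integrable_scale_indic (1 + `|M|) mA Aoo)) => x.
  by rewrite mulr_ge0 ?addr_ge0.
apply: le_trans (fM x) _; rewrite indicE; have := ler_norm M; have := normr_ge0 M.
by case: (x \in A) => /=; rewrite ?mulr1 ?mulr0 ?expr0n /= => *; nra.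
Qed.

Lemma cint_cut A f : cint mu (cut A f) =
  (\int[mu]_(x in A) complex.Re (f x)) +i* (\int[mu]_(x in A) complex.Im (f x)).
Proof.
apply: complexP => /=; rewrite [RHS]Rintegral_mkcond; apply: eq_Rintegral => x _.
  by rewrite patchE /cut indicE; case: (x \in A); rewrite ?mul1r ?mul0r.
by rewrite patchE /cut indicE; case: (x \in A); rewrite ?mul1r ?mul0r.
Qed.

Lemma cutMJ A f g x : cut A f x * (cut A g x)^*%C = cut A (fun x => f x * (g x)^*%C) x.
Proof.
have [Ax|Ax] := pselect (A x); first by rewrite !cut_in.
by rewrite !cut_out // mul0r.
Qed.

End bounded_support.

Section fourier_basis.
Context {R : realType}.
Local Notation RR := (measurableTypeR R).
Local Notation mu := (@lebesgue_measure R).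

Definition uitv : set RR := `[- 2^-1, 2^-1]%classic.

Definition fexp (k : int) : RR -> R[i] := fun x => expi (2 * pi * (k%:~R * x)).

(** The exponentials are cut to the unit interval so that the orthonormal system lives on the whole
    line and no restricted measure appears. *)
Definition fbas (k : int) : RR -> R[i] := cut uitv (fexp k).

Lemma measurable_uitv : measurable uitv.
Proof. exact: measurable_itv. Qed.

Lemma mu_uitvE : mu uitv = 1%E.
Proof.
rewrite /uitv lebesgue_measure_itv /= lte_fin ifT; last by lra.
by rewrite -EFinB opprK; congr EFin; field.
Qed.

Lemma mu_uitv : (mu uitv < +oo)%E.
Proof. by rewrite mu_uitvE ltry. Qed.

Lemma cmf_fexp k : cmf (fexp k).
Proof.
have H : @cmf _ R R (fexp k) by apply: cmf_expi; apply: measurable_funM => //; exact: measurable_funM.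
exact: H.
Qed.

Lemma cmf_fbas k : cmf (fbas k).
Proof. exact: cmf_cut measurable_uitv (cmf_fexp k). Qed.

Lemma sqm_fbas k x : sqm (fbas k x) = \1_uitv x.
Proof.
have [Ax|Ax] := pselect (uitv x).
  by rewrite /fbas cut_in // /fexp sqm_expi indicE mem_set.
by rewrite /fbas cut_out // sqm0 indicE memNset.
Qed.

Lemma L2_fbas k : L2 mu (fbas k).
Proof.
apply: (L2_bounded (M := 1) measurable_uitv mu_uitv (cmf_fbas k)) => x.
by rewrite sqm_fbas mul1r.
Qed.

Lemma fexpD k l x : fexp (k + l) x = fexp k x * fexp l x.
Proof. by rewrite /fexp -expiD -mulrDr -mulrDl -intrD. Qed.

Lemma fexpN k x : fexp (- k) x = (fexp k x)^*%C.
Proof. by rewrite /fexp -expiN mulrNz mulNr mulrN. Qed.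

Lemma cint_fbas k : cint mu (fbas k) = (k == 0)%:R.
Proof.
rewrite cint_cut /fexp; case: eqP => [->|/eqP k0].
  apply: complexP => /=.
    under eq_Rintegral do rewrite mul0r mulr0 cos0.
    rewrite Rintegral_cst; last exact: measurable_uitv.
    by rewrite mul1r; exact: (congr1 fine mu_uitvE).
  under eq_Rintegral do rewrite mul0r mulr0 sin0.
  by rewrite Rintegral_cst ?mul0r //; exact: measurable_uitv.
set c : R := 2 * pi * k%:~R.
have c0 : c != 0 by rewrite !mulf_neq0 ?intr_eq0 // gt_eqF ?pi_gt0.
have ab : - 2^-1 < 2^-1 :> R by lra.
(* The end points differ by a whole number of periods, so the antiderivatives agree there and the
   integral vanishes. *)
have per : expi (c * 2^-1) = expi (c * - 2^-1) :> R[i].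
  have -> : c * 2^-1 = c * - 2^-1 + 2 * pi * k%:~R by rewrite -/c; field.
  by rewrite expiD expi_int mulr1.
have cc : continuous (fun x : R => c * x) by move=> x; apply: cvgM; [exact: cvg_cst|exact: cvg_id].
apply: complexP => /=.
  under eq_Rintegral do rewrite mulrA -/c.
  rewrite (FTC2_is_derive ab _ (fun x => derive_sinc x c0)).
  - by rewrite -mulrBr; have := congr1 (@complex.Im R) per => /= ->; rewrite subrr mulr0.
  - by move=> x; apply: continuous_comp; [exact: cc|exact: continuous_cos].
under eq_Rintegral do rewrite mulrA -/c.
rewrite (FTC2_is_derive ab _ (fun x => derive_cosc x c0)).
- by rewrite -mulrBr; have := congr1 (@complex.Re R) per => /= ->; rewrite subrr mulr0.
- by move=> x; apply: continuous_comp; [exact: cc|exact: continuous_sin].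
Qed.

Lemma fbas_orthonormal k l : inn mu (fbas k) (fbas l) = (k == l)%:R.
Proof.
rewrite -subr_eq0 -cint_fbas; apply: eq_cint => x.
rewrite /fbas cutMJ; have [Ax|Ax] := pselect (uitv x); last by rewrite !cut_out.
by rewrite !cut_in // -fexpN -fexpD.
Qed.

Definition fcoef (F : RR -> R[i]) (k : int) : R[i] := inn mu F (fbas k).

Lemma fbessel F (s : seq int) : uniq s -> L2 mu F ->
  \sum_(k <- s) sqm (fcoef F k) <= fine (n2 mu F).
Proof. by move=> us LF; apply: bessel => //; [exact: L2_fbas|exact: fbas_orthonormal]. Qed.

End fourier_basis.

Section measurable_inverse.
Context d (T : measurableType d) {R : realType}.

(** On nonnegative numbers the inverse is the power with exponent -1, also at 0, where both are
    0. *)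
Lemma measurable_funV_ge0 (f : T -> R) : (forall x, 0 <= f x) ->
  measurable_fun setT f -> measurable_fun setT (fun x => (f x)^-1).
Proof.
move=> f0 mf; rewrite (_ : (fun x => _) = (fun x => (f x) `^ (-1))).
  exact: (measurableT_comp (@measurable_powR R (-1))).
by apply/funext => x; rewrite powR_inv1.
Qed.

Lemma invcE (z : R[i]) : z^-1 = z^*%C * ((sqm z)^-1)%:C.
Proof.
by case: z => a b; apply: complexP; rewrite /sqm /= ?mulr0 ?mul0r ?subr0 ?add0r ?addr0 ?mulNr.
Qed.

Lemma cmfV (f : T -> R[i]) : cmf f -> cmf (fun x => (f x)^-1).
Proof.
move=> mf; under eq_fun do rewrite invcE.
apply: cmfM; first exact: cmfJ.
by apply: cmfR; apply: measurable_funV_ge0; [move=> x; exact: sqm_ge0|exact: measurable_sqm].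
Qed.

End measurable_inverse.

Section sine_bound.
Context {R : realType}.

(** By the mean value theorem [sin u = u * cos c] with [0 < c < u], and the cosine decreases. *)
Lemma mul_cos_le_sin (u : R) : 0 <= u <= pi / 2 -> u * cos u <= sin u.
Proof.
move=> /andP[]; rewrite le_eqVlt => /predU1P[<-|u0 u1]; first by rewrite mul0r sin0.
have pi0 : 0 < pi :> R := pi_gt0 R.
have [|c] := @MVT R sin cos 0 u u0 (fun x _ => is_derive_sin x).
  by apply: continuous_subspaceT; exact: continuous_sin.
rewrite in_itv /= => /andP[c0 cu]; rewrite sin0 !subr0 => ->.
rewrite mulrC ler_pM2r //; apply: ltW; rewrite ltr_cos // in_itv /=; apply/andP; split; lra.
Qed.

Lemma sqm_fexpB1 (s : R) : sqm (fexp 1 s - 1) = 4 * sin (pi * s) ^+ 2.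
Proof.
rewrite /fexp mul1r; have -> : 2 * pi * s = (pi * s) *+ 2 by rewrite mulr2n; ring.
rewrite /sqm ReD ImD /= cos_mulr2n sin_mulr2n; have := cos2Dsin2 (pi * s).
move: (cos _) (sin _) => c t h.
have hc : c ^+ 2 = 1 - t ^+ 2 by rewrite -h; ring.
transitivity ((2 * c ^+ 2 - 2) ^+ 2 + 4 * c ^+ 2 * t ^+ 2); first by ring.
by rewrite hc; ring.
Qed.

(** The bound 15/16 is 1/2 + 7/16, the largest distance from a point of the unit interval to a point
    with [|x| <= 7 / 16]. Below distance 1 the only zero is [s = 0]: in sin(pi r) = 2 cos(u) sin(u)
    with u = pi r / 2 <= 15 pi / 32 < pi / 2, the cosine is at least [k] and the sine at least
    [u * k]. *)
Lemma sqm_fexpB1_ge : exists2 c : R, 0 < c &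
  forall s, `|s| <= 15 / 16 -> c * s ^+ 2 <= sqm (fexp 1 s - 1).
Proof.
pose k : R := cos (15 / 32 * pi); have pi0 : 0 < pi :> R := pi_gt0 R.
have k0 : 0 < k by apply: cos_gt0_pihalf; apply/andP; split; lra.
exists (4 * (pi * k ^+ 2) ^+ 2); first by rewrite mulr_gt0 // exprn_gt0 // mulr_gt0 // exprn_gt0.
move=> s s1; rewrite sqm_fexpB1 -mulrA ler_pM2l // -exprMn.
have -> : sin (pi * s) ^+ 2 = sin (pi * `|s|) ^+ 2.
  by have [_|_] := ger0P s => //; rewrite mulrN sinN sqrrN.
have -> : (pi * k ^+ 2 * s) ^+ 2 = (pi * k ^+ 2 * `|s|) ^+ 2.
  by rewrite !exprMn real_normK ?num_real.
move: (`|s|) (normr_ge0 s) s1 => r r0 r1.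
have -> : pi * r = (pi * r / 2) *+ 2 by rewrite mulr2n; field.
rewrite sin_mulr2n; set u := pi * r / 2.
have u0 : 0 <= u by rewrite /u; nra.
have u1 : u <= 15 / 32 * pi by rewrite /u; nra.
have ck : k <= cos u.
  rewrite leNgt ltr_cos ?in_itv /=; first by rewrite -leNgt.
    by apply/andP; split; lra.
  by apply/andP; split; lra.
have sk : u * k <= sin u.
  apply: le_trans (mul_cos_le_sin _); first by rewrite ler_wpM2l.
  by apply/andP; split; lra.
have h : pi * k ^+ 2 * r <= (cos u * sin u) *+ 2.
  have -> : pi * k ^+ 2 * r = (k * (u * k)) *+ 2 by rewrite /u mulr2n; field.
  rewrite lerMn2r orFb; apply: ler_pM => //; [exact: ltW|by rewrite mulr_ge0 // ltW].
have k20 : 0 <= pi * k ^+ 2 * r by rewrite mulr_ge0 // mulr_ge0 ?ltW // exprn_gt0.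
by rewrite ler_pXn2r // nnegrE // (le_trans k20).
Qed.

End sine_bound.

(** * Pointwise convergence and Parseval's identity for Lipschitz functions *)

Section lipschitz_parseval.
Context {R : realType}.
Local Notation RR := (measurableTypeR R).
Local Notation mu := (@lebesgue_measure R).

Lemma cvg0_bounded_sums (u : nat -> R) (B : R) : (forall n, 0 <= u n) ->
  (forall n, \sum_(0 <= i < n) u i <= B) -> u @ \oo --> (0 : R).
Proof.
move=> u0 uB; apply: cvg_series_cvg_0.
apply: nondecreasing_is_cvgn.
  by apply/nondecreasing_seqP => n; rewrite seriesSr lerDl.
by exists B => _ [n _ <-]; exact: uB.
Qed.

(** A form of the Riemann-Lebesgue lemma: by Bessel's inequality the squared coefficients are
    summable along any sequence of distinct frequencies. *)
Lemma fcoef_cvg0 (q : RR -> R[i]) (e : nat -> int) : injective e -> L2 mu q ->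
  (fun n => sqm (fcoef q (e n))) @ \oo --> (0 : R).
Proof.
move=> ie Lq; apply: (@cvg0_bounded_sums _ (fine (n2 mu q))) => n; first exact: sqm_ge0.
rewrite -(big_map e xpredT (fun k => sqm (fcoef q k))).
by apply: fbessel => //; rewrite map_inj_uniq // iota_uniq.
Qed.

Definition int_window (N : nat) : seq int := [seq (i%:Z - N%:Z)%R | i <- iota 0 (N + N).+1].

Lemma int_window_uniq N : uniq (int_window N).
Proof. by rewrite map_inj_uniq ?iota_uniq // => i j /addIr[]. Qed.

Lemma sum_int_window (V : zmodType) (u : int -> V) N :
  \sum_(k <- int_window N) (u (k - 1) - u k) = u (- N%:Z - 1) - u N%:Z.
Proof.
rewrite big_map (_ : iota 0 _ = index_iota 0 (N + N).+1); last by rewrite /index_iota subn0.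
rewrite (eq_bigr (fun i : nat => - (u ((i.+1)%:Z - N%:Z - 1) - u (i%:Z - N%:Z - 1)))); last first.
  move=> i _; rewrite opprB; congr (u _ - u _).
  by rewrite -addn1 PoszD; ring.
rewrite sumrN telescope_sumr // opprB; congr (u _ - u _); first by rewrite sub0r.
by rewrite -addn1 !PoszD; ring.
Qed.

Context (F : RR -> R[i]) (M L : R).
Context (mF : cmf F) (FM : forall x, sqm (F x) <= M)
  (F0 : forall x, 7 / 16 < `|x| -> F x = 0)
  (FL : forall x y : R, sqm (F x - F y) <= L * (x - y) ^+ 2).

Let M0 : 0 <= M. Proof. exact: le_trans (sqm_ge0 _) (FM 0). Qed.
Let L0 : 0 <= L.
Proof. by have := FL 0 1; rewrite sub0r sqrrN expr1n mulr1; exact: le_trans (sqm_ge0 _). Qed.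

Lemma uitv_supp (x : R) : `|x| <= 7 / 16 -> uitv x.
Proof.
rewrite ler_norml => /andP[a b]; rewrite /uitv /= in_itv /=; apply/andP; split; lra.
Qed.

Lemma supp_indic (x : R) : sqm (F x) <= M * \1_uitv x.
Proof.
have [h|h] := leP `|x| (7 / 16).
  by rewrite indicE mem_set ?mulr1 //; exact: uitv_supp.
by rewrite F0 // sqm0 mulr_ge0.
Qed.

Lemma L2_lip : L2 mu F.
Proof. exact: (L2_bounded measurable_uitv mu_uitv mF supp_indic). Qed.

(* Bounded as F is Lipschitz, and its Fourier coefficients make the partial sums
   of the series of F at x telescope. *)
Definition dquot (x : R) : RR -> R[i] :=
  cut uitv (fun t => (F t - F x) / (fexp 1 (t - x) - 1)).

Lemma cmf_dquot (x : R) : cmf (dquot x).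
Proof.
apply: cmf_cut; first exact: measurable_uitv.
apply: cmfM; first by apply: cmfB => //; exact: cmf_cst.
apply: cmfV; apply: cmfB; last exact: cmf_cst.
have H : @cmf _ R R (fun t => fexp 1 (t - x)).
  apply: (@cmf_comp _ _ R R R (fexp 1) (fun t => t - x)).
    exact: (@cmf_fexp R 1).
  by apply: measurable_funD.
exact: H.
Qed.

(** Both numerator and denominator are compared with [(t - x) ^+ 2], by the Lipschitz bound and by
    [sqm_fexpB1_ge]. That [K] does not depend on [x] is what later gives a dominating function. *)
Lemma dquot_bounded : exists2 K, 0 <= K & forall x t : R, `|x| <= 7 / 16 ->
  sqm (dquot x t) <= K * \1_uitv t.
Proof.
have [c c0 cP] := @sqm_fexpB1_ge R.
exists (L / c) => [|x t x1]; first by rewrite divr_ge0 // ltW.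
have [tu|tu] := pselect (uitv t); last first.
  by rewrite /dquot cut_out // sqm0 indicE memNset // mulr0.
rewrite /dquot cut_in // indicE mem_set // mulr1.
have [->|tx] := eqVneq t x.
  by rewrite subrr mul0r sqm0 divr_ge0 // ltW.
have tx1 : `|t - x| <= 15 / 16.
  move: x1 tu; rewrite /uitv /= in_itv /= !ler_norml => /andP[a b] /andP[a' b'].
  by apply/andP; split; lra.
have := cP _ tx1; move: (fexp 1 (t - x) - 1) => w hw.
have p0 : 0 < (t - x) ^+ 2 by rewrite exprn_even_gt0 //= subr_eq0.
have w0 : 0 < sqm w by apply: lt_le_trans hw; rewrite mulr_gt0.
have wn0 : w != 0 by apply/eqP => w00; move: w0; rewrite w00 sqm0 ltxx.
have -> : sqm ((F t - F x) / w) = sqm (F t - F x) / sqm w.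
  apply: (@mulIf _ (sqm w)); first by rewrite gt_eqF.
  by rewrite -sqmM !divfK // gt_eqF.
rewrite ler_pdivrMr //; apply: le_trans (FL t x) _.
have -> : L * (t - x) ^+ 2 = L / c * (c * (t - x) ^+ 2) by field; rewrite gt_eqF.
by rewrite ler_wpM2l // divr_ge0 // ltW.
Qed.

Lemma L2_dquot (x : R) : `|x| <= 7 / 16 -> L2 mu (dquot x).
Proof.
move=> x1; have [K K0 KP] := dquot_bounded.
by apply: (L2_bounded (M := K) measurable_uitv mu_uitv (cmf_dquot x)) => t; exact: KP.
Qed.

(** On the unit interval F(t) = F(x) + (exp(2 pi i (t - x)) - 1) q(t) with q the difference
    quotient, and multiplication by [fexp 1] shifts the coefficients by one. *)
Lemma fcoef_dquot (x : R) k : `|x| <= 7 / 16 ->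
  fcoef F k = F x * (k == 0)%:R +
    (fexp (-1) x * fcoef (dquot x) (k - 1) - fcoef (dquot x) k).
Proof.
move=> x1; have Lq := L2_dquot x1; set q := dquot x in Lq *.
have Lqe : L2 mu (fun t => fexp 1 t * q t).
  apply: (le_L2 _ Lq); first by apply: cmfM; [exact: cmf_fexp|exact: cmf_dquot].
  by move=> t; rewrite sqmM {1}/fexp sqm_expi mul1r.
have E1 : fcoef q (k - 1) = inn mu (fun t => fexp 1 t * q t) (fbas k).
  apply: eq_cint => t; have [tu|tu] := pselect (uitv t); last first.
    by rewrite /q /dquot !cut_out // !(mul0r, mulr0).
  rewrite /fbas !(@cut_in _ _ _ _ _ t) // -!fexpN opprB fexpD; ring.
rewrite E1 eq_sym -(fbas_orthonormal 0 k) -(innZl (fexp (-1) x)) //; last exact: L2_fbas.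
rewrite -(innZl (F x)); [|exact: L2_fbas|exact: L2_fbas].
have Lz : L2 mu (fun t => fexp (-1) x * (fexp 1 t * q t)) by exact: L2Z.
have LF : L2 mu (fun t => F x * fbas 0 t) by apply: L2Z; exact: L2_fbas.
have Ld := L2B Lz Lq; have Lk := @L2_fbas R k.
transitivity (inn mu (fun t => F x * fbas 0 t +
  (fexp (-1) x * (fexp 1 t * q t) - q t)) (fbas k)); last first.
  by rewrite (innDl LF Ld Lk) (innBl Lz Lq Lk).
apply: eq_cint => t; have [tu|tu] := pselect (uitv t); last first.
  have -> : fbas k t = 0 by exact: cut_out.
  by rewrite conjc0 !mulr0.
congr (_ * _); rewrite /fbas /q /dquot !(@cut_in _ _ _ _ _ t) //.
have -> : fexp 0 t = 1 :> R[i] by rewrite /fexp mul0r mulr0 expi0.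
have ee : fexp 1 (t - x) = fexp (-1) x * fexp 1 t :> R[i].
  by rewrite /fexp -expiD; congr expi; ring.
rewrite mulr1 mulrA -ee -[X in _ - X]mul1r -mulrBl.
have [->|tx] := eqVneq t x; first by rewrite (subrr (F x)) mul0r mulr0 addr0.
rewrite mulrC divfK; first by rewrite addrC subrK.
have [c c0 cP] := @sqm_fexpB1_ge R.
have tx1 : `|t - x| <= 15 / 16.
  move: x1 tu; rewrite /uitv /= in_itv /= !ler_norml => /andP[a b] /andP[a' b'].
  by apply/andP; split; lra.
apply/eqP => w0; have := cP _ tx1; rewrite w0 sqm0 leNgt mulr_gt0 //.
by rewrite exprn_even_gt0 //= subr_eq0.
Qed.

Definition fpart (N : nat) (x : R) : R[i] := \sum_(k <- int_window N) fcoef F k * fexp k x.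

(** The constant [F x] contributes at frequency 0 only; the rest telescopes to two boundary terms,
    which tend to 0 by [fcoef_cvg0]. *)
Lemma fpart_dquot N (x : R) : `|x| <= 7 / 16 ->
  fpart N x - F x = fexp (- N%:Z - 1) x * fcoef (dquot x) (- N%:Z - 1) -
                    fexp N%:Z x * fcoef (dquot x) N%:Z.
Proof.
move=> x1.
rewrite -(sum_int_window (fun k => fexp k x * fcoef (dquot x) k)) /fpart.
rewrite (eq_bigr (fun k => F x * (k == 0)%:R + (fexp (k - 1) x * fcoef (dquot x) (k - 1) -
    fexp k x * fcoef (dquot x) k))); last first.
  move=> k _; rewrite (fcoef_dquot k x1) mulrDl mulrBl; congr (_ + (_ - _)); last by rewrite mulrC.
    by case: eqP => [->|_]; rewrite ?mulr0 ?mul0r // /fexp mul0r mulr0 expi0 mulr1.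
  by rewrite mulrAC -fexpD [-1 + k]addrC.
rewrite big_split /= -mulr_sumr.
have -> : \sum_(k <- int_window N) (k == 0)%:R = 1 :> R[i].
  rewrite (bigD1_seq 0) /=; last exact: int_window_uniq.
    by rewrite big1 ?addr0 // => k /negbTE ->.
  by apply/mapP; exists N; rewrite ?subrr // mem_iota add0n ltnS leq_addr.
by rewrite mulr1 addrAC subrr add0r.
Qed.

Lemma cvg_fpart (x : R) : `|x| <= 7 / 16 -> (fun N => sqm (fpart N x - F x)) @ \oo --> (0 : R).
Proof.
move=> x1; have Lq := L2_dquot x1.
have cN (e : nat -> int) : injective e ->
    (fun N => 2 * sqm (fexp (e N) x * fcoef (dquot x) (e N))) @ \oo --> (0 : R).
  move=> ie; rewrite -[X in _ --> X](mulr0 2); apply: cvgM; first exact: cvg_cst.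
  under eq_fun do rewrite sqmM {1}/fexp sqm_expi mul1r.
  exact: fcoef_cvg0.
apply: (@squeeze_cvgr _ _ _ _ (fun=> 0) (fun N : nat =>
  2 * sqm (fexp (- N%:Z - 1) x * fcoef (dquot x) (- N%:Z - 1)) +
  2 * sqm (fexp N%:Z x * fcoef (dquot x) N%:Z))).
- apply: nearW => N; rewrite sqm_ge0 /= fpart_dquot // -[X in _ <= _ + 2 * X]sqmN.
  exact: sqmD2.
- exact: cvg_cst.
- rewrite -[X in _ --> X](addr0 0); apply: cvgD.
    by apply: (cN (fun N : nat => - N%:Z - 1)) => m n /addIr/oppr_inj[].
  by apply: (cN (fun N : nat => N%:Z)) => m n [].
Qed.

(** The uniform bound for dominated convergence in [parseval_lip]. Each boundary term of
    [fpart_dquot] is a single coefficient of [dquot x], so Bessel's inequality bounds it. *)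
Lemma fpart_bounded : exists2 K, 0 <= K & forall N (x : R), `|x| <= 7 / 16 ->
  sqm (fpart N x) <= K.
Proof.
have [K K0 KP] := dquot_bounded.
have nK x : `|x| <= 7 / 16 -> fine (n2 mu (dquot x)) <= K.
  move=> x1; have Lq := L2_dquot x1.
  rewrite -lee_fin -n2_EFin //.
  have := n2_bounded_le (A := uitv) mu measurable_uitv K0 (cmf_dquot x) (fun t => KP x t x1).
  rewrite [X in (_ <= _ * X)%E](_ : _ = 1%E); last exact: mu_uitvE.
  by rewrite mule1.
have cK x k : `|x| <= 7 / 16 -> sqm (fcoef (dquot x) k) <= K.
  move=> x1; apply: le_trans (nK x x1).
  by have := @fbessel _ (dquot x) [:: k] isT (L2_dquot x1); rewrite big_seq1.
exists (2 * (4 * K) + 2 * M) => [|N x x1]; first by rewrite addr_ge0 ?mulr_ge0.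
rewrite -[fpart N x](subrK (F x)); apply: le_trans (sqmD2 _ _) _.
apply: lerD; last by rewrite ler_wpM2l.
rewrite ler_wpM2l // fpart_dquot //; apply: le_trans (sqmD2 _ _) _.
rewrite sqmN !sqmM /fexp !sqm_expi !mul1r.
by have := cK x (- N%:Z - 1) x1; have := cK x N%:Z x1; lra.
Qed.

(** One inequality is Bessel's. For the other, the integral of the N-th partial sum times the
    conjugate of [F] is the sum of the squared coefficients over the window, and it converges to the
    squared norm of [F]. *)
Lemma parseval_lip : fsum mu setT (@fbas R) F = n2 mu F.
Proof.
have LF := L2_lip; apply/eqP; rewrite eq_le; apply/andP; split.
  apply: fsum_le => s us _; rewrite (n2_EFin LF) sumEFin lee_fin.
  exact: fbessel.
pose P N x := fpart N x * (F x)^*%C.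
have [K K0 KP] := fpart_bounded.
have E N : cint mu (P N) = (\sum_(k <- int_window N) sqm (fcoef F k))%:C.
  have LS k : L2 mu (fun x => fcoef F k * fbas k x) by apply: L2Z; exact: L2_fbas.
  transitivity (inn mu (fun x => \sum_(k <- int_window N) fcoef F k * fbas k x) F).
    apply: eq_cint => x; rewrite /P.
    have [h|h] := leP `|x| (7 / 16); last by rewrite F0 // conjc0 !mulr0.
    congr (_ * _); apply: eq_bigr => k _; congr (_ * _).
    by rewrite /fbas cut_in //; exact: uitv_supp.
  rewrite inn_suml // rmorph_sum /=; apply: eq_bigr => k _.
  rewrite innZl //; last exact: L2_fbas.
  by rewrite (innC LF (@L2_fbas R k)) mul_conjC.
have cE : (fun N => sqm (cint mu (P N) - cint mu (fun x => F x * (F x)^*%C))) @ \oo --> (0 : R).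
  (* The dominating function enters squared, and [K * M <= (1 + K * M) ^+ 2]. *)
  apply: (cint_dct (a := fun x => (1 + K * M) * \1_uitv x)).
  - move=> N; apply: cmfM; last exact: cmfJ.
    by apply: cmf_sum => k; apply: cmfM; [exact: cmf_cst|exact: cmf_fexp].
  - by apply: cmfM => //; exact: cmfJ.
  - move=> x; rewrite /P; have [h|h] := leP `|x| (7 / 16); last first.
      by rewrite F0 // conjc0; under eq_fun do rewrite !mulr0 subr0 sqm0; exact: cvg_cst.
    suff : (fun n => sqm (fpart n x - F x) * sqm (F x)^*%C) @ \oo --> 0 * sqm (F x)^*%C.
      by rewrite mul0r; under eq_fun do rewrite -sqmM mulrBl.
    by apply: cvgM; [exact: cvg_fpart|exact: cvg_cst].
  - by apply: integrable_scale_indic; [exact: measurable_uitv|exact: mu_uitv].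
  - by move=> x; rewrite mulr_ge0 // addr_ge0 // mulr_ge0.
  - move=> N x; rewrite /P; have [h|h] := leP `|x| (7 / 16); last first.
      by rewrite F0 // conjc0 mulr0 sqm0 sqr_ge0.
    rewrite sqmM sqm_conj indicE mem_set; last exact: uitv_supp.
    rewrite mulr1; have KM : 0 <= K * M by rewrite mulr_ge0.
    apply: (@le_trans _ _ (K * M)); last by nra.
    by apply: ler_pM; rewrite ?sqm_ge0 ?KP ?FM.
have cR := cvg_sqm_Re cE.
have E2 : complex.Re (cint mu (fun x => F x * (F x)^*%C)) = fine (n2 mu F).
  by rewrite /=; apply: eq_Rintegral => x _; rewrite mul_conjC.
have cEF : (fun N => (complex.Re (cint mu (P N)))%:E) @ \oo -->
    (complex.Re (cint mu (fun x => F x * (F x)^*%C)))%:E.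
  by apply: cvg_EFin; [exact: nearW|exact: cR].
rewrite (n2_EFin LF) -E2; apply: (cvge_to_le cEF).
apply: nearW => N; rewrite E /= -sumEFin.
by apply: fsum_ge; [exact: int_window_uniq|].
Qed.

End lipschitz_parseval.

(** * Averages of bounded functions *)

Section averages.
Context {R : realType}.
Local Notation RR := (measurableTypeR R).
Local Notation mu := (@lebesgue_measure R).
Context (f : R -> R) (M : R).
Context (mf : measurable_fun setT f) (fM : forall x, `|f x| <= M)
  (f0 : forall x, 3 / 8 < `|x| -> f x = 0).

Let M0 : 0 <= M. Proof. exact: le_trans (normr_ge0 _) (fM 0). Qed.

Let fi : mu.-integrable setT (EFin \o f).
Proof.
apply: (le_integrable measurableT _ _ (integrable_scale_indic M measurable_uitv mu_uitv)).
  exact/measurable_EFinP.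
move=> x _ /=; rewrite lee_fin; have [h|h] := leP `|x| (3 / 8); last first.
  by rewrite f0 // normr0.
rewrite indicE mem_set; last by apply: uitv_supp; apply: le_trans h _; lra.
by rewrite mulr1 (ger0_norm M0).
Qed.

Let fiS (A : set RR) : measurable A -> mu.-integrable A (EFin \o f).
Proof. by move=> mA; apply: integrableS fi. Qed.

Definition primitive (x : R) : R := \int[mu]_(t in `]-oo, x]) f t.

Lemma primitiveB (x y : R) : x <= y -> primitive y - primitive x = \int[mu]_(t in `]x, y]) f t.
Proof.
move=> xy; apply: Rintegral_itvB => //.
by apply: fiS; exact: measurable_itv.
Qed.

Lemma primitive_lip_le (x y : R) : x <= y -> `|primitive y - primitive x| <= M * (y - x).
Proof.
move=> xy; rewrite primitiveB //.
have mA : measurable (`]x, y]%classic : set RR) by exact: measurable_itv.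
have muE : mu `]x, y]%classic = (y - x)%:E.
  rewrite lebesgue_measure_itv /= lte_fin EFinB; case: ltgtP xy => // -> _.
  by rewrite subee.
have muA : (mu `]x, y]%classic < +oo)%E.
  by rewrite muE ltry.
apply: le_trans (le_normr_Rintegral mA (fiS mA)) _.
have iM : mu.-integrable `]x, y] (EFin \o (fun=> M)).
  apply: measurable_bounded_integrable => //.
  by exists `|M|; split => // r r1 z _ /=; exact: ltW.
apply: le_trans (le_Rintegral mA _ iM _) _.
- by have := integrable_norm (fiS mA).
- by move=> z _; exact: fM.
rewrite Rintegral_cst // ler_wpM2l // [X in fine X](_ : _ = (y - x)%:E) //.
Qed.

Lemma primitive_lip (x y : R) : `|primitive y - primitive x| <= M * `|y - x|.
Proof.
have [xy|/ltW yx] := leP x y; first by rewrite (ger0_norm (_ : 0 <= y - x)) ?subr_ge0 ?primitive_lip_le.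
by rewrite distrC [X in _ * X]distrC (ger0_norm (_ : 0 <= x - y)) ?subr_ge0 ?primitive_lip_le.
Qed.

(** For [h > 0] the mean of [f] over []x, x + h]]: bounded by the bound of [f], Lipschitz for fixed
    [h], and close to [f] almost everywhere by Lebesgue differentiation. *)
Definition average (h x : R) : R := h^-1 * (primitive (h + x) - primitive x).

Lemma average_le h x : 0 < h -> `|average h x| <= M.
Proof.
move=> h0; rewrite normrM (ger0_norm (_ : 0 <= h^-1)) ?invr_ge0 ?(ltW h0) // mulrC.
rewrite ler_pdivrMr //; apply: le_trans (primitive_lip _ _) _.
by rewrite addrK (ger0_norm (ltW h0)).
Qed.

(** As 3/8 + 1/16 = 7/16, steps up to 1/16 enlarge the support just to what [parseval_lip]
    admits. *)
Lemma average_supp h x : 0 < h <= 1 / 16 -> 7 / 16 < `|x| -> average h x = 0.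
Proof.
move=> /andP[h0 h1] x1; rewrite /average primitiveB ?lerDr ?(ltW h0) //.
suff H t : t \in (`]x, h + x]%classic : set RR) -> f t = 0.
  by under eq_Rintegral => t tx do rewrite H //; rewrite Rintegral_cst ?mul0r ?mulr0.
rewrite inE /= in_itv /= => /andP[a b]; apply: f0.
by move: x1; rewrite !lter_normr => /orP[c|c]; apply/orP; [left|right]; lra.
Qed.

Lemma average_lip h x y : 0 < h -> `|average h x - average h y| <= h^-1 * (2 * M * `|x - y|).
Proof.
move=> h0; have h1 : 0 <= h^-1 by rewrite invr_ge0 ltW.
rewrite -mulrBr normrM (ger0_norm h1) ler_wpM2l //.
have -> : primitive (h + x) - primitive x - (primitive (h + y) - primitive y) =
  (primitive (h + x) - primitive (h + y)) - (primitive x - primitive y) by ring.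
apply: le_trans (ler_normB _ _) _.
have := primitive_lip (h + y) (h + x); have := primitive_lip y x.
by rewrite opprD addrACA subrr add0r; lra.
Qed.

Lemma measurable_average h : measurable_fun setT (average h).
Proof.
have mp : measurable_fun setT primitive.
  apply: continuous_measurable_fun => x; apply/cvgrPdist_le => e e0.
  have M1 : 0 < M + 1 by rewrite ltr_wpDl.
  near=> y; apply: le_trans (primitive_lip _ _) _.
  apply: (@le_trans _ _ ((M + 1) * `|x - y|)); first by rewrite ler_wpM2r // lerDl.
  rewrite mulrC -ler_pdivlMr //; near: y.
  by apply/nbhs_ballP; exists (e / (M + 1)); [by rewrite /= divr_gt0|move=> z /=; exact: ltW].
apply: measurable_funM => //; apply: measurable_funB => //.
by apply: measurableT_comp => //; exact: measurable_funD.
Unshelve. all: by end_near. Qed.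

Lemma cvg_average : {ae mu, forall x : R,
  (fun n => average ((n + 16)%N%:R^-1) x) @ \oo --> f x}.
Proof.
have := @FTC1Ny R f (fun y => fiS (measurable_itv _)) (open_integrable_locally openT fi).
apply: filterS; first exact: (ae_filter_ringOfSetsType mu).
move=> x [dx ex].
have : (fun h => h^-1 *: (primitive (h + x) - primitive x)) @ 0^' --> f x.
  rewrite -ex; have := dx; rewrite /derivable /derive1 => /cvg_ex[l hl].
  have E : (fun h : R => h^-1 *: (primitive (h *: 1 + x) - primitive x)) =
      (fun h => h^-1 *: (primitive (h + x) - primitive x)).
    by apply/funext => h; rewrite /GRing.scale /= mulr1.
  by move: hl; rewrite E => hl; rewrite (cvg_lim (@Rhausdorff R) hl).
move/cvgr_dnbhsP => /(_ (fun n => (n + 16)%N%:R^-1)); apply; split.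
  by move=> n; rewrite invr_eq0 pnatr_eq0 addn_eq0 andbF.
(* [harmonic] is 1/(n + 1), so a shift by 15 gives the steps 1/(n + 16), none of which exceeds
   1/16. *)
have := @cvg_harmonic R; rewrite -(cvg_shiftn 15) => h; apply: cvg_trans h.
by apply: near_eq_cvg; apply: nearW => n; rewrite /harmonic /= (addnS n 15).
Qed.

End averages.

Section parseval1.
Context {R : realType}.
Local Notation RR := (measurableTypeR R).
Local Notation mu := (@lebesgue_measure R).

(** The Lipschitz constants of the averages blow up as the step tends to 0, but [fsum_lim] asks only
    for the identity at each step and for convergence of the averages in norm, which is dominated
    convergence. *)
Lemma parseval_bounded (F : RR -> R[i]) (M : R) : cmf F -> (forall x, sqm (F x) <= M) ->
  (forall x : R, 3 / 8 < `|x| -> F x = 0) ->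
  fsum mu setT (@fbas R) F = n2 mu F.
Proof.
move=> mF FM F0; have [mF1 mF2] := mF.
have M0 : 0 <= M := le_trans (sqm_ge0 _) (FM 0).
have ub x (r : R) : r ^+ 2 <= sqm (F x) -> `|r| <= Num.sqrt M.
  move=> h; rewrite -sqrtr_sqr; apply: ler_wsqrtr; exact: le_trans h (FM x).
have f1M x : `|complex.Re (F x)| <= Num.sqrt M by apply: (ub x); exact: Re_sq_le.
have f2M x : `|complex.Im (F x)| <= Num.sqrt M by apply: (ub x); exact: Im_sq_le.
have f10 (x : R) : 3 / 8 < `|x| -> complex.Re (F x) = 0 by move=> /F0 ->.
have f20 (x : R) : 3 / 8 < `|x| -> complex.Im (F x) = 0 by move=> /F0 ->.
pose h n : R := (n + 16)%N%:R^-1.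
have h0 n : 0 < h n by rewrite invr_gt0 ltr0n addnS.
have h1 n : 0 < h n <= 1 / 16.
  by rewrite h0 mul1r lef_pV2 ?posrE ?ltr0n ?addnS // ler_nat !ltnS leq_addl.
pose a n x := average (fun x => complex.Re (F x)) (h n) x.
pose b n x := average (fun x => complex.Im (F x)) (h n) x.
pose Fn n : RR -> R[i] := fun x => a n x +i* b n x.
have sq (r : R) c : 0 <= c -> `|r| <= c -> r ^+ 2 <= c ^+ 2.
  by move=> c0 rc; rewrite -(real_normK (num_real r)) ler_pXn2r ?nnegrE.
have sM : Num.sqrt M ^+ 2 = M by rewrite sqr_sqrtr.
have FnM n x : sqm (Fn n x) <= M + M.
  rewrite /sqm /=; apply: lerD; rewrite -[leRHS]sM; apply: sq => //; exact: average_le.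
have Fn0 n (x : R) : 7 / 16 < `|x| -> Fn n x = 0.
  move=> hx; rewrite /Fn /a /b (average_supp mF1 f1M f10 (h1 n) hx).
  by rewrite (average_supp mF2 f2M f20 (h1 n) hx).
have mFn n : cmf (Fn n).
  by split; [exact: (measurable_average mF1 f1M f10)|exact: (measurable_average mF2 f2M f20)].
have FnL n (x y : R) : sqm (Fn n x - Fn n y) <=
    2 * (2 * Num.sqrt M * (h n)^-1) ^+ 2 * (x - y) ^+ 2.
  rewrite /sqm ReD ImD ReN ImN /= -mulrA mulr2n mulrDl mul1r -exprMn.
  have c0 : 0 <= 2 * Num.sqrt M * (h n)^-1 by rewrite !mulr_ge0 // invr_ge0 ltW.
  have e : (2 * Num.sqrt M * (h n)^-1 * (x - y)) ^+ 2 =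
      (2 * Num.sqrt M * (h n)^-1 * `|x - y|) ^+ 2.
    by rewrite !exprMn real_normK ?num_real.
  rewrite e; apply: lerD; apply: sq => //; try by rewrite mulr_ge0.
  - by apply: le_trans (average_lip mF1 f1M f10 x y (h0 n)) _; rewrite mulrC mulrAC.
  - by apply: le_trans (average_lip mF2 f2M f20 x y (h0 n)) _; rewrite mulrC mulrAC.
have LF : L2 mu F.
  apply: (L2_bounded (M := M) measurable_uitv mu_uitv mF) => x.
  have [hx|hx] := leP `|x : R| (7 / 16).
    by rewrite indicE mem_set ?mulr1 //; exact: uitv_supp.
  by rewrite F0 ?sqm0 ?mulr_ge0 //; apply: lt_trans hx; lra.
apply: (fsum_lim (fn := Fn) _ _ LF).
- by move=> l _; exact: L2_fbas.
- move=> g Lg; apply: fsum_le => s us _; rewrite (n2_EFin Lg) sumEFin lee_fin.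
  exact: fbessel.
- move=> n; split.
    exact: (L2_lip (mFn n) (FnM n) (Fn0 n)).
  exact: (parseval_lip (mFn n) (FnM n) (Fn0 n) (FnL n)).
apply: (n2_dct (a := fun x => (2 * (M + M) + 2 * M) * \1_uitv x)) => //.
- have := cvg_average mF1 f1M f10; have := cvg_average mF2 f2M f20.
  apply: filterS2; first exact: (ae_filter_ringOfSetsType mu).
  by move=> x c2 c1; exact: cvg_sqmP.
- by apply: integrable_scale_indic; [exact: measurable_uitv|exact: mu_uitv].
move=> n x; have [hx|hx] := leP `|x : R| (7 / 16).
  rewrite indicE mem_set ?mulr1 //; last exact: uitv_supp.
  apply: le_trans (sqmD2 _ _) _; rewrite sqmN.
  by apply: lerD; rewrite ler_wpM2l.
rewrite Fn0 // F0 ?subr0 ?sqm0 ?mulr_ge0 ?addr_ge0 ?mulr_ge0 ?addr_ge0 //.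
by apply: lt_trans hx; lra.
Qed.

End parseval1.

(** * Linear changes of variables *)

Section scales.
Context d (T : measurableType d) {R : realType}.
Context (mu : {measure set T -> \bar R}).

(* [h] has constant Jacobian: it divides volumes by [c]. *)
Definition scales (h : T -> T) (c : R) := [/\ measurable_fun setT h, 0 <= c &
  forall g : T -> \bar R, measurable_fun setT g -> (forall x, 0 <= g x)%E ->
    (\int[mu]_x g (h x) = c%:E * \int[mu]_x g x)%E].

Lemma scales_comp h c h' c' : scales h c -> scales h' c' -> scales (h \o h') (c * c').
Proof.
move=> [mh c0 H] [mh' c'0 H']; split; first exact: measurableT_comp.
- exact: mulr_ge0.
- move=> g mg g0; have mgh : measurable_fun setT (g \o h) by exact: measurableT_comp.
  have gh0 x : (0 <= (g \o h) x)%E by exact: g0.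
  by rewrite (H' _ mgh gh0) [in LHS]/= (H _ mg g0) muleA -EFinM mulrC.
Qed.

Lemma scales_Rintegral h c (f : T -> R) : scales h c -> mu.-integrable setT (EFin \o f) ->
  mu.-integrable setT (EFin \o (f \o h)) /\ \int[mu]_x f (h x) = c * \int[mu]_x f x.
Proof.
move=> [mh c0 H] fi; have mf := measurable_int _ fi.
have ih : mu.-integrable setT (EFin \o (f \o h)).
  apply/integrableP; split; first exact: (measurableT_comp mf mh).
  rewrite (H (fun x => `|(f x)%:E|%E)) //; last exact: measurableT_comp.
  by move/integrableP : fi => [_ fo]; exact: lte_mul_pinfty.
split => //; rewrite /Rintegral.
have -> : (\int[mu]_x (f (h x))%:E = c%:E * \int[mu]_x (f x)%:E)%E.
  rewrite integralE [in RHS]integralE.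
  have fp := integrable_pos_fin_num measurableT fi; have fn := integrable_neg_fin_num measurableT fi.
  rewrite muleBr //; last by rewrite fin_num_adde_defr.
  congr (_ - _)%E.
    by rewrite -(H _ (measurable_funepos mf)) //; apply: eq_integral => x _; rewrite !funeposE.
  by rewrite -(H _ (measurable_funeneg mf)) //; apply: eq_integral => x _; rewrite !funenegE.
by rewrite fineM // integrable_fin_num.
Qed.

Lemma scales_cint h c (f : T -> R[i]) : scales h c -> cintegrable mu f ->
  cint mu (fun x => f (h x)) = c%:C * cint mu f.
Proof.
move=> sh [f1 f2]; apply: complexP; rewrite ?ReM ?ImM /= mul0r ?subr0 ?addr0.
  by case: (scales_Rintegral sh f1).
by case: (scales_Rintegral sh f2).
Qed.

Lemma scales_n2 h c (f : T -> R[i]) : scales h c -> cmf f ->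
  n2 mu (fun x => f (h x)) = (c%:E * n2 mu f)%E.
Proof.
move=> [mh c0 H] mf; rewrite /n2 (H (fun x => (sqm (f x))%:E)) //.
  exact/measurable_EFinP/measurable_sqm.
by move=> x; rewrite lee_fin sqm_ge0.
Qed.

End scales.

Section affine1.
Context {R : realType}.
Local Notation RR := (measurableTypeR R).
Local Notation mu := (@lebesgue_measure R).

Lemma measurable_affine (a b : R) : @measurable_fun _ _ RR RR setT (fun x : R => a * x + b).
Proof.
have H : @measurable_fun _ _ R R setT (fun x : R => a * x + b).
  by apply: measurable_funD => //; exact: measurable_funM.
exact: H.
Qed.

(** The scaled pushforward is a measure with the right value on half-open intervals, and these
    determine Lebesgue measure. *)
Lemma pushforward_affine (a b : R) (a0 : 0 < a) (A : set RR) : measurable A ->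
  (a%:E * pushforward mu ((fun x : R => (a * x + b)%R) : RR -> RR) A = mu A)%E.
Proof.
move=> mA; have mh := measurable_affine a b.
pose k := NngNum (ltW a0).
pose m := mscale k (pushforward mu ((fun x : R => a * x + b) : RR -> RR)).
suff : forall X, ocitv X -> mu X = m mh X.
  by move=> h; have := lebesgue_measure_unique (mu := m mh) h mA => ->.
move=> _ [[u v]] _ <-; rewrite /m /mscale /= /pushforward.
have -> : (fun x : R => a * x + b) @^-1` `]u, v]%classic = `](u - b) / a, (v - b) / a]%classic.
  apply/seteqP; split => x /=; rewrite !in_itv /= ltr_pdivrMr // ler_pdivlMr // [x * a]mulrC.
    by move=> /andP[p q]; apply/andP; split; lra.
  by move=> /andP[p q]; apply/andP; split; lra.
rewrite !lebesgue_measure_itv /= !lte_fin ltr_pM2r ?invr_gt0 // ltrD2r.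
case: ifP => _; last by rewrite mule0.
by rewrite -!EFinB -EFinM; congr EFin; field; rewrite gt_eqF.
Qed.

Lemma ge0_integral_affine (a b : R) (g : RR -> \bar R) : 0 < a ->
  measurable_fun setT g -> (forall x, 0 <= g x)%E ->
  (\int[mu]_x g ((a * x + b)%R : RR) = (a^-1)%:E * \int[mu]_x g x)%E.
Proof.
move=> a0 mg g0; have mh := measurable_affine a b.
pose k := NngNum (ltW a0).
pose m := mscale k (pushforward mu ((fun x : R => a * x + b) : RR -> RR)).
have -> : (\int[mu]_x g x = \int[m mh]_x g x)%E.
  apply: eq_measure_integral => A mA _; exact/esym/(pushforward_affine b a0).
rewrite ge0_integral_mscale // (ge0_integral_pushforward mh) //=.
by rewrite muleA -EFinM mulVf ?mul1e // gt_eqF.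
Qed.

End affine1.

Section affine2.
Context {R : realType}.
Local Notation RR := (measurableTypeR R).
Local Notation PP := (RR * RR)%type.
Local Notation mu := (@lebesgue_measure R).
Local Notation mu2 := (mu \x mu)%E.

Lemma measurable_pairR (f g : PP -> R) : @measurable_fun _ _ PP R setT f ->
  @measurable_fun _ _ PP R setT g -> @measurable_fun _ _ PP PP setT (fun x => (f x, g x) : PP).
Proof.
move=> mf mg; apply/measurable_fun_pairP; split; [exact: mf|exact: mg].
Qed.

Lemma measurable_fstR : @measurable_fun _ _ PP R setT (fun x : PP => x.1 : R).
Proof. exact: (@measurable_fst _ _ RR RR). Qed.

Lemma measurable_sndR : @measurable_fun _ _ PP R setT (fun x : PP => x.2 : R).
Proof. exact: (@measurable_snd _ _ RR RR). Qed.

Lemma measurable_aff2 (a b c : R) :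
  @measurable_fun _ _ PP R setT (fun x : PP => a * (x.1 : R) + b * (x.2 : R) + c).
Proof.
have m1 := measurable_fstR; have m2 := measurable_sndR.
by apply: measurable_funD => //; apply: measurable_funD; exact: measurable_funM.
Qed.

(** Maps that change one coordinate only: Tonelli reduces them to a substitution on the line, and
    their compositions supply the translations, dilations and rotations below. *)
Definition affx (a s u : R) (x : PP) : PP := (a * (x.1 : R) + s * (x.2 : R) + u, x.2).
Definition affy (a s u : R) (x : PP) : PP := (x.1, s * (x.1 : R) + a * (x.2 : R) + u).

Lemma scales_affx (a s u : R) : 0 < a -> scales mu2 (affx a s u) a^-1.
Proof.
move=> a0; have mh : measurable_fun setT (affx a s u).
  by apply: measurable_pairR; [exact: measurable_aff2|exact: measurable_sndR].
split=> //; first by rewrite invr_ge0 ltW.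
move=> g mg g0.
have mgh : measurable_fun setT (g \o affx a s u) by exact: measurableT_comp.
have gh0 x : (0 <= (g \o affx a s u) x)%E by exact: g0.
rewrite -[LHS]/(\int[mu2]_z (g \o affx a s u) z)%E (fubini_tonelli2 _ mgh gh0).
rewrite (fubini_tonelli2 g mg g0).
rewrite -ge0_integralZl_EFin //; first last.
- by rewrite invr_ge0 ltW.
- exact: measurable_fun_fubini_tonelli_G.
- by move=> y _; apply: integral_ge0.
apply: eq_integral => y _; rewrite /fubini_G /=.
rewrite -(ge0_integral_affine (s * y + u) (g := fun x => g (x, y))) //.
  by apply: eq_integral => x _; rewrite /affx /= addrA.
exact: (measurableT_comp mg (pair2_measurable y)).
Qed.

Lemma scales_affy (a s u : R) : 0 < a -> scales mu2 (affy a s u) a^-1.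
Proof.
move=> a0; have mh : measurable_fun setT (affy a s u).
  by apply: measurable_pairR; [exact: measurable_fstR|exact: measurable_aff2].
split=> //; first by rewrite invr_ge0 ltW.
move=> g mg g0.
have mgh : measurable_fun setT (g \o affy a s u) by exact: measurableT_comp.
have gh0 x : (0 <= (g \o affy a s u) x)%E by exact: g0.
rewrite -[LHS]/(\int[mu2]_z (g \o affy a s u) z)%E (fubini_tonelli1 _ mgh gh0).
rewrite (fubini_tonelli1 g mg g0).
rewrite -ge0_integralZl_EFin //; first last.
- by rewrite invr_ge0 ltW.
- exact: measurable_fun_fubini_tonelli_F.
- by move=> y _; apply: integral_ge0.
apply: eq_integral => x _; rewrite /fubini_F /=.
rewrite -(ge0_integral_affine (s * x + u) (g := fun y => g (x, y))) //.
  by apply: eq_integral => y _; rewrite /affy /= addrCA addrA [_ + a * _]addrC.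
exact: (measurableT_comp mg (pair1_measurable x)).
Qed.

Lemma eq_scales (h h' : PP -> PP) c c' : scales mu2 h c -> h =1 h' -> c = c' -> scales mu2 h' c'.
Proof. by move=> + /funext <- <-. Qed.

Lemma scales_translate (v : PP) : scales mu2 (fun x : PP => ((x.1 : R) + v.1, (x.2 : R) + v.2)) 1.
Proof.
apply: (eq_scales (scales_comp (scales_affx 0 v.1 (@ltr01 R)) (scales_affy 0 v.2 (@ltr01 R)))).
  by move=> x; rewrite /affx /affy /= !mul1r !mul0r addr0 add0r.
by rewrite invr1 mulr1.
Qed.

Lemma scales_dilate (a b : R) : 0 < a -> 0 < b ->
  scales mu2 (fun x : PP => (a * (x.1 : R), b * (x.2 : R))) (a * b)^-1.
Proof.
move=> a0 b0; apply: (eq_scales (scales_comp (scales_affx 0 0 a0) (scales_affy 0 0 b0))).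
  by move=> x; rewrite /affx /affy /= !mul0r !addr0 add0r.
by rewrite invfM.
Qed.

(* A rotation is a product of three shears. *)
Lemma scales_rotv (t : R) : cos (t / 2) != 0 -> scales mu2 (rotv t : PP -> PP) 1.
Proof.
(* [w] is -tan(t/2): the horizontal shear by [w] is applied before and after the vertical shear by
   [sin t]. *)
move=> c0; set c := cos (t / 2) in c0; pose s := sin (t / 2); pose w := - (s / c).
have ht : t = (t / 2) *+ 2 by rewrite mulr2n; field.
have cs : c ^+ 2 + s ^+ 2 = 1 by exact: cos2Dsin2.
have st : sin t = 2 * (c * s) by rewrite {1}ht sin_mulr2n mulr2n /c /s; ring.
have ct : cos t = 2 * c ^+ 2 - 1 by rewrite {1}ht cos_mulr2n mulr2n /c; ring.
have e1 : 1 + w * sin t = cos t.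
  have s2 : s ^+ 2 = 1 - c ^+ 2 by rewrite -cs; ring.
  by transitivity (1 - 2 * s ^+ 2); [rewrite st /w; field|rewrite s2 ct; ring].
have e2 : w * (1 + cos t) = - sin t.
  by rewrite st ct /w; field.
apply: (eq_scales (scales_comp (scales_affx w 0 (@ltr01 R))
  (scales_comp (scales_affy (sin t) 0 (@ltr01 R)) (scales_affx w 0 (@ltr01 R))))).
  move=> [x y]; rewrite /affx /affy /rotv /= !mul1r !addr0; congr pair.
    transitivity ((1 + w * sin t) * x + w * (1 + (1 + w * sin t)) * y); first by ring.
    by rewrite e1 e2 mulNr.
  by transitivity (sin t * x + (1 + w * sin t) * y); [ring|rewrite e1].
by rewrite !invr1 !mulr1.
Qed.

End affine2.

Section integral_esum.
Context d (T : measurableType d) {R : realType}.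
Context (mu : {measure set T -> \bar R}).

(** Turns the sum into a series so that monotone convergence applies. [i0] is a default that is
    never summed, as only codes of elements are kept. *)
Lemma esum_countable (I : countType) (i0 : I) (a : I -> \bar R) : (forall i, 0 <= a i)%E ->
  (\esum_(i in [set: I]) a i =
   \sum_(0 <= n <oo | isSome (@pickle_inv I n)) a (odflt i0 (@pickle_inv I n)))%E.
Proof.
move=> a0; pose e n := odflt i0 (@pickle_inv I n).
rewrite -(@esum_pred_image R I a e (fun n => isSome (@pickle_inv I n))).
- congr esum; apply/seteqP; split => // i _; exists (pickle i) => /=.
    by rewrite pickleK_inv.
  by rewrite /e pickleK_inv.
- by move=> n _; exact: a0.
- move=> m n; rewrite !inE /e.
  have := @pickle_invK I m; have := @pickle_invK I n.
  by case: pickle_inv => // y; case: pickle_inv => // x /= <- <- _ _ ->.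
Qed.

Lemma integral_esum (I : countType) (i0 : I) (f : I -> T -> \bar R) :
  (forall i, measurable_fun setT (f i)) -> (forall i x, 0 <= f i x)%E ->
  (\int[mu]_x (\esum_(i in [set: I]) f i x) = \esum_(i in [set: I]) (\int[mu]_x f i x))%E.
Proof.
move=> mf f0.
rewrite (esum_countable i0) => [|i]; last exact: integral_ge0.
under eq_integral do rewrite (esum_countable i0) // eseries_mkcond.
rewrite integral_nneseries //.
- rewrite [RHS]eseries_mkcond; apply: eq_eseriesr => n _.
  by case: pickle_inv => [i|] //=; rewrite integral0.
- by move=> n; case: pickle_inv => [i|] //=; exact: measurable_cst.
- by move=> n x _; case: pickle_inv => [i|] //=.
Qed.

End integral_esum.

(** * Parseval's identity on the square *)

Section parseval2.
Context {R : realType}.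
Local Notation RR := (measurableTypeR R).
Local Notation PP := (RR * RR)%type.
Local Notation mu := (@lebesgue_measure R).
Local Notation mu2 := (mu \x mu)%E.

Definition usq : set PP := uitv `*` uitv.

Lemma measurable_usq : measurable usq.
Proof. by apply: measurableX; exact: measurable_uitv. Qed.

Lemma mu2_usq : mu2 usq = 1%E.
Proof.
rewrite /usq product_measure1E; [|exact: measurable_uitv..].
by rewrite [X in (X * _)%E]mu_uitvE [X in (_ * X)%E]mu_uitvE mule1.
Qed.

Definition fbas2 (k : int * int) : PP -> R[i] := fun x => fbas k.1 x.1 * fbas k.2 x.2.

Lemma cmf_fbas2 k : cmf (fbas2 k).
Proof.
apply: cmfM.
  exact: (cmf_comp (@cmf_fbas R k.1) (@measurable_fst _ _ RR RR)).
exact: (cmf_comp (@cmf_fbas R k.2) (@measurable_snd _ _ RR RR)).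
Qed.

Lemma sqm_fbas2 k x : sqm (fbas2 k x) = \1_usq x.
Proof.
rewrite /fbas2 sqmM !sqm_fbas /usq !indicE -natrM mulnb; congr (_ %:R); congr nat_of_bool.
by rewrite in_setX.
Qed.

(** The one-dimensional identity is applied to each slice in the first variable, integrated over the
    second, and applied again to each coefficient [G k] as a function of the second. [G k] is
    admissible: Bessel's inequality bounds it by [M], and it vanishes beyond 3/8. *)
Lemma parseval2 (F : PP -> R[i]) (M : R) : cmf F -> (forall x, sqm (F x) <= M) ->
  (forall x : R * R, 3 / 8 < `|x.1| -> F x = 0) -> (forall x : R * R, 3 / 8 < `|x.2| -> F x = 0) ->
  fsum mu2 setT fbas2 F = n2 mu2 F.
Proof.
move=> mF FM F1 F2.
have M0 : 0 <= M := le_trans (sqm_ge0 _) (FM 0).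
pose S (y : RR) : RR -> R[i] := fun x => F (x, y).
have mS y : cmf (S y) by exact: (cmf_comp mF (pair2_measurable y)).
have LS y : L2 mu (S y).
  apply: (L2_bounded (M := M) measurable_uitv mu_uitv (mS y)) => x.
  have [hx|hx] := leP `|x : R| (7 / 16).
    by rewrite indicE mem_set ?mulr1; [exact: FM|exact: uitv_supp].
  by rewrite /S F1 ?sqm0 ?mulr_ge0 //=; apply: lt_trans hx; lra.
pose G k (y : RR) : R[i] := fcoef (S y) k.
have mG k : cmf (G k).
  apply: (@cmf_fubini _ _ RR RR R mu (fun z : RR * RR => S z.1 z.2 * (fbas k z.2)^*%C)).
  apply: cmfM; first exact: (cmf_comp mF (@measurable_swap _ _ RR RR)).
  by apply: cmfJ; exact: (cmf_comp (@cmf_fbas R k) (@measurable_snd _ _ RR RR)).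
have GM k y : sqm (G k y) <= M.
  have := @fbessel R (S y) [:: k] isT (LS y); rewrite big_seq1 => /le_trans; apply.
  rewrite -lee_fin -n2_EFin //.
  have := n2_bounded_le (A := uitv) (f := S y) (M := M) mu measurable_uitv M0 (mS y).
  rewrite [X in (_ <= _ * X)%E](_ : _ = 1%E); last exact: mu_uitvE.
  rewrite mule1; apply => x; have [hx|hx] := leP `|x : R| (7 / 16).
    by rewrite indicE mem_set ?mulr1; [exact: FM|exact: uitv_supp].
  by rewrite /S F1 ?sqm0 ?mulr_ge0 //=; apply: lt_trans hx; lra.
have G0 k (y : R) : 3 / 8 < `|y| -> G k y = 0.
  move=> hy; rewrite /G /fcoef /inn -[RHS](@cint0 _ _ R mu); apply: eq_cint => x.
  by rewrite /S F2 // mul0r.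
have -> : n2 mu2 F = (\int[mu]_y n2 mu (S y))%E.
  rewrite /n2 (fubini_tonelli2 (fun z => (sqm (F z))%:E)) //.
    exact/measurable_EFinP/measurable_sqm.
  by move=> z; rewrite lee_fin sqm_ge0.
transitivity (\int[mu]_y (\esum_(k in [set: int]) (sqm (G k y))%:E))%E; last first.
  apply: eq_integral => y _; rewrite -(parseval_bounded (M := M) (mS y)) //.
  - by move=> x; exact: FM.
  - by move=> x hx; rewrite /S F1.
rewrite (integral_esum _ 0) => [|k|k y]; last 2 first.
- exact/measurable_EFinP/measurable_sqm.
- by rewrite lee_fin sqm_ge0.
transitivity (\esum_(k in [set: int]) \esum_(l in [set: int]) (sqm (inn mu (G k) (fbas l)))%:E)%E; last first.
  by apply: eq_esum => k _; exact: (parseval_bounded (mG k) (GM k) (G0 k)).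
rewrite esum_esum; last by move=> k l _ _; rewrite lee_fin sqm_ge0.
rewrite /fsum (_ : [set: int] `*`` (fun=> [set: int]) = [set: int * int]); last first.
  by apply/seteqP; split => // -[].
apply: eq_esum => -[k l] _; congr (sqm _)%:E.
rewrite /inn cfubini2; last 2 first.
- apply: (cintegrable_bounded (M := M) measurable_usq).
  + by rewrite [X in (X < _)%E](_ : _ = 1%E) ?ltry //; exact: mu2_usq.
  + by apply: cmfM => //; apply: cmfJ; exact: cmf_fbas2.
  + by move=> x; rewrite sqmM sqm_conj sqm_fbas2 ler_wpM2r // ?FM.
- move=> y; apply: (cintegrable_bounded (M := M) measurable_uitv mu_uitv).
    apply: (cmf_comp (f := fun z => F z * (fbas2 (k, l) z)^*%C) _ (pair2_measurable y)).
    by apply: cmfM => //; apply: cmfJ; exact: cmf_fbas2.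
  move=> x; rewrite sqmM sqm_conj sqm_fbas2 ler_pM ?sqm_ge0 ?FM //.
  rewrite /usq !indicE ler_nat; case: (boolP (_ \in _)) => //; rewrite inE /= => -[xu _].
  by rewrite mem_set.
apply: eq_cint => y; rewrite /G /fcoef /inn [RHS]mulrC -cintZ.
  by apply: eq_cint => x; rewrite /fbas2 conjcM /S [(k, l).1]/= [(k, l).2]/= [(x, y).1]/= [(x, y).2]/=; ring.
by apply: L2_cintegrable => //; exact: L2_fbas.
Qed.

End parseval2.

(** * The Fourier-Plancherel transform *)

Section bounded_compact.
Context {R : realType}.
Local Notation RR := (measurableTypeR R).
Local Notation PP := (RR * RR)%type.
Local Notation mu := (@lebesgue_measure R).
Local Notation mu2 := (mu \x mu)%E.
Implicit Types (f g : PP -> R[i]).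

Definition box (N : R) : set PP := `[- N, N]%classic `*` `[- N, N]%classic.

Lemma measurable_box N : measurable (box N).
Proof. by apply: measurableX; exact: measurable_itv. Qed.

Lemma mu2_box N : (mu2 (box N) < +oo)%E.
Proof.
pose I : set RR := `[- N, N]%classic.
have h : (mu I < +oo)%E.
  by rewrite /I lebesgue_measure_itv /=; case: ifP => _; rewrite ?ltry // -EFinB ltry.
have h' : mu I \is a fin_num by rewrite ge0_fin_numE.
have -> : mu2 (box N) = (mu I * mu I)%E by rewrite /box product_measure1E //; exact: measurable_itv.
by rewrite -(fineK h') -EFinM ltry.
Qed.

Lemma boxP N (x : R * R) : box N x <-> `|x.1| <= N /\ `|x.2| <= N.
Proof.
by rewrite /box /= !in_itv /= !ler_norml; split=> -[].
Qed.

(** The dense class: contained in L1 and L2, stable under translations, conjugation and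
    multiplication by bounded functions, and wide enough to contain the multipliers. *)
Definition bcs f := cmf f /\ exists M N : R, 0 <= M /\ forall x, sqm (f x) <= M * \1_(box N) x.

Lemma bcsP f (M N : R) : cmf f -> (forall x, sqm (f x) <= M) ->
  (forall x, ~ box N x -> f x = 0) -> bcs f.
Proof.
move=> mf fM f0; have M0 : 0 <= M := le_trans (sqm_ge0 _) (fM (0, 0)).
split => //; exists M, N; split => // x.
have [bx|bx] := pselect (box N x); first by rewrite indicE mem_set // mulr1.
by rewrite f0 // sqm0 mulr_ge0.
Qed.

Lemma bcs_cmf f : bcs f -> cmf f. Proof. by case. Qed.

Lemma bcs_bound f : bcs f -> exists M N : R, [/\ 0 <= M, 0 < N, (forall x, sqm (f x) <= M) &
  (forall x, ~ box N x -> f x = 0)].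
Proof.
move=> [mf [M [N [M0 fM]]]]; exists M, (`|N| + 1); split => //.
- move=> x; apply: le_trans (fM x) _; rewrite indicE.
  by case: (_ \in _); rewrite ?mulr1 ?mulr0.
- move=> x nx; apply/sqm_eq0/eqP; rewrite eq_le sqm_ge0 andbT; apply: le_trans (fM x) _.
  rewrite indicE memNset ?mulr0 // => /boxP[a b]; apply: nx; apply/boxP.
  have h : N <= `|N| + 1 by apply: le_trans (ler_norm N) _; rewrite lerDl.
  by split; [exact: le_trans a h|exact: le_trans b h].
Qed.

Lemma bcs_L2 f : bcs f -> L2 mu2 f.
Proof. by move=> [mf [M [N [M0 fM]]]]; exact: (L2_bounded (measurable_box N) (mu2_box N) mf fM). Qed.

Lemma bcs_cint f : bcs f -> cintegrable mu2 f.
Proof. by move=> [mf [M [N [M0 fM]]]]; exact: (cintegrable_bounded (measurable_box N) (mu2_box N) mf fM). Qed.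

Lemma bcsM f g : bcs f -> cmf g -> (exists M, forall x, sqm (g x) <= M) -> bcs (fun x => f x * g x).
Proof.
move=> /[dup] bf /bcs_bound[M [N [M0 N0 fM f0]]] mg [M' gM].
have M'0 : 0 <= M' := le_trans (sqm_ge0 _) (gM (0, 0)).
apply: (@bcsP _ (M * M') N); first by apply: cmfM => //; exact: bcs_cmf.
  by move=> x; rewrite sqmM ler_pM ?sqm_ge0.
by move=> x /f0 ->; rewrite mul0r.
Qed.

Lemma bcsD f g : bcs f -> bcs g -> bcs (fun x => f x + g x).
Proof.
move=> /[dup] bf /bcs_bound[M [N [M0 N0 fM f0]]] /[dup] bg /bcs_bound[M' [N' [M'0 N'0 gM g0]]].
apply: (@bcsP _ (2 * M + 2 * M') (Num.max N N')).
- by apply: cmfD; exact: bcs_cmf.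
- by move=> x; apply: le_trans (sqmD2 _ _) _; apply: lerD; rewrite ler_wpM2l.
move=> x nx; rewrite f0 ?g0 ?addr0 // => /boxP[a b]; apply: nx; apply/boxP;
  by rewrite !le_max ?a ?b ?orbT.
Qed.

Lemma bcsN f : bcs f -> bcs (fun x => - f x).
Proof.
move=> bf; rewrite (_ : (fun x => _) = (fun x => f x * (-1))); last first.
  by apply/funext => x; rewrite mulrN1.
by apply: bcsM => //; exists (sqm (-1)).
Qed.

Lemma bcsB f g : bcs f -> bcs g -> bcs (fun x => f x - g x).
Proof. by move=> bf bg; apply: bcsD => //; exact: bcsN. Qed.

Lemma bcsJ f : bcs f -> bcs (fun x => (f x)^*%C).
Proof.
move=> /[dup] bf /bcs_bound[M [N [M0 N0 fM f0]]]; apply: (@bcsP _ M N).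
- by apply: cmfJ; exact: bcs_cmf.
- by move=> x; rewrite sqm_conj.
- by move=> x /f0 ->; rewrite conjc0.
Qed.

(** Domain and values are truncated together; at each point the truncation equals [f] once [n] is
    large ([near_trunc]). *)
Definition trunc (n : nat) f := cut (box n%:R `&` [set x | sqm (f x) <= n%:R]) f.

Lemma measurable_trunc_set n f : cmf f -> measurable (box n%:R `&` [set x | sqm (f x) <= n%:R]).
Proof.
move=> mf; apply: measurableI; first exact: measurable_box.
have := measurable_sqm mf => ms.
by have := ms measurableT `]-oo, n%:R]%classic (measurable_itv _); rewrite setTI set_itvE.
Qed.

Lemma bcs_trunc n f : cmf f -> bcs (trunc n f).
Proof.
move=> mf; apply: (@bcsP _ n%:R n%:R).
- by apply: cmf_cut => //; exact: measurable_trunc_set.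
- move=> x; rewrite /trunc; have [[bx h]|nx] := pselect ((box n%:R `&` [set x | sqm (f x) <= n%:R]) x).
    by rewrite cut_in.
  by rewrite cut_out // sqm0.
- by move=> x nx; rewrite /trunc cut_out // => -[].
Qed.

Lemma near_trunc f x : \forall n \near \oo, (box n%:R `&` [set x | sqm (f x) <= n%:R]) x.
Proof.
exists (Num.truncn (Num.max (sqm (f x)) (Num.max `|x.1 : R| `|x.2 : R|))).+1 => // n /=.
set m := Num.max _ _ => mn.
have h : m <= n%:R.
  apply: ltW; apply: lt_le_trans (truncnS_gt m) _; by rewrite ler_nat.
split; last by apply: le_trans h; rewrite le_max lexx.
by apply/boxP; split; apply: le_trans h; rewrite !le_max lexx ?orbT.
Qed.

Lemma trunc_cvg f x : (fun n => sqm (trunc n f x - f x)) @ \oo --> (0 : R).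
Proof. exact: (cvg_cut f (near_trunc f x)). Qed.

Lemma trunc_L2 f : L2 mu2 f -> (fun n => n2 mu2 (fun x => trunc n f x - f x)) @ \oo --> 0%E.
Proof.
move=> Lf; apply: n2_cut => //.
  by move=> n; apply: measurable_trunc_set; exact: L2_cmf Lf.
by move=> x; exact: near_trunc.
Qed.

End bounded_compact.

Section sigma_finite_product.
Context {R : realType}.
Local Notation mu := (@lebesgue_measure R).
Local Notation mu2 := (mu \x mu)%E.

Lemma sigma_finite_mu2 : sigma_finite setT mu2.
Proof.
exists (fun n => box n%:R) => [|n]; last by split; [exact: measurable_box|exact: mu2_box].
apply/seteqP; split => // x _; have [n _ h] := near_trunc (fun=> 0) x.
by exists n => //; have [] := h n (leqnn n).
Qed.

(* The product measure has no sigma-finite structure; this alias receives one. *)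
Definition leb2s : set (measurableTypeR R * measurableTypeR R)%type -> \bar R := mu2.

HB.instance Definition _ := Measure.copy leb2s mu2.
HB.instance Definition _ := Measure_isSigmaFinite.Build _ _ _ leb2s sigma_finite_mu2.

End sigma_finite_product.

(** * Plancherel's identity for bounded functions of bounded support *)

Section plancherel_bcs.
Context {R : realType}.
Local Notation RR := (measurableTypeR R).
Local Notation PP := (RR * RR)%type.
Local Notation mu := (@lebesgue_measure R).
Local Notation mu2 := (mu \x mu)%E.
Implicit Types (f g : PP -> R[i]).

Definition chr (x xi : R * R) : R[i] := expi (- (2 * pi * dot x xi)).

(** Convertible with [fourier], but written with [cint], so that the lemmas on complex integrals
    apply. *)
Definition ft f : PP -> R[i] := fun xi => cint mu2 (fun x => f x * chr x xi).

Lemma sqm_chr x xi : sqm (chr x xi) = 1.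
Proof. exact: sqm_expi. Qed.

Lemma chrC x xi : chr x xi = chr xi x.
Proof. by rewrite /chr; congr expi; rewrite /dot; ring. Qed.

Lemma cmf_chrl (xi : R * R) : @cmf _ PP R (fun x => chr x xi).
Proof.
apply: cmf_expi.
have h := measurable_aff2 (- (2 * pi * xi.1)) (- (2 * pi * xi.2)) 0.
by apply: eq_measurable_fun h => x _; rewrite /dot /=; ring.
Qed.

Lemma cmf_chrr (x : R * R) : @cmf _ PP R (chr x).
Proof. by rewrite (_ : chr x = fun xi => chr xi x); [exact: cmf_chrl|apply/funext => xi; exact: chrC]. Qed.

Lemma fbas2E (k : int * int) (x : PP) : usq x -> (fbas2 k x)^*%C = chr (int2 k) x.
Proof.
move=> [x1 x2]; rewrite /fbas2 /fbas !cut_in // /fexp -expiD -expiN /chr; congr expi.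
by rewrite /dot /int2 /=; ring.
Qed.

(** [f] is pulled back by [h] into the unit square, where [E k] becomes the conjugate of [fbas2 k],
    and Parseval's identity is applied there. Only the values of the characters on the support
    matter, so [E] may be any family that [h] carries to the integer characters. *)
Lemma lattice_parseval (h : PP -> PP) (c : R) (E : int * int -> PP -> R[i]) f :
  scales mu2 h c -> 0 < c -> bcs f -> (forall k, cmf (E k)) -> (forall k x, sqm (E k x) = 1) ->
  (forall x : R * R, 3 / 8 < `|x.1| -> f (h x) = 0) ->
  (forall x : R * R, 3 / 8 < `|x.2| -> f (h x) = 0) ->
  (forall k x, E k (h x) = chr (int2 k) x) ->
  (\esum_(k in [set: int * int]) (sqm (cint mu2 (fun x => f x * E k x)))%:E =
   (c^-1)%:E * n2 mu2 f)%E.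
Proof.
move=> sh c0 bf mE E1 f1 f2 Eh.
have [M [N [M0 N0 fM f0]]] := bcs_bound bf; have mf := bcs_cmf bf.
have [mh _ _] := sh.
have cn0 : c != 0 by rewrite gt_eqF.
have mfh : cmf (fun x => f (h x)) by exact: cmf_comp mf mh.
(* The factor cancels the Jacobian in the coefficients; in the squared norm it leaves
   [c^-2 * c = c^-1]. *)
pose G x := (c^-1)%:C * f (h x).
have G0 x : f (h x) = 0 -> G x = 0 by rewrite /G => ->; rewrite mulr0.
have := @parseval2 R G (sqm (c^-1)%:C * M) _ _ (fun x hx => G0 x (f1 x hx)) (fun x hx => G0 x (f2 x hx)).
have -> : n2 mu2 G = ((c^-1)%:E * n2 mu2 f)%E.
  rewrite n2Z // (scales_n2 sh mf) muleA -EFinM sqmR; congr (_%:E * _)%E.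
  by field.
move=> <-.
- apply: eq_esum => k _; congr (sqm _)%:E.
  have bE : cintegrable mu2 (fun x => f x * E k x).
    by apply: bcs_cint; apply: bcsM => //; exists 1 => x; rewrite E1.
  have [mfE _] := bE.
  have shE := scales_cint sh bE.
  transitivity ((c^-1)%:C * cint mu2 (fun x => f (h x) * E k (h x))).
    by rewrite shE mulrA -rmorphM /= mulVf // mul1r.
  rewrite -cintZ.
    apply: eq_cint => x; rewrite /G mulrA.
    have [xu|xu] := pselect (usq x); first by rewrite fbas2E // Eh.
    have -> : f (h x) = 0; last by rewrite mulr0 !mul0r.
    have [a|a] := ltP (3 / 8) `|x.1 : R|; first exact: f1.
    have [b|b] := ltP (3 / 8) `|x.2 : R|; first exact: f2.
    by exfalso; apply: xu; split; apply: uitv_supp; [apply: le_trans a _|apply: le_trans b _]; lra.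
  have [[i1 i2] [mh' _ _]] := (bE, sh); split.
    by case: (scales_Rintegral sh i1).
  by case: (scales_Rintegral sh i2).
- by apply: cmfM => //; exact: cmf_cst.
- by move=> x; rewrite sqmM ler_wpM2l ?sqm_ge0.
Qed.

Definition tile : set PP := `[0, 1[%classic `*` `[0, 1[%classic.

Lemma measurable_tile : measurable tile.
Proof. by apply: measurableX; exact: measurable_itv. Qed.

Lemma mu2_tile : mu2 tile = 1%E.
Proof.
have h : mu (`[0, 1[%classic : set RR) = 1%E.
  by rewrite lebesgue_measure_itv /= lte_fin ltr01 oppr0 adde0.
rewrite /tile product_measure1E; [|exact: measurable_itv..].
by rewrite [X in (X * _)%E]h [X in (_ * X)%E]h mule1.
Qed.

(** The integer translates of the half-open unit square partition the plane: the cell of a point is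
    given by the floors of its coordinates. *)
Lemma tiling (g : PP -> \bar R) : measurable_fun setT g -> (forall x, 0 <= g x)%E ->
  (\int[mu2]_t (\esum_(k in [set: int * int])
     ((\1_tile t)%:E * g (t.1 + k.1%:~R, t.2 + k.2%:~R)%R)) = \int[mu2]_x g x)%E.
Proof.
move=> mg g0.
have st (k : int * int) := @scales_translate R (k.1%:~R, k.2%:~R).
have mi : measurable_fun setT (fun t => (\1_tile t)%:E : \bar R).
  by apply/measurable_EFinP/measurable_indic; exact: measurable_tile.
have i0 t : (0 <= (\1_tile t)%:E :> \bar R)%E by rewrite lee_fin.
rewrite (integral_esum _ (0, 0)); first last.
- by move=> k t; rewrite mule_ge0.
- move=> k; apply: emeasurable_funM => //.
  by have [mh _ _] := st k; exact: (measurableT_comp mg mh).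
pose sh (k : int * int) (x : PP) : PP := (x.1 - k.1%:~R, x.2 - k.2%:~R).
have msh k : measurable_fun setT (sh k).
  by have [mh _ _] := @scales_translate R (- k.1%:~R, - k.2%:~R); exact: mh.
pose gk (k : int * int) (x : PP) := ((\1_tile (sh k x))%:E * g x)%E.
have mgk k : measurable_fun setT (gk k).
  by apply: emeasurable_funM => //; exact: (measurableT_comp mi (msh k)).
have gk0 k x : (0 <= gk k x)%E by rewrite mule_ge0.
transitivity (\esum_(k in [set: int * int]) (\int[mu2]_x gk k x))%E.
  apply: eq_esum => k _; have [_ _ H] := st k.
  have := H _ (mgk k) (gk0 k); rewrite mul1e => <-.
  by apply: eq_integral => x _; rewrite /gk /sh /= !addrK; case: (x).
rewrite -(integral_esum _ (0, 0)) //; apply: eq_integral => x _.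
pose k0 : int * int := (Num.floor (x.1 : R), Num.floor (x.2 : R)).
have tk k : gk k x = if k \in [set k0] then g x else 0%E.
  have fl (r : R) (m : int) : (0 <= r - m%:~R < 1) = (m == Num.floor r).
    rewrite eq_sym floor_eq //; apply/idP/idP => /andP[a b]; apply/andP; split; rewrite ?intrD; lra.
  rewrite /gk indicE /tile in_setX !mem_setE /sh /= !in_itv /= !fl.
  have -> : (k \in [set k0]) = (k.1 == Num.floor (x.1 : R)) && (k.2 == Num.floor (x.2 : R)).
    by apply/idP/idP; rewrite inE; [move=> ->; rewrite !eqxx|case: k => ? ? /= /andP[/eqP -> /eqP ->]].
  by case: ifP => _; rewrite ?mul1e ?mul0e.
under eq_esum do rewrite tk.
by rewrite -esum_mkcond esum_set1.
Qed.

(** The frequency comes first and the space variable second, so that [cmf_fubini] integrates the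
    latter out. *)
Lemma cmf_ft_kernel f : cmf f -> @cmf _ (PP * PP)%type R (fun z => f z.2 * chr z.2 z.1).
Proof.
move=> mf.
apply: cmfM; first exact: (cmf_comp mf (@measurable_snd _ _ PP PP)).
apply: cmf_expi.
have p11 : @measurable_fun _ _ (PP * PP)%type R setT (fun z => z.1.1).
  exact: (measurableT_comp measurable_fstR (@measurable_fst _ _ PP PP)).
have p12 : @measurable_fun _ _ (PP * PP)%type R setT (fun z => z.1.2).
  exact: (measurableT_comp measurable_sndR (@measurable_fst _ _ PP PP)).
have p21 : @measurable_fun _ _ (PP * PP)%type R setT (fun z => z.2.1).
  exact: (measurableT_comp measurable_fstR (@measurable_snd _ _ PP PP)).
have p22 : @measurable_fun _ _ (PP * PP)%type R setT (fun z => z.2.2).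
  exact: (measurableT_comp measurable_sndR (@measurable_snd _ _ PP PP)).
have h : @measurable_fun _ _ (PP * PP)%type R setT
  (fun z => (- (2 * pi)) * (z.2.1 * z.1.1 + z.2.2 * z.1.2)).
  by apply: measurable_funM => //; apply: measurable_funD; exact: measurable_funM.
by apply: eq_measurable_fun h => z _; rewrite /dot mulNr.
Qed.

Lemma cmf_ft f : cmf f -> cmf (ft f).
Proof.
move=> mf; have h := cmf_ft_kernel mf.
have h2 := @cmf_fubini _ _ PP PP R (@leb2s R) _ h.
exact: h2.
Qed.

Lemma plancherel_bcs f : bcs f -> n2 mu2 (ft f) = n2 mu2 f.
Proof.
move=> bf; have [M [N [M0 N0 fM f0]]] := bcs_bound bf; have mf := bcs_cmf bf.
have mft := cmf_ft mf.
(* Division by [a] takes the box of half-side [N] to the one of half-side 3/8. *)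
pose a : R := 8 / 3 * N.
have a0 : 0 < a by rewrite mulr_gt0.
have an0 : a != 0 by rewrite gt_eqF.
have aN : 3 / 8 * a = N by rewrite /a; field.
pose d (x : PP) : PP := (a * (x.1 : R), a * (x.2 : R)).
have sd : scales mu2 d (a * a)^-1 := scales_dilate a0 a0.
pose di (x : PP) : PP := (a^-1 * (x.1 : R), a^-1 * (x.2 : R)).
have sdi : scales mu2 di (a^-1 * a^-1)^-1 by apply: scales_dilate; rewrite invr_gt0.
(* The samples of the transform at (t + k)/a are the coefficients, on the square of side [a], of [f]
   modulated by [chr x (di t)]; the modulation does not change the norm. *)
have Q (t : PP) : (\esum_(k in [set: int * int])
    (sqm (ft f (di ((t.1 : R) + k.1%:~R, (t.2 : R) + k.2%:~R)%R)))%:E = (a * a)%:E * n2 mu2 f)%E.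
  have bft : bcs (fun x => f x * chr x (di t)).
    by apply: bcsM => //; [exact: cmf_chrl|exists 1 => x; rewrite sqm_chr].
  have e1 : n2 mu2 f = n2 mu2 (fun x => f x * chr x (di t)).
    by apply: eq_n2 => x; rewrite sqmM sqm_chr mulr1.
  have ci0 : 0 < (a * a)^-1 by rewrite invr_gt0 mulr_gt0.
  have sm (r : R) : 3 / 8 < `|r| -> ~ `|a * r| <= N.
    by move=> hr; apply/negP; rewrite -ltNge normrM (gtr0_norm a0) -aN mulrC ltr_pM2l.
  have LP := @lattice_parseval d _ (fun k x => chr x (di (int2 k))) _ sd ci0 bft
    (fun k => cmf_chrl _) (fun k x => sqm_chr _ _).
  rewrite e1 -[(a * a)%R]invrK -LP.
  - apply: eq_esum => k _; congr (sqm _)%:E; apply: eq_cint => x.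
    rewrite -mulrA /chr -expiD; congr (_ * expi _); rewrite /dot /di /int2 /=; ring.
  - by move=> x hx; rewrite f0 ?mul0r // => /boxP[h _]; exact: (sm _ hx h).
  - by move=> x hx; rewrite f0 ?mul0r // => /boxP[_ h]; exact: (sm _ hx h).
  - by move=> k x; rewrite chrC /chr /dot /di /d /int2 /=; congr expi; field.
have mg : measurable_fun setT (fun x => (sqm (ft f (di x)))%:E).
  by have [mh _ _] := sdi; apply/measurable_EFinP/measurable_sqm; exact: cmf_comp mft mh.
have g0 (x : PP) : (0 <= (sqm (ft f (di x)))%:E)%E by rewrite lee_fin sqm_ge0.
(* As [t] runs over one tile, the sample points sweep out the plane once, so integrating [Q] gives
   the squared norm of the transform. *)
have := tiling mg g0.
have -> : (\int[mu2]_x (sqm (ft f (di x)))%:E = (a * a)%:E * n2 mu2 (ft f))%E.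
  by have := scales_n2 sdi mft; rewrite -invfM invrK.
have fin := bcs_L2 bf; rewrite (n2_EFin fin).
have -> : (\int[mu2]_t (\esum_(k in [set: int * int])
     ((\1_tile t)%:E * (sqm (ft f (di (t.1 + k.1%:~R, t.2 + k.2%:~R)%R)))%:E)) =
     (a * a)%:E * n2 mu2 f)%E.
  transitivity (\int[mu2]_t ((\1_tile t)%:E * ((a * a)%:E * n2 mu2 f)))%E.
    apply: eq_integral => t _; have [tt|tt] := pselect (tile t); last first.
      rewrite indicE memNset // mul0e; apply: esum1 => k _; by rewrite mul0e.
    rewrite indicE mem_set // mul1e -(Q t); apply: eq_esum => k _; by rewrite mul1e.
  rewrite (n2_EFin fin) -EFinM ge0_integralZr //.
  - rewrite integral_indic; [|by []|exact: measurable_tile].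
    by rewrite setIT [X in (X * _)%E](_ : _ = 1%E) ?mul1e //; exact: mu2_tile.
  - by apply/measurable_EFinP/measurable_indic; exact: measurable_tile.
  - by rewrite lee_fin mulr_ge0 ?fine_n2_ge0 // mulr_ge0 // ltW.
rewrite (n2_EFin fin) => e.
have : ((a * a)^-1%:E * ((a * a)%:E * (fine (n2 mu2 f))%:E) =
  (a * a)^-1%:E * ((a * a)%:E * n2 mu2 (ft f)))%E by rewrite e.
have c1 : ((a * a)^-1%:E * (a * a)%:E = 1 :> \bar R)%E by rewrite -EFinM mulVf // mulf_neq0.
by rewrite !muleA c1 !mul1e => <-.
Qed.

End plancherel_bcs.

Section L1.
Context d (T : measurableType d) {R : realType}.
Context (mu : {measure set T -> \bar R}).
Implicit Types (f g : T -> R[i]).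

Definition L1c f := cmf f /\ mu.-integrable setT (EFin \o (fun x => cmod (f x))).

Lemma L1c_cint f : L1c f -> cintegrable mu f.
Proof.
move=> [mf fi]; apply: (le_cintegrable mf fi) => x; first exact: cmod_ge0.
by rewrite cmod_sqr.
Qed.

Lemma cmod_sqrt (z : R[i]) : cmod z = Num.sqrt (sqm z).
Proof. by rewrite -cmod_sqr sqrtr_sqr ger0_norm // cmod_ge0. Qed.

Lemma cmodD (z w : R[i]) : cmod (z + w) <= cmod z + cmod w.
Proof. exact: le_normcD. Qed.

Lemma cmodM (z w : R[i]) : cmod (z * w) = cmod z * cmod w.
Proof. by rewrite !cmod_sqrt sqmM sqrtrM // sqm_ge0. Qed.

Lemma measurable_cmod f : cmf f -> measurable_fun setT (fun x => cmod (f x)).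
Proof.
move=> mf; under eq_fun do rewrite cmod_sqrt.
apply: (measurableT_comp (f := @Num.sqrt R)); last exact: measurable_sqm.
by apply: continuous_measurable_fun; exact: sqrt_continuous.
Qed.

Lemma le_L1c f g : cmf f -> L1c g -> (forall x, sqm (f x) <= sqm (g x)) -> L1c f.
Proof.
move=> mf [mg gi] fg; split => //; apply: (le_integrable measurableT _ _ gi).
  exact/measurable_EFinP/measurable_cmod.
by move=> x _ /=; rewrite lee_fin !ger0_norm ?cmod_ge0 // !cmod_sqrt ler_wsqrtr.
Qed.

Lemma L1cD f g : L1c f -> L1c g -> L1c (fun x => f x + g x).
Proof.
move=> [mf fi] [mg gi]; have mfg := cmfD mf mg; split => //.
apply: (le_integrable measurableT _ _ (integrableD measurableT fi gi)).
  exact/measurable_EFinP/measurable_cmod.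
by move=> x _ /=; rewrite lee_fin !ger0_norm ?addr_ge0 ?cmod_ge0 // cmodD.
Qed.

Lemma L1cZ (z : R[i]) f : L1c f -> L1c (fun x => z * f x).
Proof.
move=> [mf fi]; have mzf := cmfM (cmf_cst T z) mf; split => //.
apply: (eq_integrableT (integrableZl measurableT (cmod z) fi)) => x /=.
by rewrite cmodM EFinM.
Qed.

End L1.

(** * Plancherel's identity on the intersection of L1 and L2 *)

Section plancherel.
Context {R : realType}.
Local Notation RR := (measurableTypeR R).
Local Notation PP := (RR * RR)%type.
Local Notation mu := (@lebesgue_measure R).
Local Notation mu2 := (mu \x mu)%E.
Implicit Types (f g v : PP -> R[i]).
Local Notation L1c := (L1c mu2).

Lemma L1c_chr f xi : L1c f -> L1c (fun x => f x * chr x xi).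
Proof.
move=> Lf; apply: (le_L1c _ Lf); first by apply: cmfM; [case: Lf|exact: cmf_chrl].
by move=> x; rewrite sqmM sqm_chr mulr1.
Qed.

Lemma bcs_L1c f : bcs f -> L1c f.
Proof.
move=> bf; have mf := bcs_cmf bf; have [_ [M [N [M0 fM]]]] := bf; split => //.
apply: (le_integrable measurableT _ _
  (integrable_scale_indic (1 + M) (measurable_box N) (mu2_box N))).
  exact/measurable_EFinP/measurable_cmod.
move=> x _ /=; rewrite lee_fin ger0_norm ?cmod_ge0 // ger0_norm ?mulr_ge0 ?addr_ge0 //.
rewrite -(@ler_pXn2r _ 2) ?nnegrE ?cmod_ge0 ?mulr_ge0 ?addr_ge0 // cmod_sqr.
apply: le_trans (fM x) _; rewrite indicE.
by case: (_ \in _); rewrite ?mulr1 ?mulr0 ?expr0n //=; nra.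
Qed.

Lemma ftD f g xi : L1c f -> L1c g -> ft (fun x => f x + g x) xi = ft f xi + ft g xi.
Proof.
move=> Lf Lg; rewrite /ft -cintD; [|exact/L1c_cint/L1c_chr..].
by apply: eq_cint => x; rewrite mulrDl.
Qed.

Lemma ftZ (z : R[i]) f xi : L1c f -> ft (fun x => z * f x) xi = z * ft f xi.
Proof.
move=> Lf; rewrite /ft -cintZ; last exact/L1c_cint/L1c_chr.
by apply: eq_cint => x; rewrite mulrA.
Qed.

Lemma ftB f g xi : L1c f -> L1c g -> ft (fun x => f x - g x) xi = ft f xi - ft g xi.
Proof.
move=> Lf Lg; rewrite -[in RHS](mulN1r (ft g xi)) -ftZ // -ftD //; last exact: L1cZ.
by congr (ft _ xi); apply/funext => x; rewrite mulN1r.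
Qed.

(** Norms may be infinite here. This matters in [plancherel], where the transform of [v] is not yet
    known to be square-integrable. *)
Lemma n2_lim_le (fn gn : nat -> PP -> R[i]) f g :
  (forall n, cmf (fn n)) -> (forall n, cmf (gn n)) -> cmf f -> cmf g ->
  (forall n, n2 mu2 (fn n) = n2 mu2 (gn n)) ->
  (fun n => n2 mu2 (fun x => fn n x - f x)) @ \oo --> 0%E ->
  (fun n => n2 mu2 (fun x => gn n x - g x)) @ \oo --> 0%E ->
  (n2 mu2 f <= n2 mu2 g)%E.
Proof.
move=> mfn mgn mf mg E cf cg.
apply: (approx_le (p := fun n => n2 mu2 (fn n)) (e := fun n => n2 mu2 (fun x => fn n x - f x))
  (e' := fun n => n2 mu2 (fun x => gn n x - g x))) => //.
- exact: n2_ge0.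
- by move=> n; exact: n2_ge0.
- move=> t n t0; rewrite [in X in (_ <= _ + X)%E]n2_distC.
  have {1}-> : f = (fun x => fn n x + (f x - fn n x)).
    by apply/funext => x; rewrite addrC subrK.
  by apply: n2D_le => //; exact: cmfB.
- move=> t n t0; rewrite E; have {1}-> : gn n = (fun x => g x + (gn n x - g x)).
    by apply/funext => x; rewrite addrC subrK.
  by apply: n2D_le => //; exact: cmfB.
Qed.

Lemma n2_lim_eq (fn gn : nat -> PP -> R[i]) f g :
  (forall n, cmf (fn n)) -> (forall n, cmf (gn n)) -> cmf f -> cmf g ->
  (forall n, n2 mu2 (fn n) = n2 mu2 (gn n)) ->
  (fun n => n2 mu2 (fun x => fn n x - f x)) @ \oo --> 0%E ->
  (fun n => n2 mu2 (fun x => gn n x - g x)) @ \oo --> 0%E ->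
  n2 mu2 f = n2 mu2 g.
Proof.
move=> mfn mgn mf mg E cf cg; apply/eqP; rewrite eq_le.
by rewrite (n2_lim_le mfn mgn mf mg E cf cg) (n2_lim_le mgn mfn mg mf (fun n => esym (E n)) cg cf).
Qed.

Lemma ft_trunc_cvg v xi : L1c v ->
  (fun n => sqm (ft (trunc n v) xi - ft v xi)) @ \oo --> (0 : R).
Proof.
move=> Lv; have [mv vi] := Lv; have mc := @cmf_chrl R xi.
have mt n := bcs_cmf (bcs_trunc n mv).
apply: (cint_dct (mu := mu2) (fn := fun n x => trunc n v x * chr x xi)
  (f := fun x => v x * chr x xi) (a := fun x => cmod (v x))).
- by move=> n; exact: (cmfM (mt n) mc).
- exact: (cmfM mv mc).
- move=> x; under eq_fun do rewrite -mulrBl sqmM sqm_chr mulr1.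
  exact: trunc_cvg.
- exact: vi.
- by move=> x; exact: cmod_ge0.
- move=> n x; rewrite cmod_sqr sqmM sqm_chr mulr1 /trunc /cut sqmM sqmR indicE.
  by case: (_ \in _); rewrite ?expr1n ?expr0n ?mul1r ?mul0r //= sqm_ge0.
Qed.

(** Fatou's lemma in [m], applied to the transforms of [trunc n v - trunc (n + m) v]. Their norms
    are given by [plancherel_bcs], and since the truncation sets increase, this difference is
    nowhere larger than [trunc n v - v]. *)
Lemma plancherel_trunc v n : L1c v -> L2 mu2 v ->
  (n2 mu2 (fun xi => (ft (trunc n v) xi - ft v xi)%R) <= n2 mu2 (fun x => (trunc n v x - v x)%R))%E.
Proof.
move=> Lv L2v; have [mv _] := Lv.
have bt m := bcs_trunc m mv; have Lt m := bcs_L1c (bt m).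
have mft m : cmf (ft (trunc m v)) := cmf_ft (bcs_cmf (bt m)).
apply: (n2_fatou (fn := fun m xi => ft (trunc n v) xi - ft (trunc (n + m) v) xi)).
- by move=> m; exact: (cmfB (mft n) (mft (n + m)%N)).
- move=> xi; have := ft_trunc_cvg xi Lv; rewrite -(cvg_shiftn n) /=.
  apply: cvg_trans; apply: near_eq_cvg; apply: nearW => m /=.
  by rewrite addnC -sqmN; congr sqm; ring.
move=> m.
have -> : n2 mu2 (fun xi => ft (trunc n v) xi - ft (trunc (n + m) v) xi) =
    n2 mu2 (fun x => trunc n v x - trunc (n + m) v x).
  rewrite -(plancherel_bcs (bcsB (bt n) (bt (n + m)%N))).
  by apply: eq_n2 => xi; rewrite ftB.
apply: le_n2.
- by apply: cmfB; exact: bcs_cmf.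
- by apply: cmfB => //; exact: bcs_cmf.
move=> x; rewrite /trunc.
have [[bx sx]|nx] := pselect ((box n%:R `&` [set x | sqm (v x) <= n%:R]) x).
  have nm : (n%:R : R) <= (n + m)%N%:R by rewrite ler_nat leq_addr.
  have h2 : (box (n + m)%N%:R `&` [set x | sqm (v x) <= (n + m)%N%:R]) x.
    split; last exact: le_trans sx nm.
    by have [a b] := (boxP _ _).1 bx; apply/boxP; split; [exact: le_trans a nm|exact: le_trans b nm].
  by rewrite (cut_in _ h2) cut_in // subrr sqm0 sqm_ge0.
rewrite (cut_out _ nx) !sub0r !sqmN /cut sqmM sqmR indicE.
by case: (_ \in _); rewrite ?expr1n ?expr0n ?mul1r ?mul0r //= sqm_ge0.
Qed.

Lemma plancherel v : L1c v -> L2 mu2 v -> n2 mu2 (ft v) = n2 mu2 v.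
Proof.
move=> Lv L2v; have [mv _] := Lv.
apply: (n2_lim_eq (fn := fun n => ft (trunc n v)) (gn := fun n => trunc n v)).
- by move=> n; exact: cmf_ft (bcs_cmf (bcs_trunc n mv)).
- by move=> n; exact: bcs_cmf (bcs_trunc n mv).
- exact: cmf_ft mv.
- exact: mv.
- by move=> n; exact: plancherel_bcs (bcs_trunc n mv).
- have h := trunc_L2 L2v.
  apply: (squeeze_cvge _ _ h); last exact: cvg_cst.
  by apply: nearW => n; rewrite n2_ge0 plancherel_trunc.
- exact: trunc_L2.
Qed.

End plancherel.

(** * The transform as a relation on L2 *)

Section fourier_L2.
Context {R : realType}.
Local Notation RR := (measurableTypeR R).
Local Notation PP := (RR * RR)%type.
Local Notation mu := (@lebesgue_measure R).
Local Notation mu2 := (mu \x mu)%E.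
Implicit Types (f g : PP -> R[i]).

(** [is_fourier2] with squared norms in place of norms; [is_fourier2P] proves the equivalence. *)
Definition ft2 f g := [/\ L2 mu2 f, L2 mu2 g & exists u : nat -> PP -> R[i],
  [/\ forall n, L1c mu2 (u n) /\ L2 mu2 (u n),
      (fun n => n2 mu2 (fun x => u n x - f x)) @ \oo --> 0%E &
      (fun n => n2 mu2 (fun x => ft (u n) x - g x)) @ \oo --> 0%E]].

Lemma ft2_n2 f g : ft2 f g -> n2 mu2 f = n2 mu2 g.
Proof.
move=> [[mf nf] [mg ng] [u [Lu uf ug]]].
apply: (n2_lim_eq (fn := u) (gn := fun n => ft (u n))).
- by move=> n; have [[]] := Lu n.
- by move=> n; have [[mu' _] _] := Lu n; exact: cmf_ft.
- exact: mf.
- exact: mg.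
- by move=> n; have [L1u L2u] := Lu n; rewrite plancherel.
- exact: uf.
- exact: ug.
Qed.

Lemma n2_cvg0_lin (u v : nat -> PP -> R[i]) f g (z : R[i]) :
  (forall n, cmf (u n)) -> (forall n, cmf (v n)) -> cmf f -> cmf g ->
  (fun n => n2 mu2 (fun x => u n x - f x)) @ \oo --> 0%E ->
  (fun n => n2 mu2 (fun x => v n x - g x)) @ \oo --> 0%E ->
  (fun n => n2 mu2 (fun x => (u n x + z * v n x) - (f x + z * g x))) @ \oo --> 0%E.
Proof.
move=> mu' mv mf mg cu cv.
have H : (fun n => 2%:E * n2 mu2 (fun x => (u n x - f x)%R) +
    2%:E * ((sqm z)%:E * n2 mu2 (fun x => (v n x - g x)%R)))%E @ \oo --> 0%E.
  rewrite -[X in _ --> X]adde0; apply: cvgeD => //.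
    by rewrite -[X in _ --> X](mule0 2%:E); exact: cvgeZl.
  rewrite -[X in _ --> X](mule0 2%:E); apply: cvgeZl => //.
  by rewrite -[X in _ --> X](mule0 (sqm z)%:E); exact: cvgeZl.
apply: (squeeze_cvge _ _ H); last exact: cvg_cst.
apply: nearW => n; rewrite n2_ge0 /=.
have m1 := cmfB (mu' n) mf; have m2 := cmfB (mv n) mg.
rewrite -(n2Z _ z m2); apply: le_trans (n2D_le2 _ m1 (cmfM (cmf_cst _ z) m2)).
rewrite le_eqVlt; apply/orP; left; apply/eqP; apply: eq_n2 => x; congr sqm; ring.
Qed.

Lemma ft2_lin f1 g1 f2 g2 (z : R[i]) : ft2 f1 g1 -> ft2 f2 g2 ->
  ft2 (fun x => f1 x + z * f2 x) (fun x => g1 x + z * g2 x).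
Proof.
move=> [Lf1 Lg1 [u1 [Lu1 uf1 ug1]]] [Lf2 Lg2 [u2 [Lu2 uf2 ug2]]].
split; [exact: (L2D Lf1 (L2Z z Lf2))|exact: (L2D Lg1 (L2Z z Lg2))|].
have mu1 n : cmf (u1 n) by have [[]] := Lu1 n.
have mu2' n : cmf (u2 n) by have [[]] := Lu2 n.
exists (fun n x => u1 n x + z * u2 n x); split.
- move=> n; have [a b] := Lu1 n; have [c e] := Lu2 n; split.
    exact: (L1cD a (L1cZ z c)).
  exact: (L2D b (L2Z z e)).
- exact: (n2_cvg0_lin z mu1 mu2' (L2_cmf Lf1) (L2_cmf Lf2) uf1 uf2).
have := n2_cvg0_lin z (fun n => cmf_ft (mu1 n)) (fun n => cmf_ft (mu2' n)) (L2_cmf Lg1) (L2_cmf Lg2) ug1 ug2.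
apply: cvg_trans; apply: near_eq_cvg; apply: nearW => n; apply: eq_n2 => x.
have [a b] := Lu1 n; have [c e] := Lu2 n.
by rewrite ftD ?ftZ //; exact: L1cZ.
Qed.

(* Polarization. *)
Lemma ft2_inn f1 g1 f2 g2 : ft2 f1 g1 -> ft2 f2 g2 -> inn mu2 f1 f2 = inn mu2 g1 g2.
Proof.
move=> h1 h2; have [Lf1 Lg1 _] := h1; have [Lf2 Lg2 _] := h2.
have key (z : R[i]) : complex.Re (z^*%C * inn mu2 f1 f2) = complex.Re (z^*%C * inn mu2 g1 g2).
  have := congr1 fine (ft2_n2 (ft2_lin z h1 h2)).
  rewrite (n2D Lf1 (L2Z z Lf2)) (n2D Lg1 (L2Z z Lg2)) (fine_n2Z z Lf2) (fine_n2Z z Lg2) (innZr z Lf1 Lf2) (innZr z Lg1 Lg2).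
  by rewrite (ft2_n2 h1) (ft2_n2 h2) => /addrI/mulfI; apply; rewrite pnatr_eq0.
apply: complexP; first by have := key 1; rewrite conjc1 !mul1r.
(* The real part after multiplication by the conjugate of the imaginary unit is the imaginary
   part. *)
have := key (0 +i* 1).
by case: (inn mu2 f1 f2) (inn mu2 g1 g2) => [a b] [c e] /=; rewrite !mul0r !sub0r !mulN1r !opprK.
Qed.

Lemma n2_subrr f : n2 mu2 (fun x => f x - f x) = 0%E.
Proof. by rewrite /n2; under eq_integral do rewrite subrr sqm0; rewrite integral0. Qed.

Lemma ft2_bcs f : bcs f -> ft2 f (ft f).
Proof.
move=> bf; have Lf := bcs_L2 bf.
have Lft : L2 mu2 (ft f).
  by split; [exact: cmf_ft (bcs_cmf bf)|rewrite plancherel_bcs //; case: Lf].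
split => //; exists (fun=> f); split.
- by move=> n; split => //; exact: bcs_L1c.
- by under eq_fun do rewrite n2_subrr; exact: cvg_cst.
- by under eq_fun do rewrite n2_subrr; exact: cvg_cst.
Qed.

Lemma ft_bounded f : bcs f -> exists M, forall xi, sqm (ft f xi) <= M.
Proof.
move=> bf; have [mf [M [N [M0 fM]]]] := bf.
exists (2 * (\int[mu2]_x ((1 + M) * \1_(box N) x)) ^+ 2) => xi.
apply: sqm_cint_le.
- by apply: cmfM => //; exact: cmf_chrl.
- exact: (integrable_scale_indic (1 + M) (measurable_box N) (mu2_box N)).
- by move=> x; rewrite mulr_ge0 ?addr_ge0.
- move=> x; rewrite sqmM sqm_chr mulr1; apply: le_trans (fM x) _; rewrite indicE.
  by case: (_ \in _); rewrite ?mulr1 ?mulr0 ?expr0n //=; nra.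
Qed.

(** The multiplication formula: Fubini and the symmetry of the character. The kernel is bounded with
    bounded support on the product of the two planes, hence integrable. *)
Lemma fubini_chr f g : bcs f -> bcs g ->
  cint mu2 (fun xi => ft f xi * g xi) = cint mu2 (fun x => f x * ft g x).
Proof.
move=> bf bg; have mf := bcs_cmf bf; have mg := bcs_cmf bg.
pose m : {sigma_finite_measure set PP -> \bar R} := @leb2s R.
pose K (z : PP * PP) : R[i] := g z.1 * (f z.2 * chr z.2 z.1).
have mK : cmf K.
  by apply: cmfM; [exact: (cmf_comp mg (@measurable_fst _ _ PP PP))|exact: cmf_ft_kernel].
have iK : cintegrable (m \x m)%E K.
  have [_ [M [N [M0 fM]]]] := bf; have [_ [M' [N' [M'0 gM]]]] := bg.
  apply: (@cintegrable_bounded _ _ _ _ (box N' `*` box N) K (M' * M)) => //.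
  - by apply: measurableX; exact: measurable_box.
  - have h12 : (m \x m)%E (box N' `*` box N) = (m (box N') * m (box N))%E.
      by apply: product_measure1E; exact: measurable_box.
    rewrite [X in (X < _)%E](_ : _ = (m (box N') * m (box N))%E); last exact: h12.
    have h n : (m (box n) < +oo)%E by exact: mu2_box.
    have h' n : m (box n) \is a fin_num by rewrite ge0_fin_numE.
    by rewrite -(fineK (h' N)) -(fineK (h' N')) -EFinM ltry.
  - move=> z; rewrite /K !sqmM sqm_chr mulr1.
    apply: le_trans (ler_pM _ _ (gM z.1) (fM z.2)) _; rewrite ?sqm_ge0 // !indicE.
    have -> : (z \in box N' `*` box N) = (z.1 \in box N') && (z.2 \in box N) by exact: in_setX.
    by case: (z.1 \in box N'); case: (z.2 \in box N); rewrite /= ?mulr0 ?mulr1 ?mul0r ?mulr0.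
transitivity (cint (m \x m)%E K).
  rewrite (@cfubini1 _ _ PP PP R m m K iK).
    apply: eq_cint => xi; rewrite mulrC -cintZ //.
    by apply: L1c_cint; apply: L1c_chr; exact: bcs_L1c.
  move=> xi; have h : cintegrable mu2 (fun x => g xi * (f x * chr x xi)).
    by apply: cintegrableZ; apply: L1c_cint; apply: L1c_chr; exact: bcs_L1c.
  exact: h.
rewrite (@cfubini2 _ _ PP PP R m m K iK).
  apply: eq_cint => x; rewrite -cintZ.
    by apply: eq_cint => xi; rewrite /K /= [chr x xi]chrC; ring.
  by apply: L1c_cint; apply: L1c_chr; exact: bcs_L1c.
move=> x; have h : cintegrable mu2 (fun xi => f x * (g xi * chr xi x)).
  by apply: cintegrableZ; apply: L1c_cint; apply: L1c_chr; exact: bcs_L1c.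
suff E : (fun xi => K (xi, x)) = (fun xi => f x * (g xi * chr xi x)) by rewrite E; exact: h.
by apply/funext => xi; rewrite /K /= chrC; ring.
Qed.

(** The candidate is the inverse transform, written with two conjugations. No inversion theorem is
    used: expanding the squares, [E] shows that [ft (trunc n f)] is as far from [g] as [trunc n f]
    is from [f], since Plancherel matches the norms and [fubini_chr] the inner products. *)
Lemma ft2_exists g : bcs g -> exists f, ft2 f g.
Proof.
move=> bg; have bJ := bcsJ bg; have mg := bcs_cmf bg.
pose f : PP -> R[i] := fun x => (ft (fun y => (g y)^*%C) x)^*%C.
have [M fM0] := ft_bounded bJ.
have fM x : sqm (f x) <= M by rewrite /f sqm_conj.
have mf : cmf f by apply: cmfJ; apply: cmf_ft; exact: cmfJ.
have nf : n2 mu2 f = n2 mu2 g by rewrite n2J plancherel_bcs // n2J.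
have Lg := bcs_L2 bg.
have Lf : L2 mu2 f by split => //; rewrite nf; case: Lg.
have bt n := bcs_trunc n mf.
have E n : n2 mu2 (fun x => ft (trunc n f) x - g x) = n2 mu2 (fun x => trunc n f x - f x).
  have [Lt Lft _] := ft2_bcs (bt n).
  rewrite (n2_EFin (L2B Lft Lg)) (n2_EFin (L2B Lt Lf)); congr EFin.
  rewrite (n2B Lft Lg) (n2B Lt Lf) nf plancherel_bcs //; congr (_ - _ * complex.Re _).
  rewrite /inn fubini_chr //; apply: eq_cint => x; congr (_ * _).
  by rewrite /f conjcK.
exists f; split => //; exists (fun n => trunc n f); split.
- by move=> n; split; [exact: bcs_L1c|exact: bcs_L2].
- exact: trunc_L2.
- by under eq_fun do rewrite E; exact: trunc_L2.
Qed.

End fourier_L2.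

(** * The given definitions in terms of squared norms, and the sum over one lattice of translates *)

Section bridge.
Context {R : realType}.
Local Notation RR := (measurableTypeR R).
Local Notation PP := (RR * RR)%type.
Local Notation mu := (@lebesgue_measure R).
Local Notation mu2 := (mu \x mu)%E.
Implicit Types (f g : PP -> R[i]).

Lemma cLnorm2_sqr f : (cLnorm 2%:E f ^+ 2)%E = n2 mu2 f.
Proof.
have c0 : (0 <= cLnorm 2%:E f)%E by exact: Lnorm_ge0.
have sq (x : \bar R) : (0 <= x)%E -> (x ^+ 2 = x `^ 2)%E.
  case: x => [r||] //=; last by rewrite mulyy pnatr_eq0.
  by rewrite lee_fin => r0; rewrite -EFinM -expr2 -powR_mulrn.
rewrite sq //.
rewrite /cLnorm poweR_Lnorm ?pnatr_eq0 //; apply: eq_integral => x _.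
rewrite /= -cmod_sqr -powR_mulrn ?cmod_ge0 //.
by rewrite ger0_norm ?cmod_ge0.
Qed.

Lemma cLnorm2_ge0 f : (0 <= cLnorm 2%:E f)%E.
Proof. exact: Lnorm_ge0. Qed.

Lemma inLp2P f : inLp 2%:E f <-> L2 mu2 f.
Proof.
have c0 := cLnorm2_ge0 f; have e := cLnorm2_sqr f.
split=> -[mf h]; split; first exact: mf.
- rewrite -e; have hf : cLnorm 2%:E f \is a fin_num by rewrite ge0_fin_numE.
  by rewrite -(fineK hf) -EFin_expe ltry.
- exact: mf.
rewrite ltNge leye_eq; apply/negP => /eqP h'; move: h; rewrite -e h'.
by rewrite expe2 mulyy ltxx.
Qed.

Lemma inLp1P f : inLp 1%:E f <-> L1c mu2 f.
Proof.
rewrite /inLp /cLnorm Lnorm1; split=> -[mf h]; split => //.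
  by apply/integrableP; split => //; exact/measurable_EFinP/measurable_cmod.
by case/integrableP : h.
Qed.

Lemma cLnorm2E f : L2 mu2 f -> cLnorm 2%:E f = (Num.sqrt (fine (n2 mu2 f)))%:E.
Proof.
move=> Lf; have c0 := cLnorm2_ge0 f; have [_ h] := (inLp2P f).2 Lf.
have hf : cLnorm 2%:E f \is a fin_num by rewrite ge0_fin_numE.
rewrite -cLnorm2_sqr -(fineK hf) -EFin_expe /= sqrtr_sqr ger0_norm // fine_ge0 //.
Qed.

Lemma is_fourier2P f g : is_fourier2 f g <-> ft2 f g.
Proof.
split=> [[Lf Lg [u [Lu uf ug]]]|[Lf Lg [u [Lu uf ug]]]].
  have sq (h : nat -> PP -> R[i]) : (fun n => cLnorm 2%:E (h n)) @ \oo --> 0%E ->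
      (fun n => n2 mu2 (h n)) @ \oo --> 0%E.
    move=> ch; suff : (fun n => cLnorm 2%:E (h n) * cLnorm 2%:E (h n))%E @ \oo --> (0 * 0 : \bar R)%E.
      by rewrite mule0; under eq_fun do rewrite -expe2 cLnorm2_sqr.
    by apply: cvgeM.
  split; [exact/inLp2P|exact/inLp2P|exists u; split].
  - by move=> n; have [a b] := Lu n; split; [exact/inLp1P|exact/inLp2P].
  - exact: (sq (fun n x => u n x - f x)).
  - exact: (sq (fun n x => ft (u n) x - g x)).
have sq (h : nat -> PP -> R[i]) : (forall n, L2 mu2 (h n)) ->
    (fun n => n2 mu2 (h n)) @ \oo --> 0%E -> (fun n => cLnorm 2%:E (h n)) @ \oo --> 0%E.
  move=> Lh ch; under eq_fun do rewrite (cLnorm2E (Lh _)).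
  apply: cvg_EFin; first exact: nearW.
  rewrite -(@sqrtr0 R); apply: (cvg_comp (fun n => fine (n2 mu2 (h n))) (@Num.sqrt R) _ (@sqrt_continuous R 0)).
  exact: (fine_cvg ch).
split; [exact/inLp2P|exact/inLp2P|exists u; split].
- by move=> n; have [a b] := Lu n; split; [exact/inLp1P|exact/inLp2P].
- by apply: (sq (fun n x => u n x - f x)) => // n; apply: L2B => //; case: (Lu n).
- apply: (sq (fun n x => ft (u n) x - g x) _ ug) => n; apply: (L2B _ Lg).
  have [a b] := Lu n; split; first by apply: cmf_ft; case: a.
  by rewrite plancherel //; case: b.
Qed.

(** [xget] picks some inverse transform; [ft2_exists] rules out its default value. *)
Lemma inv_fourier2P g : bcs g -> ft2 (inv_fourier2 g) g.
Proof.
move=> /ft2_exists[f fg]; apply/is_fourier2P; rewrite /inv_fourier2.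
by case: xgetP => [h _ //|/(_ f)]; case; exact/is_fourier2P.
Qed.

Lemma ft_translate f (x xi : R * R) : bcs f ->
  ft (fun y : R * R => f (y + x)) xi = (chr x xi)^*%C * ft f xi.
Proof.
move=> bf; have st := @scales_translate R x.
have L : cintegrable mu2 (fun y => f y * chr y xi).
  by apply: L1c_cint; apply: L1c_chr; exact: bcs_L1c.
rewrite /ft -[in RHS](mul1r (cint _ _)) -[in RHS](scales_cint st L) -cintZ.
  apply: eq_cint => y; rewrite mulrCA; congr (_ * _).
  by rewrite /chr -expiN -expiD; congr expi; rewrite /dot /=; ring.
have [i1 i2] := L; split; first by case: (scales_Rintegral st i1).
by case: (scales_Rintegral st i2).
Qed.

Lemma bcs_translate f (x : R * R) : bcs f -> bcs (fun y : R * R => f (y + x)).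
Proof.
move=> bf; have [M [N [M0 N0 fM f0]]] := bcs_bound bf.
have [mh _ _] := @scales_translate R x.
apply: (@bcsP _ _ M (N + `|x.1| + `|x.2|)).
- exact: (cmf_comp (bcs_cmf bf) mh).
- by move=> y.
move=> y ny; rewrite f0 // => /boxP[/= a b]; apply: ny; apply/boxP; split.
  have := ler_normB (y.1 + x.1) x.1; rewrite addrK; have := normr_ge0 x.2; lra.
have := ler_normB (y.2 + x.2) x.2; rewrite addrK; have := normr_ge0 x.1; lra.
Qed.

Lemma L2_translate f (x : R * R) : L2 mu2 f -> L2 mu2 (fun y : R * R => f (y - x)).
Proof.
move=> [mf nf]; have st := @scales_translate R (- x.1, - x.2); have [mh _ _] := st.
split; first exact: (cmf_comp mf mh).
by have := scales_n2 st mf; rewrite mul1e => e; move: nf; rewrite -e.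
Qed.

(** Moves the translation from a curvelet, known only through its L2 transform, to the test
    function, whose transform is an integral. *)
Lemma inn_translate f g (x : R * R) : L2 mu2 f -> L2 mu2 g ->
  inn mu2 f (fun y : R * R => g (y - x)) = inn mu2 (fun y : R * R => f (y + x)) g.
Proof.
move=> Lf Lg; have st := @scales_translate R x.
have L := L2_cintegrable Lf (L2_translate x Lg).
rewrite /inn -[LHS]mul1r -(scales_cint st L); apply: eq_cint => y.
congr (_ * (g _)^*%C); rewrite /=; case: y => y1 y2; case: (x) => x1 x2.
by congr pair; rewrite /= addrK.
Qed.

(** Serves both the coarse functions, with [h] the identity, and the pieces of a given scale and
    direction. The condition [w ^+ 2 = c] makes the weight cancel the constant of
    [lattice_parseval]. *)
Lemma frame_piece (h : PP -> PP) (c w : R) (x : int * int -> R * R) (chi : PP -> R) psi f :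
  scales mu2 h c -> 0 < c -> w ^+ 2 = c -> bcs (fun xi => (chi xi)%:C) ->
  ft2 psi (fun xi => (chi xi)%:C) ->
  (forall y : R * R, 3 / 8 < `|y.1| -> chi (h y) = 0) ->
  (forall y : R * R, 3 / 8 < `|y.2| -> chi (h y) = 0) ->
  (forall k y, chr (x k) (h y) = chr (int2 k) y) -> bcs f ->
  (\esum_(k in [set: int * int])
     (sqm (inn mu2 f (fun y : R * R => (w%:C * psi (y - x k))%R)))%:E =
   n2 mu2 (fun xi => (ft f xi * (chi xi)%:C)%R))%E.
Proof.
move=> sh c0 wc bchi fpsi c1 c2 hx bf.
have [M ftM] := ft_bounded bf; have mft := cmf_ft (bcs_cmf bf).
have b1 : bcs (fun xi => (chi xi)%:C * ft f xi) by apply: bcsM => //; exists M.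
(* Translating the test function yields conjugated characters; conjugating the whole integrand
   restores [chr] and leaves the modulus unchanged. *)
pose F xi := w%:C * ((chi xi)%:C * ft f xi)^*%C.
have bF : bcs F.
  rewrite /F (_ : (fun xi => _) = (fun xi => ((chi xi)%:C * ft f xi)^*%C * w%:C)).
    by apply: bcsM; [exact: bcsJ|exact: cmf_cst|exists (sqm w%:C)].
  by apply/funext => xi; rewrite mulrC.
have Lpsi : L2 mu2 psi by case: fpsi.
have -> : (n2 mu2 (fun xi => (ft f xi * (chi xi)%:C)%R) = (c^-1)%:E * n2 mu2 F)%E.
  rewrite n2Z; last by apply: cmfJ; exact: bcs_cmf.
  rewrite n2J sqmR wc muleA -EFinM mulVf ?gt_eqF // mul1e.
  by apply: eq_n2 => xi; rewrite mulrC.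
have F1 (y : R * R) : 3 / 8 < `|y.1| -> F (h y) = 0.
  by move=> hy; rewrite /F c1 // mul0r conjc0 mulr0.
have F2 (y : R * R) : 3 / 8 < `|y.2| -> F (h y) = 0.
  by move=> hy; rewrite /F c2 // mul0r conjc0 mulr0.
rewrite -(@lattice_parseval R h c (fun k xi => chr (x k) xi) F sh c0 bF
  (fun k => cmf_chrr (x k)) (fun k => sqm_chr (x k)) F1 F2 hx).
apply: eq_esum => k _; congr (EFin _).
have Lf := bcs_L2 bf.
rewrite innZr //; last exact: L2_translate.
rewrite inn_translate // (ft2_inn (ft2_bcs (bcs_translate (x k) bf)) fpsi).
rewrite sqmM sqm_conj /inn.
have bFE : bcs (fun xi => ((chi xi)%:C * ft f xi)^*%C * chr (x k) xi).
  by apply: bcsM; [exact: bcsJ|exact: cmf_chrr|exists 1 => xi; rewrite sqm_chr].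
have -> : cint mu2 (fun xi => F xi * chr (x k) xi) =
    w%:C * cint mu2 (fun xi => ((chi xi)%:C * ft f xi)^*%C * chr (x k) xi).
  rewrite -cintZ; last exact: bcs_cint.
  by apply: eq_cint => xi; rewrite /F mulrA.
rewrite sqmM -[X in _ = _ * X]sqm_conj -cintJ; last exact: bcs_cint.
congr (_ * sqm _); apply: eq_cint => xi.
rewrite ft_translate // !conjcM conjcK.
by apply: complexP; rewrite ?ReM ?ImM ?ReJ ?ImJ /=; ring.
Qed.

End bridge.

(** * Curvelet multipliers *)

Section geometry.
Context {R : realType}.
Local Notation RR := (measurableTypeR R).
Local Notation PP := (RR * RR)%type.
Implicit Types (x u : R * R).

Lemma dot_ge0 x : 0 <= dot x x.
Proof. by rewrite /dot addr_ge0 // -expr2 sqr_ge0. Qed.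

Lemma enorm_ge0 x : 0 <= enorm x.
Proof. exact: sqrtr_ge0. Qed.

Lemma enorm_sqr x : enorm x ^+ 2 = dot x x.
Proof. by rewrite sqr_sqrtr // dot_ge0. Qed.

Lemma dot_rotv t x y : dot (rotv t x) (rotv t y) = dot x y.
Proof.
have := cos2Dsin2 t; rewrite /dot /rotv /= => h.
transitivity ((cos t ^+ 2 + sin t ^+ 2) * (x.1 * y.1 + x.2 * y.2)); first by ring.
by rewrite h mul1r.
Qed.

(** At the origin the division by zero yields the direction 0. *)
Lemma dot_dir x : dot (dir x) (dir x) = (x != 0)%:R.
Proof.
rewrite /dir /dot /=; have [->|x0] := eqVneq x 0.
  by rewrite /= !mul0r addr0.
have e0 : enorm x != 0.
  apply: contra x0 => /eqP h; have := enorm_sqr x; rewrite h expr0n /= /dot => /esym/eqP.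
  by rewrite -!expr2 paddr_eq0 ?sqr_ge0 // !sqrf_eq0 => /andP[/eqP a /eqP b]; apply/eqP; case: x a b h => ? ? /= -> ->.
transitivity (dot x x / enorm x ^+ 2); first by rewrite /dot; field.
by rewrite enorm_sqr divff // -enorm_sqr sqrf_eq0.
Qed.

Lemma fst_le1 u : dot u u <= 1 -> `|u.1| <= 1.
Proof.
move=> h; rewrite -(@ler_pXn2r _ 2) ?nnegrE // real_normK ?num_real // expr1n.
by apply: le_trans h; rewrite /dot -!expr2 lerDl sqr_ge0.
Qed.

Lemma dot_dir_le1 x : dot (dir x) (dir x) <= 1.
Proof. by rewrite dot_dir; case: (_ != _); rewrite ?ler01. Qed.

Lemma angleP u : dot u u = 1 -> [/\ u = (cos (angle u), sin (angle u)),
  - pi <= angle u & angle u <= pi].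
Proof.
move=> u1; have : `|u.1| <= 1 by apply: fst_le1; rewrite u1.
rewrite ler_norml => hu.
have ci : u.1 \in `[(-1), 1] by rewrite in_itv.
have s2 : u.2 ^+ 2 = 1 - u.1 ^+ 2 by rewrite -u1 /dot; ring.
have pi0 := pi_gt0 R; have a0 := acos_ge0 hu; have a1 := acos_lepi hu.
case: u u1 hu ci s2 a0 a1 => [a b] /= u1 hu ci s2 a0 a1; rewrite /angle /=.
case: ifPn => b0.
  by split; [rewrite acosK // sin_acos // -s2 sqrtr_sqr ger0_norm|lra|].
split; [|lra|lra].
by rewrite cosN sinN acosK // sin_acos // -s2 sqrtr_sqr ltr0_norm ?opprK // ltNge.
Qed.

(** The projection onto [-1, 1]: [acos] after it is nonincreasing on the whole line, hence
    measurable. *)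
Definition clamp (c : R) : R := Num.max (- 1) (Num.min 1 c).

Lemma measurable_acos_clamp : measurable_fun setT (fun c : R => acos (clamp c)).
Proof.
apply: nonincreasing_measurable => // x y xy.
have h (c : R) : -1 <= clamp c <= 1.
  by rewrite /clamp le_max lexx ge_max ge_min lexx /= andbT; lra.
have hxy : clamp x <= clamp y by rewrite /clamp le_max2 // le_min2.
have pi0 := pi_gt0 R.
rewrite leNgt; apply/negP => lt.
have : cos (acos (clamp y)) < cos (acos (clamp x)).
  by rewrite ltr_cos // in_itv /= ?acos_ge0 ?acos_lepi.
by rewrite !acosK ?in_itv //= ltNge hxy.
Qed.

Lemma clampE (c : R) : `|c| <= 1 -> clamp c = c.
Proof.
by rewrite ler_norml => /andP[a b]; rewrite /clamp min_r // max_r.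
Qed.

Lemma measurable_angle (a b : PP -> R) : @measurable_fun _ _ PP R setT a ->
  @measurable_fun _ _ PP R setT b -> (forall x, `|a x| <= 1) ->
  @measurable_fun _ _ PP R setT (fun x => angle (a x, b x)).
Proof.
move=> ma mb a1.
rewrite (_ : (fun x => _) = (fun x => if 0 <= b x then acos (clamp (a x)) else - acos (clamp (a x)))).
  have mac := measurableT_comp measurable_acos_clamp ma.
  by apply: measurable_fun_ifT; [exact: measurable_fun_ler|exact: mac|exact: measurable_funN].
by apply/funext => x; rewrite /angle /= clampE.
Qed.

Lemma measurable_enorm : @measurable_fun _ _ PP R setT (fun x : PP => enorm (x : R * R)).
Proof.
apply: (measurableT_comp (f := @Num.sqrt R)).
  by apply: continuous_measurable_fun; exact: sqrt_continuous.
have m1 := @measurable_fstR R; have m2 := @measurable_sndR R.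
by apply: measurable_funD; exact: measurable_funM.
Qed.

Lemma measurable_dir1 : @measurable_fun _ _ PP R setT (fun x : PP => (dir (x : R * R)).1).
Proof.
have m1 := @measurable_fstR R.
apply: measurable_funM => //; apply: measurable_funV_ge0; last exact: measurable_enorm.
by move=> x; exact: enorm_ge0.
Qed.

Lemma measurable_dir2 : @measurable_fun _ _ PP R setT (fun x : PP => (dir (x : R * R)).2).
Proof.
have m1 := @measurable_sndR R.
apply: measurable_funM => //; apply: measurable_funV_ge0; last exact: measurable_enorm.
by move=> x; exact: enorm_ge0.
Qed.

Lemma smooth_continuous (g : R -> R) : smooth g -> continuous g.
Proof.
move=> sg x; apply: differentiable_continuous; apply/derivable1_diffP; exact: (sg 0%N x).
Qed.

Lemma smooth_measurable (g : R -> R) : smooth g -> measurable_fun setT g.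
Proof. by move=> sg; apply: continuous_measurable_fun; exact: smooth_continuous. Qed.

Lemma smooth_Rplus_measurable (f : R -> R) (a : PP -> R) : smooth_Rplus f ->
  @measurable_fun _ _ PP R setT a -> (forall x, 0 <= a x) ->
  @measurable_fun _ _ PP R setT (fun x => f (a x)).
Proof.
move=> [g [sg gf]] ma a0; rewrite (_ : (fun x => _) = g \o a).
  exact: (measurableT_comp (smooth_measurable sg) ma).
by apply/funext => x /=; rewrite gf.
Qed.

End geometry.

Section windows.
Context {R : realType}.
Local Notation RR := (measurableTypeR R).
Local Notation PP := (RR * RR)%type.
Context (alpha : R) (W0 W V : R -> R).
Context (hgen : curvelet_generators W0 W V).
Implicit Types (x u : R * R).

Lemma sin_le_id (t : R) : 0 <= t -> sin t <= t.
Proof.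
move=> t0; have [->|tn0] := eqVneq t 0; first by rewrite sin0.
have tp : 0 < t by rewrite lt_def tn0.
have [//|c _] := @MVT R sin cos 0 t tp.
  by apply: continuous_subspaceT => z; exact: continuous_sin.
by rewrite sin0 !subr0 => ->; rewrite ler_piMl ?cos_le1.
Qed.

(** This is |sin t| <= |t|; it turns the angular support of [V] into a bound on the second
    coordinate. *)
Lemma snd_le_angle u : dot u u = 1 -> `|u.2| <= `|angle u|.
Proof.
move=> u1; have [-> _ _] := angleP u1; have [/= a0 a1 a2] := angleP u1.
rewrite [X in _ <= X](_ : _ = `|angle u|); last by rewrite -a0.
have h (t : R) : 0 <= t -> `|sin t| <= t.
  move=> t0; rewrite ler_norml sin_le_id // andbT.
  have [t1|t1] := leP t 1; last by have := sin_geN1 t; lra.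
  by apply: (@le_trans _ _ 0); [lra|apply: sin_ge0_pi; have := pi_ge2 R; lra].
have [t0|t0] := leP 0 (angle u); first by rewrite (ger0_norm t0) h.
by rewrite (ltr0_norm t0) -normrN -sinN h // oppr_ge0 ltW.
Qed.

Lemma W0_supp_le (r : R) : 0 <= r -> W0 r != 0 -> r <= 2.
Proof.
move=> r0 h; have : [set` `[0 : R, 2]] r by apply: (W0_supp hgen); apply: subset_closure.
by rewrite /= in_itv /= => /andP[].
Qed.

Lemma W_supp_itv (r : R) : 0 <= r -> W r != 0 -> 1 / 2 <= r <= 2.
Proof.
move=> r0 h; have : [set` `[1 / 2 : R, 2]] r by apply: (W_supp hgen); apply: subset_closure.
by rewrite /= in_itv.
Qed.

Lemma V_supp_itv (t : R) : V t != 0 -> `|t| <= 3 / 4 * pi.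
Proof.
move=> h; have : [set` `[- (3 / 4 * pi) : R, 3 / 4 * pi]] t by apply: (V_supp hgen); apply: subset_closure.
by rewrite /= in_itv /= ler_norml.
Qed.

Lemma pi8_ge0 (r : R) : 0 <= r -> 0 <= 8 * pi * r.
Proof. by move=> r0; rewrite !mulr_ge0 // ?pi_ge0. Qed.

Lemma Wrad_itv j (r : R) : 0 <= r -> 0 <= Wrad W0 W j r <= 1.
Proof.
move=> /pi8_ge0 r0; rewrite /Wrad; case: j => [|j]; first exact: W0_range hgen _ r0.
by apply: W_range hgen _ _; rewrite mulr_ge0 // invr_ge0 exprn_ge0.
Qed.

(** Both radial windows end at 2, so [8 * pi * r <= 2 * 2 ^+ j]. *)
Lemma Wrad_supp j (r : R) : 0 <= r -> Wrad W0 W j r != 0 -> 4 * pi * r <= 2 ^+ j.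
Proof.
move=> /pi8_ge0 r0; rewrite /Wrad; case: j => [|j] /=.
  by move=> /(W0_supp_le r0); rewrite expr0; lra.
have p : 0 < (2 : R) ^+ j.+1 by rewrite exprn_gt0.
have r1 : 0 <= 2 ^- j.+1 * (8 * pi * r) by rewrite mulr_ge0 // invr_ge0 ltW.
by move=> /(W_supp_itv r1)/andP[_]; rewrite mulrC ler_pdivrMr //; lra.
Qed.

Lemma Wrad_supp_ge j (r : R) : 0 <= r -> Wrad W0 W j.+1 r != 0 -> 2 ^+ j <= 8 * pi * r.
Proof.
move=> /pi8_ge0 r0; rewrite /Wrad /=.
have p : 0 < (2 : R) ^+ j.+1 by rewrite exprn_gt0.
have r1 : 0 <= 2 ^- j.+1 * (8 * pi * r) by rewrite mulr_ge0 // invr_ge0 ltW.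
by move=> /(W_supp_itv r1)/andP[+ _]; rewrite [X in _ <= X]mulrC ler_pdivlMr // exprS; lra.
Qed.

(** The bound is 2 rather than 1 because the windows at [u] and [- u] can overlap: at angular level
    0 both equal 1 for a direction at angle pi/2. *)
Lemma Vang_itv j l u : 0 <= Vang alpha V j l u <= 2.
Proof.
rewrite /Vang /Vang0 /Vt; set a := V _; set b := V _.
have /andP[? ?] : 0 <= a <= 1 by exact: V_range hgen _.
have /andP[? ?] : 0 <= b <= 1 by exact: V_range hgen _.
by apply/andP; split; lra.
Qed.

Lemma Vt_supp j u : dot u u = 1 -> Vt alpha V j u != 0 ->
  `|u.2| <= 3 / 4 * pi * 2 ^- ang_level alpha j.
Proof.
move=> u1 /V_supp_itv; rewrite normrM => h; apply: le_trans (snd_le_angle u1) _.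
rewrite ler_pdivlMr ?exprn_gt0 // mulrC; apply: le_trans h.
by rewrite ger0_norm ?exprn_ge0.
Qed.

Lemma Vang0_supp j u : dot u u = 1 -> Vang0 alpha V j u != 0 ->
  `|u.2| <= 3 / 4 * pi * 2 ^- ang_level alpha j.
Proof.
move=> u1 h; have [a|a] := eqVneq (Vt alpha V j u) 0; last exact: Vt_supp a.
rewrite -normrN; apply: (@Vt_supp j (- u)).
  by rewrite -u1 /dot /=; ring.
by move: h; rewrite /Vang0 a add0r.
Qed.

Lemma Vang0N j u : Vang0 alpha V j (- u) = Vang0 alpha V j u.
Proof. by rewrite /Vang0 opprK addrC. Qed.

Lemma Vang0_ge1 j (s : R) : `|s| <= pi / 2 * 2 ^- ang_level alpha j ->
  1 <= Vang0 alpha V j (cos s, sin s).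
Proof.
move=> hs; have pi0 := pi_gt0 R; have p : 0 < (2 : R) ^+ ang_level alpha j by rewrite exprn_gt0.
have p1 : 1 <= (2 : R) ^+ ang_level alpha j by rewrite exprn_ege1 // ler1n.
have hs1 : `|s| * 2 ^+ ang_level alpha j <= pi / 2 by rewrite -ler_pdivlMr.
have hs2 : `|s| <= pi / 2 by apply: le_trans hs1; rewrite ler_peMr.
have h : Vt alpha V j (cos s, sin s) = 1.
  rewrite /Vt angleK; last by move: hs2; rewrite ler_norml => /andP[? ?]; apply/andP; split; lra.
  by apply: (V_one hgen); rewrite -ler_norml normrM mulrC (ger0_norm (ltW p)).
by rewrite /Vang0 h lerDl; case/andP: (V_range hgen (2 ^+ ang_level alpha j * angle (- (cos s, sin s)))).
Qed.

Lemma rotv_angle (t s : R) : rotv t (cos s, sin s) = (cos (s + t), sin (s + t)).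
Proof. by rewrite /rotv /= cosD sinD; congr pair; ring. Qed.

Lemma rotvN t u : rotv t (- u) = - rotv t u.
Proof. by congr pair => /=; ring. Qed.

(** The symmetric window covers half a step around the axis on both sides of the origin, and the
    rotations advance by one step [d] through half a turn. By the symmetry the angle [t] may be
    taken in [0, pi]; it is then rotated as close to pi as possible. *)
Lemma Vang_cover j u : dot u u = 1 ->
  exists2 l, (l < nrot alpha j)%N & 1 <= Vang alpha V j l u.
Proof.
move=> u1; rewrite /Vang /nrot /omega; set n := ang_level alpha j.
have pi0 := pi_gt0 R; set d := pi * 2 ^- n.
have p : 0 < (2 : R) ^+ n by rewrite exprn_gt0.
have d0 : 0 < d by rewrite divr_gt0.
wlog : u u1 / exists2 t, 0 <= t <= pi & u = (cos t, sin t) => [hw|[t /andP[t0 t1] ->]].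
  have [a b c] := angleP u1; have [t0|t0] := leP 0 (angle u).
    by apply: hw => //; exists (angle u) => //; rewrite t0.
  have [||l ln] := hw (- u); first by rewrite -u1 /dot /=; ring.
    exists (angle u + pi); first by apply/andP; split; lra.
    by rewrite {1}a cosDpi sinDpi.
  by rewrite rotvN Vang0N => h; exists l.
(* Adding 1/2 makes the truncation [m] a nearest integer to [(pi - t) / d]. *)
pose q := (pi - t) / d + 1 / 2.
have q0 : 0 <= q by rewrite addr_ge0 ?divr_ge0 // ?subr_ge0 // ltW.
have /andP[m1 m2] := truncn_itv q0; set m := Num.truncn q in m1 m2.
have qE : (pi - t) = (q - 1 / 2) * d by rewrite /q addrK divfK // gt_eqF.
have bnd : `|t + m%:R * d - pi| <= pi / 2 * 2 ^- n.
  rewrite (_ : t + m%:R * d - pi = (m%:R - q + 1 / 2) * d); last first.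
    transitivity (m%:R * d - (pi - t)); [by ring|rewrite qE; ring].
  rewrite normrM (gtr0_norm d0) /d mulrA [X in _ <= X](_ : _ = 1 / 2 * pi * 2 ^- n); last by ring.
  rewrite ler_pM2r ?invr_gt0 // ler_pM2r // ler_norml; rewrite -natr1 in m2.
  by apply/andP; split; lra.
have mle : (m <= 2 ^ n)%N.
  rewrite -ltnS -(ltr_nat R); apply: le_lt_trans m1 _; rewrite -natr1 natrX.
  have : (pi - t) / d <= 2 ^+ n; last by rewrite /q; lra.
  by rewrite ler_pdivrMr // /d mulrCA divff ?gt_eqF //; lra.
(* The value [m = 2 ^ n] is not an admissible rotation index, but it would be half a turn: then [t]
   itself lies within half a step of 0 and index 0 serves. *)
move: mle; rewrite leq_eqVlt => /orP[/eqP mE|mlt].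
  exists 0%N; first by rewrite expn_gt0.
  rewrite mul0r rotv_angle addr0; apply: Vang0_ge1; apply: le_trans bnd.
  by rewrite mE natrX /d mulrCA divff ?gt_eqF // mulr1 addrK.
exists m => //; rewrite rotv_angle.
have -> : t + m%:R * d = (t + m%:R * d - pi) + pi by rewrite subrK.
rewrite cosDpi sinDpi -[X in Vang0 _ _ _ X]/(- (_, _)) Vang0N; exact: Vang0_ge1.
Qed.

End windows.

(** * Lower bound and measurability of the normalizing sum *)

Section partition.
Context {R : realType}.
Local Notation RR := (measurableTypeR R).
Local Notation PP := (RR * RR)%type.
Local Notation mu := (@lebesgue_measure R).
Local Notation mu2 := (mu \x mu)%E.
Context (alpha : R) (W0 W V : R -> R).
Context (hgen : curvelet_generators W0 W V).
Implicit Types (x u : R * R).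

Local Notation Wrad := (Wrad W0 W).
Local Notation Vang := (Vang alpha V).
Local Notation nrot := (nrot alpha).
Local Notation Psi := (Psi alpha W0 W V).
Local Notation chi0 := (chi0 alpha W0 W V).
Local Notation chi := (chi alpha W0 W V).

Definition ring_sum j x : R :=
  \sum_(l < nrot j) Wrad j (enorm x) ^+ 2 * Vang j l (dir x) ^+ 2.

Lemma ring_sum_ge0 j x : 0 <= ring_sum j x.
Proof. by apply: sumr_ge0 => l _; rewrite mulr_ge0 // sqr_ge0. Qed.

Lemma Wrad_eventually0 x : exists n, forall j, (n < j)%N -> Wrad j (enorm x) = 0.
Proof.
have e0 := enorm_ge0 x; exists (Num.truncn (8 * pi * enorm x)).+1 => -[//|j] nj.
apply/eqP/negP => /negP /(Wrad_supp_ge hgen e0); apply/negP; rewrite -ltNge.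
apply: (lt_le_trans (truncnS_gt _)); rewrite -natrX ler_nat.
by apply: (leq_trans (n := j)) => //; rewrite ltnW // ltn_expl.
Qed.

(** Only finitely many rings meet a given point. The cutoff [m] is left free, so that a given ring
    can be included in the sum or the partial sums followed to their limit. *)
Lemma Psi_eventually x : exists n, forall m, (n < m)%N ->
  Wrad 0 (enorm x) ^+ 2 + \sum_(1 <= j < m) ring_sum j x = Psi x.
Proof.
have [n hn] := Wrad_eventually0 x; exists n => m nm.
have z j : (n < j)%N -> ring_sum j x = 0.
  by move=> nj; rewrite /ring_sum big1 // => l _; rewrite hn // expr0n mul0r.
congr (_ + _); rewrite -[LHS]/(fine (_%:E)); congr fine; apply/esym.
apply: lim_near_cst; first exact: ereal_hausdorff.
exists m => // k /= mk; rewrite sumEFin; congr EFin.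
rewrite (big_cat_nat (n := m)) //=; last by apply: leq_trans nm.
rewrite [X in _ + X]big_nat [X in _ + X]big1 ?addr0 // => j /andP[mj _].
exact/z/(leq_trans nm).
Qed.

Lemma ring_sum_le_Psi j x : (0 < j)%N -> ring_sum j x <= Psi x.
Proof.
move=> j0; have [n hn] := Psi_eventually x; rewrite -(hn (maxn n j).+1); last first.
  by rewrite ltnS leq_maxl.
rewrite (bigD1_seq j) ?iota_uniq //=; last by rewrite mem_index_iota j0 ltnS leq_maxr.
rewrite addrCA lerDl addr_ge0 ?sqr_ge0 // sumr_ge0 // => i _; exact: ring_sum_ge0.
Qed.

Lemma enorm_eq0 x : (enorm x == 0) = (x == 0).
Proof.
rewrite -sqrf_eq0 enorm_sqr /dot -!expr2 paddr_eq0 ?sqr_ge0 // !sqrf_eq0.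
by case: x.
Qed.

(** With [r = 8 * pi * |x|], the coarse window is 1 for [r <= 3/2]. Otherwise take the least [j]
    with [r <= 3/2 * 2^j]: minimality gives [r > 3/4 * 2^j], so the window at scale [j] is 1, and
    [Vang_cover] supplies an angular factor at least 1. *)
Lemma Psi_ge1 x : 1 <= Psi x.
Proof.
have e0 := enorm_ge0 x; have r0 := pi8_ge0 e0; set r := 8 * pi * enorm x in r0.
have [r1|r1] := leP r (3 / 2).
  have [n hn] := Psi_eventually x; rewrite -(hn n.+1) // /Wrad /= (W0_one hgen) ?r0 //.
  by rewrite expr1n lerDl sumr_ge0 // => i _; exact: ring_sum_ge0.
have ex : exists j, r <= 3 / 2 * 2 ^+ j.
  exists (Num.truncn r).+1; apply: ltW; apply: (lt_le_trans (truncnS_gt _)).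
  have h : (Num.truncn r).+1%:R <= (2 : R) ^+ (Num.truncn r).+1.
    by rewrite -natrX ler_nat ltnW // ltn_expl.
  by apply: (le_trans h); rewrite ler_peMl ?exprn_ge0 //; lra.
case: (ex_minnP ex) => -[|j]; first by rewrite expr0 mulr1 leNgt r1.
move=> jle jmin; have jgt : 3 / 2 * 2 ^+ j < r.
  by rewrite ltNge; apply/negP => /jmin; rewrite ltnn.
have x0 : x != 0.
  by rewrite -enorm_eq0; apply/negP => /eqP h; move: r1; rewrite /r h mulr0; lra.
have [l ln hl] := @Vang_cover _ alpha _ _ _ hgen j.+1 _ (etrans (dot_dir x) (f_equal _ (f_equal _ x0))).
apply: le_trans (@ring_sum_le_Psi j.+1 x _) => //.
have hW : Wrad j.+1 (enorm x) = 1.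
  have p : 0 < (2 : R) ^+ j.+1 by rewrite exprn_gt0.
  apply: (W_one hgen); rewrite -/r [2 ^- _ * _]mulrC ler_pdivlMr // ler_pdivrMr // jle andbT.
  by rewrite exprS; lra.
rewrite /ring_sum hW (bigD1 (Ordinal ln)) //= expr1n mul1r.
apply: (@le_trans _ _ (Vang j.+1 l (dir x) ^+ 2)).
  by rewrite -(expr1n _ 2) ler_pXn2r ?nnegrE // (le_trans ler01).
by rewrite lerDl sumr_ge0 // => i _; rewrite mulr_ge0 ?sqr_ge0.
Qed.

Lemma Psi_gt0 x : 0 < Psi x.
Proof. exact: lt_le_trans (Psi_ge1 x). Qed.

Lemma measurable_Wrad j : @measurable_fun _ _ PP R setT (fun x : PP => Wrad j (enorm (x : R * R))).
Proof.
have m1 : @measurable_fun _ _ PP R setT (fun x : PP => 8 * pi * enorm (x : R * R)).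
  by apply: measurable_funM; [exact: measurable_cst|exact: measurable_enorm].
have p1 (x : PP) : 0 <= 8 * pi * enorm (x : R * R) by apply/pi8_ge0/enorm_ge0.
rewrite /Defs.Wrad; case: j => [|j] /=; first exact: (smooth_Rplus_measurable (W0_smooth hgen)).
apply: (smooth_Rplus_measurable (W_smooth hgen)).
  by apply: measurable_funM; [exact: measurable_cst|exact: m1].
by move=> x; rewrite mulr_ge0 // invr_ge0 exprn_ge0.
Qed.

Lemma measurable_Vang j l : @measurable_fun _ _ PP R setT (fun x : PP => Vang j l (dir (x : R * R))).
Proof.
have m1 := @measurable_dir1 R; have m2 := @measurable_dir2 R.
pose a (x : PP) := (rotv (omega alpha j l) (dir (x : R * R))).1.
pose b (x : PP) := (rotv (omega alpha j l) (dir (x : R * R))).2.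
have ma : @measurable_fun _ _ PP R setT a.
  by apply: measurable_funB; apply: measurable_funM => //; exact: measurable_cst.
have mb : @measurable_fun _ _ PP R setT b.
  by apply: measurable_funD; apply: measurable_funM => //; exact: measurable_cst.
have a1 (x : PP) : `|a x| <= 1 by apply: fst_le1; rewrite dot_rotv dot_dir_le1.
have mV := smooth_measurable (V_smooth hgen).
have h (f : PP -> R) : @measurable_fun _ _ PP R setT f ->
    @measurable_fun _ _ PP R setT (fun x => V (2 ^+ ang_level alpha j * f x)).
  move=> mf; apply: (measurableT_comp mV).
  by apply: measurable_funM; [exact: measurable_cst|exact: mf].
apply: measurable_funD; apply: h; first exact: measurable_angle.
apply: (@measurable_angle _ (fun x => - a x) (fun x => - b x)); try exact: measurable_funN.
by move=> x; rewrite normrN.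
Qed.

Lemma measurable_Psi : @measurable_fun _ _ PP R setT (fun x : PP => Psi (x : R * R)).
Proof.
have mW j := measurable_funX 2 (measurable_Wrad j).
apply: (@measurable_fun_cvg _ PP _ _ (fun m (x : PP) =>
    Wrad 0 (enorm (x : R * R)) ^+ 2 + \sum_(1 <= j < m) ring_sum j (x : R * R))).
  move=> m; apply: measurable_funD => //; apply: measurable_sum => j.
  apply: measurable_sum => l; apply: measurable_funM => //.
  exact: (measurable_funX 2 (measurable_Vang j l)).
move=> x _; have [n hn] := Psi_eventually x.
by apply: cvg_near_cst; exists n.+1 => // m /= nm; rewrite hn.
Qed.

End partition.

Section multipliers.
Context {R : realType}.
Local Notation RR := (measurableTypeR R).
Local Notation PP := (RR * RR)%type.
Local Notation mu := (@lebesgue_measure R).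
Local Notation mu2 := (mu \x mu)%E.
Context (alpha : R) (W0 W V : R -> R).
Context (hgen : curvelet_generators W0 W V).
Implicit Types (x y u : R * R).

Local Notation Wrad := (Wrad W0 W).
Local Notation Vang := (Vang alpha V).
Local Notation nrot := (nrot alpha).
Local Notation omega := (omega alpha).
Local Notation Psi := (Psi alpha W0 W V).
Local Notation chi0 := (chi0 alpha W0 W V).
Local Notation chi := (chi alpha W0 W V).
Local Notation ring_sum := (ring_sum alpha W0 W V).

Lemma measurable_inv_sqrt_Psi :
  @measurable_fun _ _ PP R setT (fun x : PP => (Num.sqrt (Psi (x : R * R)))^-1).
Proof.
apply: measurable_funV_ge0; first by move=> x; exact: sqrtr_ge0.
apply: (measurableT_comp (f := @Num.sqrt R)); last exact: (measurable_Psi alpha hgen).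
by apply: continuous_measurable_fun; exact: sqrt_continuous.
Qed.

(** Common to [chi0], with factor 1, and to [chi], with an angular factor. The bound [Psi >= 1]
    makes the denominator harmless. *)
Lemma bcs_window (j : nat) (M : R) (v : PP -> R) : @measurable_fun _ _ PP R setT v ->
  (forall x, 0 <= v x <= M) ->
  bcs (fun x : R * R => (Wrad j (enorm x) * v x / Num.sqrt (Psi x))%:C).
Proof.
move=> mv v01; apply: (@bcsP _ _ (M ^+ 2) (2 ^+ j)).
- apply: cmfR; apply: measurable_funM; last exact: measurable_inv_sqrt_Psi.
  by apply: measurable_funM => //; exact: (measurable_Wrad hgen j).
- move=> x; rewrite sqmR.
  have /andP[a0 a1] := Wrad_itv hgen j (enorm_ge0 x); have /andP[b0 b1] := v01 x.
  have s1 : 1 <= Num.sqrt (Psi x) by rewrite -sqrtr1 ler_sqrt ?(Psi_ge1 alpha hgen) // ltW ?(Psi_gt0 alpha hgen).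
  have s0 : 0 < Num.sqrt (Psi x) by exact: lt_le_trans s1.
  have M0 : 0 <= M by exact: le_trans b1.
  rewrite ler_pXn2r ?nnegrE ?divr_ge0 ?mulr_ge0 ?(ltW s0) //.
  rewrite ler_pdivrMr //; apply: (@le_trans _ _ M); last by rewrite ler_peMr.
  by rewrite -[X in _ <= X]mul1r ler_pM.
move=> x nb; suff -> : Wrad j (enorm x) = 0 by rewrite !mul0r.
apply/eqP/negP => /negP /(Wrad_supp hgen (enorm_ge0 x)) h; apply: nb; apply/boxP.
have e2 := enorm_sqr x; have e0 := enorm_ge0 x.
have el : enorm x <= 2 ^+ j.
  by apply: le_trans h; rewrite ler_peMl //; have := pi_ge2 R; lra.
have c (a b : R) : enorm x ^+ 2 = a ^+ 2 + b ^+ 2 -> `|a| <= 2 ^+ j.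
  move=> h1; apply: le_trans el; rewrite -(@ler_pXn2r _ 2) ?nnegrE //.
  by rewrite real_normK ?num_real // h1 lerDl sqr_ge0.
by split; [apply: (c x.1 x.2)|apply: (c x.2 x.1)]; rewrite e2 /dot; ring.
Qed.

Lemma bcs_chi0 : bcs (fun x : R * R => (chi0 x)%:C).
Proof.
have := @bcs_window 0 1 (fun=> 1) (@measurable_cst _ _ PP _ _ _).
under eq_fun do rewrite mulr1; apply => x; lra.
Qed.

Lemma bcs_chi j l : bcs (fun x : R * R => (chi j l x)%:C).
Proof.
apply: (@bcs_window j 2); first exact: (measurable_Vang alpha hgen j l).
by move=> x; exact: (Vang_itv alpha hgen).
Qed.

(** By definition of [Psi] the squared numerators add up to the squared denominator. The factor [c]
    stands for the squared modulus of a transform at [x]. *)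
Lemma chi_sqr_sum (c : R) x : 0 <= c -> ((c * chi0 x ^+ 2)%:E +
  \esum_(p in [set p : nat * nat | (0 < p.1)%N /\ (p.2 < nrot p.1)%N])
    (c * chi p.1 p.2 x ^+ 2)%:E = c%:E)%E.
Proof.
move=> c0; have P0 := Psi_gt0 alpha hgen x; have [n hn] := Psi_eventually alpha hgen x.
have sP : Num.sqrt (Psi x) ^+ 2 = Psi x by rewrite sqr_sqrtr // ltW.
pose d := c / Psi x; have d0 : 0 <= d by rewrite divr_ge0 // ltW.
have t0 j l : (0 <= (c * chi j l x ^+ 2)%:E)%E by rewrite lee_fin mulr_ge0 // sqr_ge0.
have -> : (\esum_(p in [set p : nat * nat | (0 < p.1)%N /\ (p.2 < nrot p.1)%N])
    (c * chi p.1 p.2 x ^+ 2)%:E = \esum_(j in [set j : nat | (0 < j)%N])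
     (ring_sum j x * d)%:E)%E.
  rewrite -[LHS](@esum_esum _ _ _ [set j : nat | (0 < j)%N] (fun j => `I_(nrot j))
    (fun j l => (c * chi j l x ^+ 2)%:E)) //.
  apply: eq_esum => j _; rewrite esum_fset ?finite_II //.
  rewrite -(@fsbig_ord _ _ _ (nrot j) (fun l => (c * chi j l x ^+ 2)%:E)) sumEFin.
  rewrite /ring_sum mulr_suml; congr EFin; apply: eq_bigr => l _.
  by rewrite /Defs.chi expr_div_n sP exprMn mulrCA.
rewrite -[X in (_ + X)%E](@nneseries_esum _ (fun j => (ring_sum j x * d)%:E) (fun j => (0 < j)%N)); last first.
  by move=> j _; rewrite lee_fin mulr_ge0 // ring_sum_ge0.
rewrite (_ : limn _ = ((Psi x - Wrad 0 (enorm x) ^+ 2) * d)%:E).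
  rewrite /Defs.chi0 expr_div_n sP -EFinD; congr EFin; rewrite /d; field; exact: lt0r_neq0.
apply: lim_near_cst; first exact: ereal_hausdorff.
exists n.+1 => // m /= nm; rewrite sumEFin -(hn m nm) addrAC subrr add0r.
(* The series starts at 0 under the condition [0 < j], the sum in [Psi] at 1. *)
rewrite big_ltn_cond ?(leq_trans _ nm) //= mulr_suml; congr EFin.
by rewrite [LHS]big_nat_cond [RHS]big_nat; apply: eq_bigl => -[|j] /=; rewrite ?andbT.
Qed.

(** The inverse transpose of the linear map that sends the integer lattice to the grid: the rotation
    is orthogonal and the dilation symmetric, so only the dilation is inverted. *)
Definition lattice_chart j l y : R * R :=
  rotv (- omega j l) (2 ^+ j * y.1, (2 ^+ j) `^ alpha * y.2).

Lemma omega_itv j l : (l < nrot j)%N -> 0 <= omega j l < pi.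
Proof.
have pi0 := pi_gt0 R; have p : 0 < (2 : R) ^+ ang_level alpha j by rewrite exprn_gt0.
rewrite /Defs.omega /Defs.nrot -(ltr_nat R) natrX => h.
rewrite mulrA mulr_ge0 ?mulr_ge0 ?invr_ge0 ?(ltW pi0) ?(ltW p) //=.
by rewrite ltr_pdivrMr // mulrC ltr_pM2l.
Qed.

Lemma scales_chart j l : (l < nrot j)%N ->
  scales mu2 (lattice_chart j l : PP -> PP) (2 ^+ j * (2 ^+ j) `^ alpha)^-1.
Proof.
move=> /omega_itv/andP[w0 w1]; have p : 0 < (2 : R) ^+ j by rewrite exprn_gt0.
(* As [omega j l < pi], half the angle stays within a quarter turn, as the decomposition into shears
   requires. *)
have c0 : cos (- omega j l / 2) != 0.
  by apply: lt0r_neq0; apply: cos_gt0_pihalf; apply/andP; split; lra.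
apply: eq_scales (scales_comp (scales_rotv c0) (scales_dilate p (powR_gt0 alpha p))) _ _ => //.
by rewrite mul1r.
Qed.

Lemma chr_chart j l k y : chr (grid alpha j l k) (lattice_chart j l y) = chr (int2 k) y.
Proof.
rewrite /chr dot_rotv /dot /dil_inv /=; congr (expi (- (_ * _))).
have p : 0 < (2 : R) ^+ j by rewrite exprn_gt0.
have q := powR_gt0 alpha p.
by congr (_ + _); rewrite mulrACA mulVf ?mul1r // gt_eqF.
Qed.

Lemma weight_sqr j : ((2 : R) `^ (- (j%:R * (1 + alpha) / 2))) ^+ 2 =
  (2 ^+ j * (2 ^+ j) `^ alpha)^-1.
Proof.
rewrite -powR_mulrn ?powR_ge0 // -powRrM mulNr divfK ?pnatr_eq0 //.
by rewrite powRN mulrDr mulr1 powRD ?pnatr_eq0 ?implybT // powRrM powR_mulrn.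
Qed.

Lemma enorm_rotv t x : enorm (rotv t x) = enorm x.
Proof. by rewrite /enorm dot_rotv. Qed.

Lemma dir_rotv t x : dir (rotv t x) = rotv t (dir x).
Proof. by rewrite /dir enorm_rotv; congr pair => /=; ring. Qed.

(** The floor loses less than one unit, [j * (1 - alpha) < ang_level alpha j + 1], hence the factor
    2. *)
Lemma ang_level_bound (a : 0 <= alpha <= 1) j :
  (2 : R) ^+ j <= 2 * 2 ^+ ang_level alpha j * (2 ^+ j) `^ alpha.
Proof.
have p : 0 < (2 : R) ^+ j by rewrite exprn_gt0.
rewrite -exprS -!powR_mulrn // -powRrM -powRD ?pnatr_eq0 ?implybT //.
rewrite ler_powR ?ler1n //; have := truncnS_gt (j%:R * (1 - alpha)).
by rewrite -/(ang_level alpha j); lra.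
Qed.

(** The radial window gives [|z| <= 2^j / (4 pi)], so [|y.1| <= 1/(4 pi)]. The angular window gives
    [|z.2| <= 3/4 * pi * m * |z| <= 3/16 * m * 2^j], which by [ang_level_bound] is at most 3/8 times
    the dilation factor of the second axis. This is parabolic scaling for general [alpha]: the
    angular width compensates the weaker dilation. *)
Lemma chi_chart_eq0 (a : 0 <= alpha <= 1) j l y : (0 < j)%N ->
  chi j l (lattice_chart j l y) != 0 -> `|y.1| <= 3 / 8 /\ `|y.2| <= 3 / 8.
Proof.
move=> j0; rewrite /chi /lattice_chart enorm_rotv dir_rotv /Vang.
rewrite -{1}(opprK (omega j l)) rotvK; set z := (_ , _).
have p : 0 < (2 : R) ^+ j by rewrite exprn_gt0.
have q := powR_gt0 alpha p; have pi2 := pi_ge2 R; have pi0 := pi_gt0 R.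
rewrite mulf_eq0 negb_or mulf_eq0 negb_or => /andP[/andP[w0 v0] _].
have e0 := enorm_ge0 z; have wle := Wrad_supp hgen e0 w0.
(* For [j > 0] the radial window vanishes near the origin, so the direction of [z] is a unit
   vector. *)
have ep : 0 < enorm z.
  move: j0 w0; case: (j) => // i _ /(Wrad_supp_ge hgen e0).
  rewrite lt_def e0 andbT; apply: contraTneq => ->.
  by rewrite mulr0 -ltNge exprn_gt0.
have d1 : dot (dir z) (dir z) = 1 by rewrite dot_dir -enorm_eq0 (gt_eqF ep).
have z1 : `|z.1| <= enorm z.
  have := fst_le1 (dot_dir_le1 z); rewrite /= normrM normfV (gtr0_norm ep).
  by rewrite ler_pdivrMr // mul1r.
split.
  have : 4 * pi * (2 ^+ j * `|y.1|) <= 2 ^+ j.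
    apply: le_trans wle; rewrite ler_pM2l ?mulr_gt0 //; apply: le_trans z1.
    by rewrite normrM (gtr0_norm p).
  rewrite mulrCA -[X in _ <= X]mulr1 ler_pM2l // => h.
  suff : 8 * `|y.1| <= 1 by have := normr_ge0 y.1; lra.
  by apply: le_trans h; rewrite ler_wpM2r // ; lra.
have := Vang0_supp hgen d1 v0; rewrite /= normrM normfV (gtr0_norm ep) ler_pdivrMr //.
rewrite normrM (gtr0_norm q); set m := 2 ^- _ => h.
have m0 : 0 < m by rewrite invr_gt0 exprn_gt0.
have h1 : (2 ^+ j) `^ alpha * `|y.2| <= 3 / 16 * m * 2 ^+ j.
  apply: le_trans h _; rewrite (_ : 3 / 4 * pi * m * enorm z = 3 / 16 * m * (4 * pi * enorm z)); last by field.
  by rewrite ler_pM2l // mulr_gt0.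
have h2 : m * 2 ^+ j <= 2 * (2 ^+ j) `^ alpha.
  by rewrite mulrC ler_pdivrMr ?exprn_gt0 // mulrAC; exact: ang_level_bound.
rewrite -(ler_pM2l q); lra.
Qed.

End multipliers.

(** * The frame identity *)

Section assembly.
Context {R : realType}.
Local Notation RR := (measurableTypeR R).
Local Notation PP := (RR * RR)%type.
Local Notation mu := (@lebesgue_measure R).
Local Notation mu2 := (mu \x mu)%E.
Context (alpha : R) (W0 W V : R -> R).
Context (halpha : 0 <= alpha <= 1) (hgen : curvelet_generators W0 W V).

Local Notation chi0 := (chi0 alpha W0 W V).
Local Notation chi := (chi alpha W0 W V).
Local Notation curvelet := (curvelet alpha W0 W V).

(** The grid is the integer lattice and the chart the identity, since [4 * pi * |y| <= 1] already
    places the support of [chi0] within 3/8. *)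
Lemma curvelet_frame_coarse f : bcs f ->
  (\esum_(k in [set: int * int]) (sqm (inn mu2 f (curvelet (inl k))))%:E =
   n2 mu2 (fun xi => (ft f xi * (chi0 xi)%:C)%R))%E.
Proof.
move=> bf; have b0 := bcs_chi0 alpha hgen.
have sid : scales mu2 (fun x : PP => x) 1.
  apply: (eq_scales (scales_dilate (@ltr01 R) (@ltr01 R))); last by rewrite mulr1 invr1.
  by case=> a b; rewrite /= !mul1r.
have supp (y : R * R) : chi0 y != 0 -> `|y.1| <= 3 / 8 /\ `|y.2| <= 3 / 8.
  rewrite /Defs.chi0 mulf_eq0 negb_or => /andP[/(Wrad_supp hgen (enorm_ge0 y)) h _].
  have e2 := enorm_sqr y; have e0 := enorm_ge0 y; have pi2 := pi_ge2 R.
  have el : enorm y <= 3 / 8.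
    have h8 : 8 * enorm y <= 4 * pi * enorm y by rewrite ler_wpM2r //; lra.
    by move: h; rewrite expr0; lra.
  have c (a b : R) : enorm y ^+ 2 = a ^+ 2 + b ^+ 2 -> `|a| <= 3 / 8.
    move=> h1; apply: le_trans el; rewrite -(@ler_pXn2r _ 2) ?nnegrE //.
    by rewrite real_normK ?num_real // h1 lerDl sqr_ge0.
  by split; [apply: (c y.1 y.2)|apply: (c y.2 y.1)]; rewrite e2 /dot; ring.
rewrite -(@frame_piece _ (fun x => x) 1 1 int2 chi0 (psi0 alpha W0 W V) f sid) //; last 4 first.
- by rewrite expr1n.
- exact: inv_fourier2P.
- by move=> y; apply: contraTeq => /supp[h _]; rewrite -leNgt.
- by move=> y; apply: contraTeq => /supp[_ h]; rewrite -leNgt.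
apply: eq_esum => k _; congr (EFin (sqm (inn _ _ _))).
by apply/funext => y; rewrite mul1r.
Qed.

Lemma curvelet_frame_scale j l f : (0 < j)%N -> (l < nrot alpha j)%N -> bcs f ->
  (\esum_(k in [set: int * int]) (sqm (inn mu2 f (curvelet (inr (j, l, k)))))%:E =
   n2 mu2 (fun xi => (ft f xi * (chi j l xi)%:C)%R))%E.
Proof.
move=> j0 lj bf; have bc := bcs_chi alpha hgen j l.
have supp := @chi_chart_eq0 _ _ _ _ _ hgen halpha j l ^~ j0.
apply: (@frame_piece _ (lattice_chart alpha j l) _ _ (grid alpha j l) (chi j l)
  (psi alpha W0 W V j l) f (scales_chart lj) _ (weight_sqr alpha j)) => //.
- exact: inv_fourier2P.
- by move=> y; apply: contraTeq => /supp[h _]; rewrite -leNgt.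
- by move=> y; apply: contraTeq => /supp[_ h]; rewrite -leNgt.
- by move=> k y; exact: chr_chart.
Qed.

Lemma L2_curvelet i : L2 mu2 (curvelet i).
Proof.
have [L0 _ _] := inv_fourier2P (bcs_chi0 alpha hgen).
case: i => [k|[[j l] k]]; first exact: L2_translate.
have [L1 _ _] := inv_fourier2P (bcs_chi alpha hgen j l).
exact/L2Z/L2_translate.
Qed.

Definition piece_indices : set (nat * nat) :=
  [set p | (0 < p.1)%N /\ (p.2 < nrot alpha p.1)%N].

Lemma esum_curvelet_indices (F : curvelet_index -> \bar R) : (forall i, 0 <= F i)%E ->
  (\esum_(i in curvelet_indices alpha) F i =
   \esum_(k in [set: int * int]) F (inl k) +
   \esum_(p in piece_indices) \esum_(k in [set: int * int]) F (inr (p, k)))%E.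
Proof.
move=> F0; rewrite (esumID [set i : curvelet_index | if i is inl _ then True else False]) //.
congr (_ + _)%E.
  apply: (@reindex_esum _ _ _ _ _ inl F); split.
  - by move=> k _.
  - by move=> k k' _ _ [].
  - by case=> [k _|q [_ []]]; exists k.
rewrite (@esum_esum _ _ _ piece_indices (fun=> setT) (fun p k => F (inr (p, k)))) //.
apply: (@reindex_esum _ _ _ _ _ (fun q : (nat * nat) * (int * int) => inr (q.1, q.2) : curvelet_index) F); split.
- by case=> [[j l] k] [/= h _]; split.
- by move=> [a b] [a' b'] _ _ [-> ->].
- by case=> [k [_ /(_ I)]//|[[j l] k] [h _]]; exists (j, l, k).
Qed.

(** Integrates [chi_sqr_sum] term by term with [c] the squared modulus of [g]. The terms are
    extended by 0 to all pairs, as [integral_esum] sums over a whole countable type, and their sum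
    is measurable as the difference of two measurable functions. *)
Lemma n2_partition (g : PP -> R[i]) : cmf g ->
  (n2 mu2 (fun xi => (g xi * (chi0 xi)%:C)%R) +
   \esum_(p in piece_indices) n2 mu2 (fun xi => (g xi * (chi p.1 p.2 xi)%:C)%R) =
   n2 mu2 g)%E.
Proof.
move=> mg; have msq := measurable_sqm mg.
have m0 := measurable_sqm (cmfM mg (bcs_cmf (bcs_chi0 alpha hgen))).
have mp j l := measurable_sqm (cmfM mg (bcs_cmf (bcs_chi alpha hgen j l))).
pose t p xi := if p \in piece_indices then (sqm (g xi * (chi p.1 p.2 xi)%:C)%R)%:E else 0%E.
have t0 p xi : (0 <= t p xi)%E by rewrite /t; case: ifP => // _; rewrite lee_fin sqm_ge0.
have mt p : @measurable_fun _ _ PP _ setT (t p).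
  by rewrite /t; case: (p \in _); [apply/measurable_EFinP; exact: mp|exact: measurable_cst].
have st xi : (\esum_(p in [set: nat * nat]) t p xi =
    (sqm (g xi) - sqm (g xi * (chi0 xi)%:C))%:E)%E.
  have := chi_sqr_sum alpha hgen xi (sqm_ge0 (g xi)).
  rewrite esum_mkcond /= sqmM sqmR => h; rewrite EFinB -[in RHS]h addeAC subee // add0e.
  apply: eq_esum => p _; rewrite /t /piece_indices; case: ifP => // _.
  by rewrite sqmM sqmR.
have -> : (\esum_(p in piece_indices) n2 mu2 (fun xi => (g xi * (chi p.1 p.2 xi)%:C)%R) =
    \int[mu2]_xi (sqm (g xi) - sqm (g xi * (chi0 xi)%:C))%:E)%E.
  under [RHS]eq_integral do rewrite -st.
  rewrite (@integral_esum _ _ _ mu2 _ (0%N, 0%N) t mt t0) [LHS]esum_mkcond; apply: eq_esum => p _.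
  by rewrite /t /n2; case: (p \in _); rewrite ?integral0.
rewrite /n2 -ge0_integralD //.
- by apply: eq_integral => xi _; rewrite -EFinD addrC subrK.
- by move=> xi _; rewrite lee_fin sqm_ge0.
- exact/measurable_EFinP.
- by move=> xi _; rewrite -st esum_ge0.
- by apply/measurable_EFinP; exact: measurable_funB.
Qed.

Lemma curvelet_frame_bcs f : bcs f ->
  fsum mu2 (curvelet_indices alpha) curvelet f = n2 mu2 f.
Proof.
move=> bf; rewrite /fsum esum_curvelet_indices; last by move=> i; rewrite lee_fin sqm_ge0.
rewrite curvelet_frame_coarse // -(plancherel_bcs bf) -(n2_partition (cmf_ft (bcs_cmf bf))).
congr (_ + _)%E; apply: eq_esum => -[j l] [/= j0 lj].
exact: curvelet_frame_scale.
Qed.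

Lemma curvelet_parseval f : L2 mu2 f ->
  fsum mu2 (curvelet_indices alpha) curvelet f = n2 mu2 f.
Proof.
apply: (@fsum_dense _ _ _ mu2 _ _ _ (fun i _ => L2_curvelet i) (@bcs R)).
  by move=> h bh; split; [exact: bcs_L2|exact: curvelet_frame_bcs].
move=> h Lh; exists (fun n => trunc n h); split; last exact: trunc_L2.
by move=> n; apply/bcs_trunc/(L2_cmf Lh).
Qed.

End assembly.

Theorem theorem3p2 (R : realType) (alpha : R) (W0 W V : R -> R)
    (halpha : 0 <= alpha <= 1) (hgen : curvelet_generators W0 W V) :
  tight_frame (curvelet_indices alpha) (curvelet alpha W0 W V).
Proof.
split=> [i _|]; first by apply/inLp2P; exact: L2_curvelet.
exists 1; split => // f /inLp2P Lf; rewrite mul1e cLnorm2_sqr.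
rewrite -(curvelet_parseval halpha hgen Lf).
by apply: eq_esum => i _; rewrite cmod_sqr.
Qed.
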